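(* Let $R\in(0,+\infty]$, let $\Omega=B_R(0)\subset\mathbb{R}^3$ (with $\Omega=\mathbb{R}^3$ if $R=+\infty$), let $a^2>0$, $c^2>0$, $b^2\ge0$ and $L_1,L_2,L_3\in\mathbb{R}$ with $\alpha=2L_1+\frac{4(L_2+L_3)}{3}>0$. Consider, for $Q:\Omega\to\mathcal{S}_0$, the system $$2L_1\Delta Q_{ij}+(L_2+L_3)\big(\nabla_j\nabla_kQ_{ik}+\nabla_i\nabla_kQ_{jk}\big)-\frac23(L_2+L_3)\nabla_l\nabla_kQ_{lk}\,\delta_{ij}=\Big(\frac{\partial f_{bulk}(Q)}{\partial Q}\Big)_{ij}-\frac{\delta_{ij}}{3}\,\mathrm{tr}\Big(\frac{\partial f_{bulk}(Q)}{\partial Q}\Big),\quad i,j=1,2,3,$$ in $\Omega$, with the bulk potential $$f_{bulk}(Q)=-\frac{a^2}{2}|Q|^2-\frac{b^2}{3}\mathrm{tr}(Q^3)+\frac{c^2}{4}|Q|^4,$$ and with the boundary condition $$Q(x)=s_+\Big(\frac{x}{|x|}\otimes\frac{x}{|x|}-\frac13 Id\Big)\quad\text{for }x\in\partial B_R(0)$$ if $R<+\infty$, respectively $$\lim_{|x|\to+\infty}\Big|Q(x)-s_+\Big(\frac{x}{|x|}\otimes\frac{x}{|x|}-\frac13Id\Big)\Big|=0$$ if $R=+\infty$. Then there exists a unique radially symmetric solution of this problem.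
   Context: $\mathcal{S}_0=\{Q\in\mathbb{R}^{3\times3}: Q=Q^t,\ \mathrm{tr}(Q)=0\}$ and $|Q|^2=\mathrm{tr}(Q^2)$. Repeated indices $k,l$ are summed over $1,2,3$. For $Q\in\mathcal{S}_0$, $\frac{\partial f_{bulk}(Q)}{\partial Q}=-a^2Q-b^2Q^2+c^2|Q|^2Q$, so that the system is the Euler–Lagrange system (for $\mathcal{S}_0$-valued maps) of $$\int_\Omega\Big[L_1|\nabla Q|^2+L_2\nabla_jQ_{ik}\nabla_kQ_{ij}+L_3\nabla_jQ_{ij}\nabla_kQ_{ik}+f_{bulk}(Q)\Big]dx.$$ The constant is $s_+=\frac{b^2+\sqrt{b^4+24a^2c^2}}{4c^2}$, the positive zero of $t\mapsto-a^2t-\frac{b^2}{3}t^2+\frac{2c^2}{3}t^3$. A measurable map $Q:\Omega\to\mathcal{S}_0$ is radially symmetric if $Q(\mathcal{R}x)=\mathcal{R}\,Q(x)\,\mathcal{R}^t$ for every $\mathcal{R}\in SO(3)$ and a.e. $x\in\Omega$. Solutions are understood in the classical sense ($Q\in C^2(\Omega)$, continuous up to $\partial\Omega$ when $R<+\infty$). *)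

(* Defs.v *)
From HB Require Import structures.
From mathcomp Require Import all_boot all_order all_algebra.
From mathcomp Require Import all_classical all_reals all_analysis.

Set Implicit Arguments.
Unset Strict Implicit.
Unset Printing Implicit Defensive.

Import Order.TTheory GRing.Theory Num.Theory.
Import numFieldNormedType.Exports.

Local Open Scope classical_set_scope.
Local Open Scope ring_scope.

(* The normed-module norm of the library on matrices is the sup norm, hence
   the explicit Euclidean norm. *)
Definition enorm {R : realType} (x : 'cV[R]_3) : R :=
  Num.sqrt (\sum_k x k 0 ^+ 2).

Definition oball {R : realType} (rho : \bar R) : set 'cV[R]_3 :=
  [set x | ((enorm x)%:E < rho)%E].

Definition cball {R : realType} (rho : \bar R) : set 'cV[R]_3 :=
  [set x | ((enorm x)%:E <= rho)%E].

Definition S0 {R : realType} : set 'M[R]_3 :=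
  [set Q | Q^T = Q /\ \tr Q = 0].

(* |Q|^2 = tr(Q^2); this is a squared norm on S0. *)
Definition qnorm2 {R : realType} (Q : 'M[R]_3) : R := \tr (Q *m Q).

Definition qnorm {R : realType} (Q : 'M[R]_3) : R := Num.sqrt (qnorm2 Q).

(* Throughout, a2, b2 and c2 stand for the material constants a^2, b^2, c^2. *)
Definition fbulk {R : realType} (a2 b2 c2 : R) (Q : 'M[R]_3) : R :=
  - (a2 / 2) * qnorm2 Q - b2 / 3 * \tr (Q *m Q *m Q)
  + c2 / 4 * qnorm2 Q ^+ 2.

(* The gradient with respect to the nine entries of Q; for symmetric Q it is
   - a2 Q - b2 Q^2 + c2 |Q|^2 Q. *)
Definition dfbulk {R : realType} (a2 b2 c2 : R) (Q : 'M[R]_3) : 'M[R]_3 :=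
  \matrix_(i < 3, j < 3) 'D_(delta_mx i j) (fbulk a2 b2 c2) Q.

Definition splus {R : realType} (a2 b2 c2 : R) : R :=
  (b2 + Num.sqrt (b2 ^+ 2 + 24 * a2 * c2)) / (4 * c2).

(* s (x/|x| (x) x/|x| - Id/3), used for x != 0 only. *)
Definition hedgehog {R : realType} (s : R) (x : 'cV[R]_3) : 'M[R]_3 :=
  let n := (enorm x)^-1 *: x in s *: (n *m n^T - (3^-1)%:M).

Definition partial {R : realType} (k : 'I_3) (f : 'cV[R]_3 -> R) :
    'cV[R]_3 -> R :=
  fun x => 'D_(delta_mx k 0) f x.

Definition C2_on {R : realType} (A : set 'cV[R]_3) (f : 'cV[R]_3 -> R) : Prop :=
  forall x, A x ->
    {for x, continuous f} /\
    forall i, [/\ derivable f x (delta_mx i 0),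
                  {for x, continuous (partial i f)} &
      forall j, derivable (partial i f) x (delta_mx j 0) /\
                {for x, continuous (partial j (partial i f))}].

Definition elastic {R : realType} (L1 L2 L3 : R) (Q : 'cV[R]_3 -> 'M[R]_3)
    (x : 'cV[R]_3) (i j : 'I_3) : R :=
  2 * L1 * (\sum_k partial k (partial k (fun y => Q y i j)) x)
  + (L2 + L3) * (\sum_k partial j (partial k (fun y => Q y i k)) x
                 + \sum_k partial i (partial k (fun y => Q y j k)) x)
  - 2 / 3 * (L2 + L3)
    * (\sum_l \sum_k partial l (partial k (fun y => Q y l k)) x) * (i == j)%:R.

Definition EL_system {R : realType} (L1 L2 L3 a2 b2 c2 : R) (A : set 'cV[R]_3)
    (Q : 'cV[R]_3 -> 'M[R]_3) : Prop :=
  forall x, A x -> forall i j : 'I_3,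
    elastic L1 L2 L3 Q x i j =
    dfbulk a2 b2 c2 (Q x) i j - (i == j)%:R / 3 * \tr (dfbulk a2 b2 c2 (Q x)).

(* The first clause is vacuous for rho = +oo. *)
Definition boundary_condition {R : realType} (s : R) (rho : \bar R)
    (Q : 'cV[R]_3 -> 'M[R]_3) : Prop :=
  (forall x, (enorm x)%:E = rho -> Q x = hedgehog s x) /\
  (rho = +oo%E ->
   forall eps, 0 < eps -> exists M, forall x, M < enorm x ->
     qnorm (Q x - hedgehog s x) < eps).

(* Maps are total functions, of which only the values on cball rho matter; when
   rho = +oo, cball rho and oball rho are both the whole space. *)
Definition classical_solution {R : realType} (L1 L2 L3 a2 b2 c2 : R)
    (rho : \bar R) (Q : 'cV[R]_3 -> 'M[R]_3) : Prop :=
  [/\ forall x, oball rho x -> S0 (Q x),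
      forall i j, C2_on (oball rho) (fun x => Q x i j),
      {within cball rho, continuous Q},
      EL_system L1 L2 L3 a2 b2 c2 (oball rho) Q &
      boundary_condition (splus a2 b2 c2) rho Q].

Definition point3 {R : realType} (p : R * R * R) : 'cV[R]_3 :=
  \col_(k < 3) tnth [tuple p.1.1; p.1.2; p.2] k.

Definition lebesgue3 {R : realType} :=
  ((@lebesgue_measure R \x @lebesgue_measure R) \x @lebesgue_measure R)%E.

Definition SO3 {R : realType} : set 'M[R]_3 :=
  [set O | O *m O^T = 1%:M /\ \det O = 1].

(* Measurability is with respect to the Borel sets; like Lebesgue measurability
   it is automatic for maps that are continuous on A. *)
Definition radially_symmetric {R : realType} (A : set 'cV[R]_3)
    (Q : 'cV[R]_3 -> 'M[R]_3) : Prop :=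
  (forall i j, measurable_fun (point3 @^-1` A) (fun p => Q (point3 p) i j)) /\
  forall O, SO3 O ->
    {ae lebesgue3, forall p, A (point3 p) ->
      Q (O *m point3 p) = O *m Q (point3 p) *m O^T}.

(* Main.v *)
(** Radial symmetry holds everywhere by continuity, and invariance under the stabiliser of [x]
    forces [Q x = w(|x|) (x x^T - |x|^2/3 Id)]; the system becomes [w'' + 6 w'/r = w g(r^2 w)]
    with [g(v) = (v - s_+)(C v + D)] and [C], [D] positive.

    Uniqueness: for [v = r^2 w], the maximum principle gives [v <= s_+] and an energy argument at
    a negative minimum gives [v >= 0], so [g <= 0] and [w] is nonincreasing; for [mu < 1]
    the dilation [mu^2 w(mu r)] is a strict subsolution, and sliding in [mu] compares any two
    solutions.

    Existence: the equation with [v] truncated to [[0, s_+]] is solved from [w 0 = b] by a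
    contraction in a weighted sup norm. For finite [R], choose [b] by shooting; for infinite [R],
    take a limit of the initial values of the solutions on growing balls. The limiting [v] is
    nondecreasing and bounded, and its limit at infinity can only be [s_+]. *)
From HB Require Import structures.
Require Import Defs.
From mathcomp Require Import all_boot all_order all_algebra.
From mathcomp Require Import all_classical all_reals all_analysis.
From mathcomp Require Import measurable_realfun.
From mathcomp Require Import ring lra.
Set Implicit Arguments.
Unset Strict Implicit.
Unset Printing Implicit Defensive.

Import Order.TTheory GRing.Theory Num.Theory.
Import numFieldNormedType.Exports.
Local Open Scope classical_set_scope.
Local Open Scope ring_scope.

(** * Calculus on the line *)

(** The entries of [x x^T - |x|^2/3 Id] are harmonic of degree two, so on [w] times this tensor the
    elastic operator acts, up to the factor alpha, as [w'' + 6 w'/r], the radial Laplacian of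
    dimension seven. Passing from [v] to [w] removes the singular term [- 6 v / r^2] at the origin.
    Both unknowns are kept: [w] for regularity and for integrating [(r^6 w')' = r^6 w g], [v] for
    maximum principles.

    The obstacle is that [v g(v)] is not monotone on [[0, s_+]], so a plain comparison does not
    order two solutions. Dilation replaces it: [v(mu r)] solves the same equation with [g]
    multiplied by [mu^2], and [g <= 0]. Monotonicity of [v g(v)] is used only for [v >= 2 s_+ / 3],
    to control the noncompact end. Sliding a solution below itself shows that [v] is nondecreasing,
    and existence relies on this: it gives a positive lower bound at a fixed radius, uniform in the
    size of the ball, so the limit on growing balls is not the zero solution. The initial values
    stay bounded because the nonlinearity is at most a multiple of [b] and of [1/r^2]. *)

Lemma is_deriveDf {R : realType} {V : normedModType R} (f g : V -> R) x v a b :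
  is_derive x v f a -> is_derive x v g b ->
  is_derive x v (fun y => f y + g y) (a + b).
Proof. exact: is_deriveD. Qed.

Lemma is_deriveNf {R : realType} {V : normedModType R} (f : V -> R) x v a :
  is_derive x v f a -> is_derive x v (fun y => - f y) (- a).
Proof. exact: is_deriveN. Qed.

Lemma is_deriveMf {R : realType} {V : normedModType R} (f g : V -> R) x v a b :
  is_derive x v f a -> is_derive x v g b ->
  is_derive x v (fun y => f y * g y) (f x * b + g x * a).
Proof. exact: is_deriveM. Qed.

Lemma is_deriveXf {R : realType} {V : normedModType R} (f : V -> R) n x v a :
  is_derive x v f a ->
  is_derive x v (fun y => f y ^+ n) (n%:R * f x ^+ n.-1 * a).
Proof.
move=> H; have -> : (fun y => f y ^+ n) = (f ^+ n)%R.
  by apply/funext => y; elim: n => [|n IH]; rewrite ?expr0// !exprS IH.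
exact: is_deriveX.
Qed.

Lemma is_deriveVf {R : realType} (f : R -> R) (x v a : R) : f x != 0 ->
  is_derive x v f a -> is_derive x v (fun y => (f y)^-1) (- (f x) ^- 2 * a).
Proof. exact: is_deriveV. Qed.

Lemma is_derive_cstf {R : realType} {V : normedModType R} (c : R) (x v : V) :
  is_derive x v (fun=> c) 0.
Proof. exact: is_derive_cst. Qed.

(** The derivative value is an existential variable filled by unification; subterms without visible
    structure are closed by hypotheses, and [derive_eq] leaves the comparison of the two values. *)
Ltac der := lazymatch goal with
  | |- is_derive _ _ (fun y => @?f y + @?g y) _ =>
      eapply (@is_deriveDf _ _ f g); der
  | |- is_derive _ _ (fun y => - @?f y) _ => eapply (@is_deriveNf _ _ f); der
  | |- is_derive _ _ (fun y => @?f y * @?g y) _ =>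
      eapply (@is_deriveMf _ _ f g); der
  | |- is_derive _ _ (fun y => @?f y ^+ ?n) _ =>
      eapply (@is_deriveXf _ _ f n); der
  | |- is_derive _ _ (fun y => (@?f y)^-1) _ =>
      first [exact (is_derive_cstf _ _ _) | eapply (@is_deriveVf _ f); [ | der]]
  | |- is_derive _ _ (fun y => y) _ => exact (is_derive_id _ _)
  | |- is_derive _ _ (fun y => ?f y) _ => change (fun y => f y) with f;
      try eassumption
  | |- is_derive _ _ (fun y => ?c) _ => first [eassumption | exact (is_derive_cstf _ _ _)]
  | |- _ => try eassumption
  end.
Ltac derive_eq := eapply is_derive_eq; [der | ].

Lemma is_derive_continuous {R : realType} (f : R -> R) (x d : R) :
  is_derive x 1 f d -> {for x, continuous f}.
Proof.
by move=> [H _]; apply: differentiable_continuous; apply/derivable1_diffP.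
Qed.


Lemma continuous_itvW {R : realType} (f : R -> R) (a b : R) :
  (forall x, a <= x <= b -> {for x, continuous f}) ->
  {within `[a, b], continuous f}.
Proof.
move=> H; apply: continuous_in_subspaceT => x; rewrite inE /= in_itv /=.
exact: H.
Qed.

Lemma mean_value {R : realType} (f df : R -> R) (a b : R) : a < b ->
  (forall x, a <= x <= b -> {for x, continuous f}) ->
  (forall x, a < x < b -> is_derive x 1 f (df x)) ->
  exists2 c, a < c < b & f b - f a = df c * (b - a).
Proof.
move=> ab cf Df.
have Df' x : x \in `]a, b[%R -> is_derive x 1 f (df x).
  by rewrite in_itv /=; exact: Df.
have [c] := MVT ab Df' (continuous_itvW cf).
by rewrite in_itv /=; exists c.
Qed.

Lemma nonincr_of_derive {R : realType} (f df : R -> R) (a b : R) : a <= b ->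
  (forall x, a <= x <= b -> {for x, continuous f}) ->
  (forall x, a < x < b -> is_derive x 1 f (df x)) ->
  (forall x, a < x < b -> df x <= 0) -> f b <= f a.
Proof.
rewrite le_eqVlt => /orP[/eqP -> //|ab] cf Df dle.
have [c /dle dc E] := mean_value ab cf Df.
by rewrite -subr_le0 E mulr_le0_ge0// subr_ge0 ltW.
Qed.

Lemma nondecr_of_derive {R : realType} (f df : R -> R) (a b : R) : a <= b ->
  (forall x, a <= x <= b -> {for x, continuous f}) ->
  (forall x, a < x < b -> is_derive x 1 f (df x)) ->
  (forall x, a < x < b -> 0 <= df x) -> f a <= f b.
Proof.
rewrite le_eqVlt => /orP[/eqP -> //|ab] cf Df dle.
have [c /dle dc E] := mean_value ab cf Df.
by rewrite -subr_ge0 E mulr_ge0// subr_ge0 ltW.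
Qed.

Lemma incr_right_of_derive {R : realType} (f : R -> R) (x d : R) :
  is_derive x 1 f d -> 0 < d ->
  exists2 e, 0 < e & forall h, 0 < h < e -> f x < f (x + h).
Proof.
move=> [Df dE] d0; have := Df; rewrite /derivable => /cvg_ex[l Hl].
have ld : l = d by rewrite -dE; apply/esym/cvg_lim.
have : \forall h \near 0^', 0 < h^-1 *: (f (h *: 1 + x) - f x).
  by apply: (cvgr_gt l) => //; rewrite ld.
move=> /nbhs_ballP [e /= e0 He]; exists e => // h /andP[h0 he].
have := He h; rewrite /ball /= sub0r normrN gtr0_norm// => /(_ he).
rewrite gt_eqF// => /(_ isT).
change (0 < h^-1 * (f (h * 1 + x) - f x) -> f x < f (x + h)).
by rewrite pmulr_rgt0 ?invr_gt0// subr_gt0 mulr1 addrC.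
Qed.

(** If [d] were positive, [y1] would be positive just to the right of its zero [r], and the mean
    value theorem would lift [y] above [y r]. *)
Lemma second_derive_max {R : realType} (y y1 : R -> R) (r e d : R) : 0 < e ->
  (forall t, `|t - r| < e -> is_derive t 1 y (y1 t)) ->
  is_derive r 1 y1 d ->
  (forall t, `|t - r| < e -> y t <= y r) -> y1 r = 0 /\ d <= 0.
Proof.
move=> e0 Dy Dy1 ymax.
have B t : (t \in `]r - e, r + e[) = (`|t - r| < e).
  by rewrite in_itv /= ltr_distl.
have y10 : y1 r = 0.
  have re : `|r - r| < e by rewrite subrr normr0.
  have [_ <-] : is_derive r 1 y 0.
    apply: (@derive1_at_max R y (r - e) (r + e) r).
    - by lra.
    - by move=> t; rewrite B => /Dy [].
    - by rewrite B.
    - by move=> t; rewrite B => /ymax.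
  by have [_ <-] := Dy r re.
split=> //; rewrite leNgt; apply/negP => d0.
have [e' e'0 He'] := incr_right_of_derive Dy1 d0.
pose h := Num.min e e' / 2.
have [h0 he he'] : [/\ 0 < h, h < e & h < e'].
  have m0 : 0 < Num.min e e' by rewrite lt_min e0.
  have me : Num.min e e' <= e by rewrite ge_min lexx.
  have me' : Num.min e e' <= e' by rewrite ge_min lexx orbT.
  by rewrite /h; split; lra.
have Dt t : r <= t <= r + h -> `|t - r| < e.
  by move=> /andP[t1 t2]; rewrite ger0_norm; lra.
have [|t /Dt|t /andP[t1 t2]|c /andP[c1 c2]] := @mean_value R y y1 r (r + h).
- lra.
- by move=> /Dy /is_derive_continuous.
- by apply/Dy/Dt; lra.
move=> E; have := ymax (r + h); rewrite (_ : r + h - r = h); last by ring.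
rewrite gtr0_norm// => /(_ he); rewrite leNgt => /negP; apply.
rewrite -subr_gt0 E (_ : r + h - r = h); last by ring.
rewrite mulr_gt0//.
have -> : c = r + (c - r) by ring.
by rewrite -y10; apply: He'; lra.
Qed.

(** The linear bound makes [P] vanish at [0+], and a nonincreasing function with that limit is
    nonpositive. It is applied to fluxes [t^6 w1], [t^6] being the integrating factor of
    [w1' + 6 w1 / t]. *)
Lemma le0_of_origin {R : realType} (P dP : R -> R) (r M d : R) : 0 < r -> 0 < d ->
  (forall t, 0 < t < d -> `|P t| <= M * t) ->
  (forall t, 0 < t <= r -> is_derive t 1 P (dP t)) ->
  (forall t, 0 < t < r -> dP t <= 0) -> P r <= 0.
Proof.
move=> r0 d0 PM DP dP0; rewrite leNgt; apply/negP => Pr.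
pose N := `|M| + 1.
have N0 : 0 < N by rewrite /N ltr_wpDl.
pose t := Num.min (Num.min d r) (P r / N) / 2.
have q0 : 0 < P r / N by rewrite divr_gt0.
have [t0 td tr tq] : [/\ 0 < t, t < d, t < r & t < P r / N].
  rewrite /t; set m := Num.min _ _.
  have m0 : 0 < m by rewrite /m !lt_min d0 r0.
  have : m <= d by rewrite /m !ge_min lexx.
  have : m <= r by rewrite /m !ge_min lexx orbT.
  have : m <= P r / N by rewrite /m !ge_min lexx orbT.
  by split; lra.
have := PM t; rewrite t0 td => /(_ isT) H.
have : P r <= P t.
  apply: (@nonincr_of_derive R P dP) => [|x /andP[x1 x2]|x /andP[x1 x2]|x /andP[x1 x2]].
  - exact: ltW.
  - by apply: (@is_derive_continuous _ _ _ (dP x)); apply: DP; lra.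
  - by apply: DP; lra.
  - by apply: dP0; lra.
apply/negP; rewrite -ltNge.
apply: (le_lt_trans (ler_norm _)); apply: (le_lt_trans H).
have : t * N < P r by rewrite -ltr_pdivlMr.
apply: le_lt_trans; rewrite mulrC ler_pM2l// /N.
by apply: (le_trans (ler_norm M)); lra.
Qed.

(** * The radial equation *)

Lemma ereal_between {R : realType} (x : R) (rho : \bar R) :
  (x%:E < rho)%E -> exists2 t, x < t & (t%:E < rho)%E.
Proof.
case: rho => [r||//]; last by exists (x + 1); rewrite ?ltrDl ?ltry.
by rewrite lte_fin => xr; exists ((x + r) / 2); rewrite ?lte_fin; lra.
Qed.

Lemma radius_nbhs {R : realType} (c : R) (rho : \bar R) :
  0 < c -> (c%:E < rho)%E ->
  exists2 e, 0 < e & forall t, `|t - c| < e -> 0 < t /\ (t%:E < rho)%E.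
Proof.
move=> c0 /ereal_between [d cd drho]; exists (Num.min c (d - c)).
  by rewrite lt_min c0 subr_gt0.
move=> t; rewrite ltr_norml lt_min => /andP[].
rewrite ltrNl lt_min => /andP[h1 _] /andP[_ h2]; split; first by lra.
by apply: le_lt_trans drho; rewrite lee_fin; lra.
Qed.

Lemma lte_finW {R : realType} (x y : R) (rho : \bar R) :
  x <= y -> (y%:E < rho)%E -> (x%:E < rho)%E.
Proof. by move=> xy; apply: le_lt_trans; rewrite lee_fin. Qed.

(** Values beyond [M] do not exceed [y r], so the maximum over the noncompact [[0, rho)] is attained
    on the segment up to [max M r]; finite and infinite [rho] are treated alike. *)
Lemma global_max {R : realType} (rho : \bar R) (y : R -> R) (r M : R) :
  (forall t, 0 <= t -> (t%:E < rho)%E -> {for t, continuous y}) ->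
  0 <= r -> (r%:E < rho)%E -> (M%:E < rho)%E ->
  (forall t, M < t -> (t%:E < rho)%E -> y t <= y r) ->
  exists c, [/\ 0 <= c, (c%:E < rho)%E &
    forall t, 0 <= t -> (t%:E < rho)%E -> y t <= y c].
Proof.
move=> cy r0 rrho Mrho H; pose N := Num.max M r.
have Nrho : (N%:E < rho)%E by rewrite /N EFin_max gt_max Mrho.
have rN : r <= N by rewrite /N le_max lexx orbT.
have MN : M <= N by rewrite /N le_max lexx.
have [x /andP[x0 xN]|c] := @EVT_max R y 0 N (le_trans r0 rN) (continuous_itvW _).
  by apply: cy => //; exact: lte_finW Nrho.
rewrite in_itv /= => /andP[c0 cN] Hc; exists c; split=> //.
  exact: lte_finW Nrho.
move=> t t0 trho; have [tN|Nt] := leP t N; first by apply: Hc; rewrite in_itv /= t0.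
apply: (@le_trans _ _ (y r)); last by apply: Hc; rewrite in_itv /= r0.
by apply: H => //; exact: le_lt_trans Nt.
Qed.

Lemma first_hit {R : realType} (f : R -> R) (a b m : R) : a <= b ->
  (forall x, a <= x <= b -> {for x, continuous f}) -> f a < m -> m <= f b ->
  exists t, [/\ a < t, t <= b, f t = m & forall x, a <= x <= t -> f x <= m].
Proof.
move=> ab cf fa fb; pose T := [set x | a <= x <= b /\ m <= f x].
have Tb : T b by split => //; rewrite ab lexx.
have lbT : lbound T a by move=> x [/andP[]].
have infT : has_inf T by split; [exists b | exists a].
pose t := inf T.
have at_ : a <= t by apply: lb_le_inf => //; exists b.
have tb : t <= b by apply: ge_inf => //; exists a.
have ct : {for t, continuous f} by apply: cf; rewrite at_.
have below x : a <= x -> x < t -> f x < m.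
  move=> ax xt; rewrite ltNge; apply/negP => mx.
  have : t <= x by apply: ge_inf; [exists a | split => //; rewrite ax /=; lra].
  by rewrite leNgt xt.
have mft : m <= f t.
  rewrite leNgt; apply/negP => ftm.
  have /nbhs_ballP[e /= e0 He] : \forall x \near t, f x < m.
    exact: (cvgr_lt (f t) ct m ftm).
  have [x [/andP[ax xb] mx] xt] := inf_adherent e0 infT.
  have tx : t <= x by apply: ge_inf; [exists a | split => //; rewrite ax].
  have := He x; rewrite /ball /= distrC ger0_norm ?subr_ge0// ltrBlDl => /(_ xt).
  by rewrite ltNge mx.
have at' : a < t.
  by rewrite lt_neqAle at_ andbT; apply/eqP => E; move: fa; rewrite E ltNge mft.
have ftm : f t <= m.
  rewrite leNgt; apply/negP => mft'.
  have /nbhs_ballP[e /= e0 He] : \forall x \near t, m < f x.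
    exact: (cvgr_gt (f t) ct m mft').
  pose x := Num.max a (t - e / 2).
  have xt : x < t by rewrite /x gt_max at' /=; lra.
  have ax : a <= x by rewrite /x le_max lexx.
  have xe : t - e / 2 <= x by rewrite /x le_max lexx orbT.
  have := He x; rewrite /ball /= gtr0_norm ?subr_gt0// => H.
  have := below x ax xt; rewrite ltNge (ltW (H _))//; lra.
exists t; split => //; first by apply/eqP; rewrite eq_le ftm.
move=> x /andP[ax]; rewrite le_eqVlt => /orP[/eqP -> //|xt].
by apply/ltW/below.
Qed.

Definition cubic {R : realType} (C D s v : R) : R := (v - s) * (C * v + D).

(** [profile_0] makes the flux [r^6 w1] vanish at the origin, which excludes the singular behaviour
    [r^-5] of [w] and starts the integration of [(r^6 w')' = r^6 w g]. [profile_bc] expresses the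
    limit of [r^2 w] at [rho], finite or infinite, by one formula. *)
Record radial_profile {R : realType} (C D s : R) (rho : \bar R) (w w1 : R -> R) :
    Prop := RadialProfile {
  profile_cont : forall r, 0 <= r -> (r%:E < rho)%E -> {for r, continuous w};
  profile_d1 : forall r, 0 < r -> (r%:E < rho)%E -> is_derive r 1 w (w1 r);
  profile_d2 : forall r, 0 < r -> (r%:E < rho)%E -> is_derive r 1 w1
    (w r * cubic C D s (r ^+ 2 * w r) - 6 * w1 r / r);
  profile_0 : exists M d, 0 < d /\
    forall r, 0 < r < d -> `|r ^+ 6 * w1 r| <= M * r;
  profile_bc : forall eps, 0 < eps -> exists2 M, (M%:E < rho)%E &
    forall r, M < r -> 0 < r -> (r%:E < rho)%E -> `|r ^+ 2 * w r - s| < eps }.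

(** The last inequality says that the negative root [- D / C] of [cubic] lies no farther from [0]
    than the positive root [s]. It comes from [b2 >= 0]. *)
Definition cubic_ok {R : realType} (C D s : R) :=
  [/\ 0 < C, 0 < D, 0 < s & D <= C * s].

(** * A priori bounds for a single profile *)

Section Profile.
Context {R : realType} (C D s : R) (hyp : cubic_ok C D s).
Context (rho : \bar R).
Implicit Types (mu r t : R).

Let C0 : 0 < C. Proof. by case: hyp. Qed.
Let D0 : 0 < D. Proof. by case: hyp. Qed.
Let s0 : 0 < s. Proof. by case: hyp. Qed.
Let DCs : D <= C * s. Proof. by case: hyp. Qed.

Lemma is_derive_quad (w w1 : R -> R) (r : R) : is_derive r 1 w (w1 r) ->
  is_derive r 1 (fun r => r ^+ 2 * w r) (2 * r * w r + r ^+ 2 * w1 r).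
Proof. by move=> H; derive_eq; ring. Qed.

(** In terms of [v = r^2 w] the seven-dimensional radial Laplacian becomes the three-dimensional one
    with the extra term [- 6 v / r^2]. *)
Lemma is_derive_quad1 (w w1 : R -> R) (r g : R) : r != 0 ->
  is_derive r 1 w (w1 r) -> is_derive r 1 w1 (w r * g - 6 * w1 r / r) ->
  let v := r ^+ 2 * w r in
  is_derive r 1 (fun r => 2 * r * w r + r ^+ 2 * w1 r)
    (6 * v / r ^+ 2 + v * g - 2 * (2 * r * w r + r ^+ 2 * w1 r) / r).
Proof. by move=> r0 H H1 /=; derive_eq; field. Qed.

Lemma quad_cont (w : R -> R) (r : R) : {for r, continuous w} ->
  {for r, continuous (fun t : R => t ^+ 2 * w t)}.
Proof. by move=> cw; apply: continuousM => //; exact: exprn_continuous. Qed.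

Lemma cubic_lt0 (v : R) : 0 <= v -> v < s -> cubic C D s v < 0.
Proof.
move=> v0 vs; rewrite /cubic nmulr_rlt0 ?subr_lt0//.
by rewrite ltr_wpDl// mulr_ge0// ltW.
Qed.

Lemma cubic_le0 (v : R) : 0 <= v -> v <= s -> cubic C D s v <= 0.
Proof.
move=> v0; rewrite le_eqVlt => /orP[/eqP ->|vs]; first by rewrite /cubic subrr mul0r.
exact/ltW/cubic_lt0.
Qed.

(** The function [x g(x)] is [C (x^3 - s x^2) + D (x^2 - s x)]; the two brackets increase from
    [2 s / 3] and from [s / 2] on. *)
Lemma cubic_mono (x y : R) : 2 * s / 3 <= x -> x <= y ->
  x * cubic C D s x <= y * cubic C D s y.
Proof.
move=> sx xy; rewrite -subr_ge0 /cubic.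
have -> : y * ((y - s) * (C * y + D)) - x * ((x - s) * (C * x + D)) =
  (y - x) * (C * ((x ^+ 2 + x * y + y ^+ 2) - s * (x + y)) + D * (x + y - s)).
  by ring.
apply: mulr_ge0; first by rewrite subr_ge0.
apply: addr_ge0; apply: mulr_ge0; try exact: ltW; last by have := s0; lra.
have xy0 : 0 <= x + y by have := s0; lra.
have : 0 <= (x - y) ^+ 2 by exact: sqr_ge0.
have : 0 <= (x + y) * (x + y - 4 * s / 3) by apply: mulr_ge0 => //; lra.
by rewrite !expr2; nra.
Qed.

Variables (w w1 : R -> R).
Hypothesis W : radial_profile C D s rho w w1.
Let v := fun r => r ^+ 2 * w r.
Let v1 := fun r => 2 * r * w r + r ^+ 2 * w1 r.

Let vcont t : 0 <= t -> (t%:E < rho)%E -> {for t, continuous v}.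
Proof. by move=> t0 trho; exact/quad_cont/(profile_cont W). Qed.

Let dv t : 0 < t -> (t%:E < rho)%E -> is_derive t 1 v (v1 t).
Proof. by move=> t0 trho; exact/is_derive_quad/(profile_d1 W). Qed.

Let dv1 t : 0 < t -> (t%:E < rho)%E -> is_derive t 1 v1
  (6 * v t / t ^+ 2 + v t * cubic C D s (v t) - 2 * v1 t / t).
Proof.
move=> t0 trho; apply: is_derive_quad1; first by rewrite gt_eqF.
  exact: profile_d1 W _ _ _.
exact: profile_d2 W _ _ _.
Qed.

Lemma profile_max (c : R) : 0 < c -> (c%:E < rho)%E ->
  (forall t, 0 <= t -> (t%:E < rho)%E -> v t <= v c) ->
  6 * v c / c ^+ 2 + v c * cubic C D s (v c) <= 0.
Proof.
move=> c0 crho Hc; have [e e0 He] := radius_nbhs c0 crho.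
have Dv t : `|t - c| < e -> is_derive t 1 v (v1 t).
  by move=> /He[t0 trho]; exact: dv.
have Mv t : `|t - c| < e -> v t <= v c.
  by move=> /He[t0 trho]; apply: Hc => //; exact: ltW.
have [E] := second_derive_max e0 Dv (dv1 c0 crho) Mv.
by rewrite E mulr0 mul0r subr0.
Qed.

Lemma profile_min (c : R) : 0 < c -> (c%:E < rho)%E ->
  (forall t, 0 <= t -> (t%:E < rho)%E -> v c <= v t) ->
  v1 c = 0 /\ 0 <= 6 * v c / c ^+ 2 + v c * cubic C D s (v c).
Proof.
move=> c0 crho Hc; have [e e0 He] := radius_nbhs c0 crho.
have Dv t : `|t - c| < e -> is_derive t 1 (fun t => - v t) (- v1 t).
  by move=> /He[t0 trho]; exact/is_deriveNf/dv.
have Mv t : `|t - c| < e -> - v t <= - v c.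
  by move=> /He[t0 trho]; rewrite lerN2; apply: Hc => //; exact: ltW.
have [E] := second_derive_max e0 Dv (is_deriveNf (dv1 c0 crho)) Mv.
have {}E : v1 c = 0 by apply/eqP; rewrite -oppr_eq0 E.
by rewrite E mulr0 mul0r subr0 oppr_le0.
Qed.

Lemma profile_le (r : R) : 0 <= r -> (r%:E < rho)%E -> v r <= s.
Proof.
move=> r0 rrho; rewrite leNgt; apply/negP => sv.
have vs0 : 0 < v r - s by rewrite subr_gt0.
have [M Mrho HM] := profile_bc W vs0.
have rho0 : (0 < rho)%E by exact: le_lt_trans rrho.
have [c [c0 crho Hc]] : exists c, [/\ 0 <= c, (c%:E < rho)%E &
    forall t, 0 <= t -> (t%:E < rho)%E -> v t <= v c].
  apply: (@global_max R rho v r (Num.max M 0)) => //.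
  - by rewrite EFin_max gt_max Mrho.
  - move=> t; rewrite gt_max => /andP[Mt t0] trho.
    by have := HM t Mt t0 trho; rewrite ltr_norml => /andP[_]; rewrite ltrD2r => /ltW.
have vc : s < v c by apply: (lt_le_trans sv); exact: Hc.
have cpos : 0 < c.
  rewrite lt_neqAle c0 andbT; apply/eqP => c0E; move: vc.
  by rewrite /v -c0E expr0n /= mul0r ltNge (ltW s0).
have := profile_max cpos crho Hc; rewrite leNgt => /negP; apply.
have v0 : 0 < v c by exact: lt_trans vc.
apply: addr_gt0; first by rewrite divr_gt0 ?exprn_gt0// mulr_gt0.
rewrite mulr_gt0// /cubic mulr_gt0 ?subr_gt0// addr_gt0// mulr_gt0//.
Qed.

(** The primitive of [x * cubic C D s x] that vanishes at [0]. *)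
Let F (x : R) := C / 4 * x ^+ 4 + (D - C * s) / 3 * x ^+ 3 - D * s / 2 * x ^+ 2.

(* On a stretch where [v] runs from a negative minimum [-m] to its first return
   to height [m], the friction and the nonautonomous potential [- 3 v^2 / r^2]
   can only dissipate the energy corrected by the constant [3 m^2 / r^2]. *)
Lemma profile_ge0 (r : R) : 0 <= r -> (r%:E < rho)%E -> 0 <= v r.
Proof.
move=> r0 rrho; rewrite leNgt; apply/negP => vr.
have vs0 : 0 < s - v r by rewrite subr_gt0; exact: lt_trans s0.
have [M Mrho HM] := profile_bc W vs0.
have rho0 : (0 < rho)%E by exact: le_lt_trans rrho.
have [c [c0 crho Hc]] : exists c, [/\ 0 <= c, (c%:E < rho)%E &
    forall t, 0 <= t -> (t%:E < rho)%E -> - v t <= - v c].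
  apply: (@global_max R rho (fun t => - v t) r (Num.max M 0)) => //.
  - by move=> t t0 trho; apply: continuousN; exact: vcont.
  - by rewrite EFin_max gt_max Mrho.
  - move=> t; rewrite gt_max => /andP[Mt t0] trho; rewrite lerN2.
    by have := HM t Mt t0 trho; rewrite ltr_norml => /andP[+ _]; rewrite /v; lra.
have {}Hc t : 0 <= t -> (t%:E < rho)%E -> v c <= v t.
  by move=> t0 trho; rewrite -lerN2; exact: Hc.
pose m := - v c; have m0 : 0 < m.
  by rewrite /m oppr_gt0; apply: le_lt_trans vr; exact: Hc.
have cpos : 0 < c.
  rewrite lt_neqAle c0 andbT; apply/eqP => c0E; move: m0.
  by rewrite /m /v -c0E expr0n /= mul0r oppr0 ltxx.
have [v1c] := profile_min cpos crho Hc.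
have -> : v c = - m by rewrite /m opprK.
move=> fc.
(* For [m >= s] the condition [D <= C * s] gives [v g(v) <= 0] at [v = - m], so the second
   derivative at the minimum would be negative. Hence the height [m] lies below the boundary value
   and is reached later. *)
have ms : m < s.
  rewrite ltNge; apply/negP => sm; move: fc; rewrite leNgt => /negP; apply.
  rewrite -subr_gt0 /cubic.
  have -> : 0 - (6 * - m / c ^+ 2 + - m * ((- m - s) * (C * - m + D))) =
    6 * m / c ^+ 2 + m * (m + s) * (C * m - D) by ring.
  rewrite ltr_pwDl//; first by rewrite divr_gt0 ?exprn_gt0// mulr_gt0.
  apply: mulr_ge0; first by rewrite mulr_ge0 ?addr_ge0 ?ltW.
  by rewrite subr_ge0 (le_trans DCs)// ler_pM2l.
have sm0 : 0 < s - m by rewrite subr_gt0.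
have [N Nrho HN] := profile_bc W sm0.
have [b Nb brho] : exists2 b, Num.max N c < b & (b%:E < rho)%E.
  by apply: ereal_between; rewrite EFin_max gt_max Nrho.
move: Nb; rewrite gt_max => /andP[Nb cb].
have mvb : m <= v b.
  have := HN b Nb (lt_trans cpos cb) brho.
  by rewrite ltr_norml => /andP[+ _]; rewrite /v; lra.
have tin t : c <= t -> t <= b -> 0 < t /\ (t%:E < rho)%E.
  by move=> ct tb; split; [exact: lt_le_trans ct | exact: lte_finW brho].
have [a [ca ab va Ha]] : exists a, [/\ c < a, a <= b, v a = m &
    forall x, c <= x <= a -> v x <= m].
  apply: first_hit => //; first exact: ltW.
    by move=> x /andP[cx xb]; have [x0 xrho] := tin x cx xb; apply: vcont => //; exact: ltW.
  have -> : v c = - m by rewrite /m opprK. by rewrite gtrN.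
have {}tin t : c <= t -> t <= a -> 0 < t /\ (t%:E < rho)%E.
  by move=> ct ta; apply: tin => //; exact: le_trans ab.
(* Multiplying the equation of [v] by [v1] produces the first three terms; the last one turns
   [6 v^2 / t^3] in the derivative into [6 (v^2 - m^2) / t^3], nonpositive while [|v| <= m]. *)
pose G t := v1 t ^+ 2 / 2 - 3 * (v t / t) ^+ 2 - F (v t) + 3 * (m / t) ^+ 2.
pose dG t := - 2 * v1 t ^+ 2 / t + 6 * (v t ^+ 2 - m ^+ 2) / t ^+ 3.
have DG t : c <= t -> t <= a -> is_derive t 1 G (dG t).
  move=> ct ta; have [t0 trho] := tin t ct ta.
  have tn0 : t != 0 by rewrite gt_eqF.
  have Hv := dv t0 trho; have Hv1 := dv1 t0 trho.
  rewrite /G /F; derive_eq => //; rewrite /dG /cubic /=.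
  by field.
have vm t : c <= t -> t <= a -> v t ^+ 2 <= m ^+ 2.
  move=> ct ta; have [t0 trho] := tin t ct ta.
  rewrite -subr_ge0 subr_sqr mulr_ge0//; first by rewrite subr_ge0 Ha ?ct.
  by rewrite /m addrC subr_ge0; apply: Hc => //; exact: ltW.
have dG0 t : c <= t -> t <= a -> dG t <= 0.
  move=> ct ta; have [t0 trho] := tin t ct ta.
  rewrite /dG -[leRHS]addr0 lerD//.
    by rewrite -mulrA mulNr oppr_le0 pmulr_rge0// divr_ge0 ?sqr_ge0// ltW.
  by rewrite mulr_le0_ge0 ?invr_ge0 ?exprn_ge0 ?(ltW t0)// mulr_ge0_le0// subr_le0 vm.
have Gdec x y : c <= x -> x <= y -> y <= a -> G y <= G x.
  move=> cx xy ya; apply: (@nonincr_of_derive R G dG) => // t /andP[t1 t2].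
  - by apply/is_derive_continuous/DG; lra.
  - by apply: DG; lra.
  - by apply: dG0; lra.
(* At both ends [|v| = m], so the terms in [1/t^2] cancel; the odd part of [F], with coefficient
   proportional to [D - C * s <= 0], then gives the reverse of [Gdec], and [G] is constant on
   [[c, a]]. *)
have Gca : G c <= G a.
  have -> : G c = - F (- m).
    rewrite /G v1c; have -> : v c = - m by rewrite /m opprK.
    by rewrite expr0n /= mul0r mulNr sqrrN; ring.
  have -> : G a = v1 a ^+ 2 / 2 - F m by rewrite /G va; ring.
  have : 0 <= v1 a ^+ 2 by exact: sqr_ge0.
  have : (D - C * s) * m ^+ 3 <= 0.
    by rewrite mulr_le0_ge0 ?subr_le0// exprn_ge0// ltW.
  rewrite /F; lra.
have Gcst x : c <= x -> x <= a -> G x = G c.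
  move=> cx xa; apply/eqP; rewrite eq_le Gdec//= (le_trans Gca)//.
  exact: Gdec.
(* On the way from [- m] to [m], [v] has a zero, where [dG] is strictly negative; this contradicts
   the constancy of [G]. *)
have [z /andP[cz za] vz] : exists2 z, c <= z <= a & v z = 0.
  have cv x : c <= x <= a -> {for x, continuous v}.
    move=> /andP[cx xa]; have [x0 xrho] := tin x cx xa.
    by apply: vcont => //; exact: ltW.
  have v0 : Num.min (v c) (v a) <= 0 <= Num.max (v c) (v a).
    have vc : v c = - m by rewrite /m opprK.
    by rewrite vc va ge_min le_max oppr_le0 (ltW m0)/= orbT.
  have [z] := IVT (ltW ca) (continuous_itvW cv) v0.
  by rewrite in_itv /=; exists z.
have {}za : z < a.
  by rewrite lt_neqAle za andbT; apply: contraPneq vz => ->; rewrite va => /eqP; rewrite gt_eqF.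
have [z0 _] := tin z cz (ltW za).
have : 0 < - dG z.
  rewrite oppr_gt0 /dG vz expr0n /= sub0r -[ltRHS]addr0 ler_ltD//.
    by rewrite -mulrA mulNr oppr_le0 pmulr_rge0// divr_ge0 ?sqr_ge0// ltW.
  by rewrite mulrN mulNr oppr_lt0 divr_gt0 ?exprn_gt0// mulr_gt0// exprn_gt0.
move=> /(incr_right_of_derive (is_deriveNf (DG z cz (ltW za))))[e e0 He].
pose h := Num.min e (a - z) / 2.
have [h0 he hz] : [/\ 0 < h, h < e & h < a - z].
  have : 0 < Num.min e (a - z) by rewrite lt_min e0 subr_gt0.
  have : Num.min e (a - z) <= e by rewrite ge_min lexx.
  have : Num.min e (a - z) <= a - z by rewrite ge_min lexx orbT.
  by rewrite /h; split; lra.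
have := He h; rewrite h0 he => /(_ isT).
by rewrite !Gcst ?ltxx//; lra.
Qed.

(** The flux [r^6 w1] has derivative [r^4 v g(v) <= 0] and starts from [0]. *)
Lemma profile_deriv_le0 (r : R) : 0 < r -> (r%:E < rho)%E -> w1 r <= 0.
Proof.
move=> r0 rrho; have [M [d [d0 HM]]] := profile_0 W.
suff : r ^+ 6 * w1 r <= 0 by rewrite pmulr_rle0// exprn_gt0.
apply: (@le0_of_origin R (fun t => t ^+ 6 * w1 t)
  (fun t => t ^+ 4 * (v t * cubic C D s (v t))) r M d) => // t /andP[t0 tr].
- have trho : (t%:E < rho)%E by exact: lte_finW rrho.
  have Hw1 := profile_d2 W t0 trho.
  derive_eq; rewrite /v /=; field.
  by rewrite gt_eqF.
- have trho : (t%:E < rho)%E by apply: lte_finW rrho; exact: ltW.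
  rewrite mulr_ge0_le0 ?exprn_ge0 ?(ltW t0)// mulr_ge0_le0 ?profile_ge0 ?(ltW t0)//.
  by apply: cubic_le0; [apply: profile_ge0|apply: profile_le] => //; exact: ltW.
Qed.

Lemma profile_nonincr (x y : R) : 0 <= x -> x <= y -> (y%:E < rho)%E ->
  w y <= w x.
Proof.
move=> x0 xy yrho; have zin z : x <= z -> z <= y -> 0 <= z /\ (z%:E < rho)%E.
  by move=> xz zy; split; [exact: le_trans xz | exact: lte_finW yrho].
apply: (@nonincr_of_derive R w w1) => // t /andP[t1 t2].
- by have [? ?] := zin t t1 t2; exact: profile_cont W _ _ _.
- have [? ?] := zin t (ltW t1) (ltW t2); apply: profile_d1 W _ _ _ => //.
  exact: le_lt_trans t1.
- have [? ?] := zin t (ltW t1) (ltW t2); apply: profile_deriv_le0 => //.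
  exact: le_lt_trans t1.
Qed.

(** The function [w] is nonincreasing and positive near [rho], where [r^2 w] is close to [s]. *)
Lemma profile_gt0 (r : R) : 0 <= r -> (r%:E < rho)%E -> 0 < w r.
Proof.
move=> r0 rrho; have [M Mrho HM] := profile_bc W s0.
have [b Nb brho] : exists2 b, Num.max M r < b & (b%:E < rho)%E.
  by apply: ereal_between; rewrite EFin_max gt_max Mrho.
move: Nb; rewrite gt_max => /andP[Mb rb].
have b0 : 0 < b by exact: le_lt_trans rb.
have : 0 < v b by have := HM b Mb b0 brho; rewrite ltr_norml => /andP[+ _]; rewrite /v; lra.
rewrite /v pmulr_rgt0 ?exprn_gt0// => /lt_le_trans; apply.
by apply: profile_nonincr => //; exact: ltW.
Qed.

(** Contact with [s] would be a maximum of [v], where [g(s) = 0] leaves [6 s / r^2 <= 0]. *)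
Lemma profile_lt (r : R) : 0 <= r -> (r%:E < rho)%E -> v r < s.
Proof.
move=> r0 rrho; rewrite lt_neqAle profile_le// andbT; apply/eqP => vs.
have rpos : 0 < r.
  rewrite lt_neqAle r0 andbT; apply/eqP => r0E; move: s0.
  by rewrite -vs /v -r0E expr0n /= mul0r ltxx.
have := profile_max rpos rrho; rewrite vs => H.
have : 6 * s / r ^+ 2 + s * cubic C D s s <= 0.
  by apply: H => t t0 trho; exact: profile_le.
rewrite /cubic subrr mul0r mulr0 addr0 leNgt => /negP; apply.
by rewrite divr_gt0 ?exprn_gt0// mulr_gt0.
Qed.
End Profile.

(** * Comparison of two profiles by dilation *)

Section Sliding.
Context {R : realType} (C D s : R) (hyp : cubic_ok C D s).
Context (rho : \bar R).
Implicit Types (mu r t : R).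
Variables (w w1 z z1 : R -> R).
Hypothesis W : radial_profile C D s rho w w1.
Hypothesis Z : radial_profile C D s rho z z1.

Let s0 : 0 < s. Proof. by case: hyp. Qed.

Let shrink mu r : 0 < mu -> mu < 1 -> 0 <= r -> (r%:E < rho)%E ->
  0 <= mu * r /\ (((mu * r)%:E) < rho)%E.
Proof.
move=> m0 m1 r0 rrho; split; first by rewrite mulr_ge0// ltW.
by apply: lte_finW rrho; rewrite ler_piMl// ltW.
Qed.

Let shrink_pos mu r : 0 < mu -> mu < 1 -> 0 < r -> (r%:E < rho)%E ->
  0 < mu * r /\ (((mu * r)%:E) < rho)%E.
Proof.
move=> m0 m1 r0 rrho; split; first by rewrite mulr_gt0.
by apply: lte_finW rrho; rewrite ler_piMl// ltW.
Qed.

Let is_derive_scale (f : R -> R) (mu r d : R) : is_derive (mu * r) 1 f d ->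
  is_derive r 1 (fun t => f (mu * t)) (mu * d).
Proof.
move=> H; have H1 : is_derive r 1 (fun t => mu * t) mu by derive_eq; ring.
have := @is_derive1_comp R f (fun t => mu * t) r d mu H H1.
by rewrite mulrC.
Qed.

Let cont_scale (f : R -> R) (mu r : R) : {for mu * r, continuous f} ->
  {for r, continuous (fun t : R => f (mu * t))}.
Proof.
move=> cf; apply: (@continuous_comp _ _ _ (fun t => mu * t) f) => //.
exact: mulrl_continuous.
Qed.

(* [mu ^+ 2 * z (mu * r)] solves the equation with [mu ^+ 2 * cubic] in place of
   [cubic], which makes it a strict subsolution. *)
Let gap mu r := w r - mu ^+ 2 * z (mu * r).
Let gap1 mu r := w1 r - mu ^+ 3 * z1 (mu * r).

Let gap_cont mu r : 0 < mu -> mu < 1 -> 0 <= r -> (r%:E < rho)%E ->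
  {for r, continuous (gap mu)}.
Proof.
move=> m0 m1 r0 rrho; have [? ?] := shrink m0 m1 r0 rrho.
apply: continuousB; first exact: profile_cont W _ _ _.
apply: continuousM; first exact: cst_continuous.
by apply: cont_scale; exact: profile_cont Z _ _ _.
Qed.

Let dgap mu r : 0 < mu -> mu < 1 -> 0 < r -> (r%:E < rho)%E ->
  is_derive r 1 (gap mu) (gap1 mu r).
Proof.
move=> m0 m1 r0 rrho; have [mr0 mrrho] := shrink_pos m0 m1 r0 rrho.
have H1 := profile_d1 W r0 rrho.
have H2 := is_derive_scale (profile_d1 Z mr0 mrrho).
by rewrite /gap; derive_eq; rewrite /gap1; ring.
Qed.

Let source mu r := w r * cubic C D s (r ^+ 2 * w r) -
  mu ^+ 4 * (z (mu * r) * cubic C D s ((mu * r) ^+ 2 * z (mu * r))).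

Let dgap1 mu r : 0 < mu -> mu < 1 -> 0 < r -> (r%:E < rho)%E ->
  is_derive r 1 (gap1 mu) (source mu r - 6 * gap1 mu r / r).
Proof.
move=> m0 m1 r0 rrho; have [mr0 mrrho] := shrink_pos m0 m1 r0 rrho.
have H1 := profile_d2 W r0 rrho.
have H2 := is_derive_scale (profile_d2 Z mr0 mrrho).
rewrite /gap1; derive_eq; rewrite /source; field.
by rewrite !gt_eqF.
Qed.

(** Where the two functions touch, both cubics have the same argument, and the source reduces to
    [(1 - mu^2) w g] with [w > 0] and [g < 0]. *)
Let source_lt0 mu r : 0 < mu -> mu < 1 -> 0 <= r -> (r%:E < rho)%E ->
  gap mu r = 0 -> source mu r < 0.
Proof.
move=> m0 m1 r0 rrho; rewrite /gap => /eqP; rewrite subr_eq0 => /eqP E.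
rewrite /source.
have -> : (mu * r) ^+ 2 * z (mu * r) = r ^+ 2 * w r by rewrite E; ring.
set K := cubic _ _ _ _.
have -> : w r * K - mu ^+ 4 * (z (mu * r) * K) = w r * (1 - mu ^+ 2) * K.
  have -> : mu ^+ 4 * (z (mu * r) * K) = mu ^+ 2 * (mu ^+ 2 * z (mu * r)) * K.
    by ring.
  by rewrite -E; ring.
rewrite /K; rewrite pmulr_rlt0.
  apply: (cubic_lt0 hyp); last exact (profile_lt hyp W r0 rrho).
  exact (profile_ge0 hyp W r0 rrho).
rewrite mulr_gt0 ?subr_gt0 ?expr_lt1 ?ltW//.
exact: (profile_gt0 hyp W).
Qed.

Let source_cont mu r : 0 < mu -> mu < 1 -> 0 <= r -> (r%:E < rho)%E ->
  {for r, continuous (source mu)}.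
Proof.
move=> m0 m1 r0 rrho; have [? ?] := shrink m0 m1 r0 rrho.
have cw := profile_cont W r0 rrho.
have cz : {for r, continuous (fun t : R => z (mu * t))}.
  by apply: cont_scale; exact: profile_cont Z _ _ _.
have ccub (f : R -> R) : {for r, continuous f} ->
    {for r, continuous (fun t : R => cubic C D s (f t))}.
  move=> cf; apply: continuousM.
    by apply: continuousB => //; exact: cst_continuous.
  apply: continuousD; last exact: cst_continuous.
  by apply: continuousM => //; exact: cst_continuous.
apply: continuousB.
  by apply: continuousM => //; apply: ccub; exact: quad_cont.
apply: continuousM; first exact: cst_continuous.
apply: continuousM => //; apply: ccub; apply: continuousM => //.
apply: (@continuous_comp _ _ _ (fun t => mu * t) (fun t => t ^+ 2)).
  exact: mulrl_continuous.
exact: exprn_continuous.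
Qed.

Lemma no_interior_touch mu r : 0 < mu -> mu < 1 -> 0 < r -> (r%:E < rho)%E ->
  (forall t, 0 <= t -> (t%:E < rho)%E -> 0 <= gap mu t) -> gap mu r <> 0.
Proof.
move=> m0 m1 r0 rrho H E; have [e e0 He] := radius_nbhs r0 rrho.
have Dg t : `|t - r| < e -> is_derive t 1 (fun t => - gap mu t) (- gap1 mu t).
  by move=> /He[t0 trho]; exact/is_deriveNf/dgap.
have Mg t : `|t - r| < e -> - gap mu t <= - gap mu r.
  by move=> /He[t0 trho]; rewrite E oppr0 oppr_le0; apply: H => //; exact: ltW.
have [G1] := second_derive_max e0 Dg (is_deriveNf (dgap1 m0 m1 r0 rrho)) Mg.
have {}G1 : gap1 mu r = 0 by apply/eqP; rewrite -oppr_eq0 G1.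
rewrite G1 mulr0 mul0r subr0 oppr_le0 leNgt => /negP; apply.
by apply: source_lt0 => //; exact: ltW.
Qed.

(** The second derivative test does not reach [r = 0]. There the negative source keeps the flux
    [t^6 gap1] nonpositive on a short interval, so the gap cannot increase from [0]; being
    nonnegative it vanishes at [a], which is an interior contact. *)
Lemma no_touch mu r : 0 < mu -> mu < 1 -> 0 <= r -> (r%:E < rho)%E ->
  (forall t, 0 <= t -> (t%:E < rho)%E -> 0 <= gap mu t) -> gap mu r <> 0.
Proof.
move=> m0 m1 r0 rrho H E; have [r_gt0|] := ltP 0 r.
  exact: no_interior_touch r_gt0 _ H E.
move=> r_le0; have {r_le0}r00 : r = 0 by apply/eqP; rewrite eq_le r_le0.
rewrite r00 in r0 rrho E.
have sl := source_lt0 m0 m1 r0 rrho E.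
have /nbhs_ballP[e /= e0 He] : \forall t \near (0 : R), source mu t < 0.
  exact: (cvgr_lt (source mu 0) (source_cont m0 m1 r0 rrho) 0 sl).
have [d d0 drho] := ereal_between rrho.
have [M1 [d1 [d10 HM1]]] := profile_0 W.
have [M2 [d2 [d20 HM2]]] := profile_0 Z.
pose a := Num.min e d / 2.
have [a0 ae ad] : [/\ 0 < a, a < e & a < d].
  have : 0 < Num.min e d by rewrite lt_min e0 d0.
  have : Num.min e d <= e by rewrite ge_min lexx.
  have : Num.min e d <= d by rewrite ge_min lexx orbT.
  by rewrite /a; split; lra.
have ain t : t <= a -> (t%:E < rho)%E.
  by move=> ta; apply: lte_finW drho; lra.
have g1 t : 0 < t -> t <= a -> gap1 mu t <= 0.
  move=> t0 ta; suff : t ^+ 6 * gap1 mu t <= 0 by rewrite pmulr_rle0// exprn_gt0.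
  apply: (@le0_of_origin R (fun t => t ^+ 6 * gap1 mu t)
    (fun t => t ^+ 6 * source mu t) t (M1 + `|M2| / mu ^+ 2) (Num.min d1 d2)) => //.
  - by rewrite lt_min d10.
  - move=> x /andP[x0]; rewrite lt_min => /andP[xd1 xd2].
    rewrite /gap1 mulrBr mulrDl; apply: (le_trans (ler_normB _ _)).
    apply: lerD; first by apply: HM1; rewrite x0.
    have mx : 0 < mu * x < d2.
      by rewrite mulr_gt0//=; apply: le_lt_trans xd2; rewrite ler_piMl ?ltW.
    have := HM2 _ mx.
    have -> : x ^+ 6 * (mu ^+ 3 * z1 (mu * x)) =
       mu ^- 3 * ((mu * x) ^+ 6 * z1 (mu * x)).
      by field; rewrite gt_eqF.
    move=> H2; rewrite normrM gtr0_norm ?invr_gt0 ?exprn_gt0//.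
    apply: (@le_trans _ _ (mu ^- 3 * (M2 * (mu * x)))).
      by rewrite ler_pM2l// invr_gt0 exprn_gt0.
    have -> : mu ^- 3 * (M2 * (mu * x)) = M2 / mu ^+ 2 * x.
      by field; rewrite gt_eqF.
    by rewrite ler_pM2r// ler_pM2r ?invr_gt0 ?exprn_gt0// ler_norm.
  - move=> x /andP[x0 xt]; have xrho := ain x (le_trans xt ta).
    have Hg := dgap1 m0 m1 x0 xrho.
    by derive_eq; rewrite /=; field; rewrite gt_eqF.
  - move=> x /andP[x0 xt]; rewrite mulr_ge0_le0 ?exprn_ge0 ?(ltW x0)//.
    by apply/ltW/He; rewrite /ball /= sub0r normrN gtr0_norm//; lra.
have : gap mu a <= gap mu 0.
  apply: (@nonincr_of_derive R (gap mu) (gap1 mu))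
    => [|t /andP[t0 ta]|t /andP[t0 ta]|t /andP[t0 ta]].
  - exact: ltW.
  - by apply: gap_cont => //; exact: ain.
  - by apply: dgap => //; apply/ain/ltW.
  - by apply: g1 => //; exact: ltW.
rewrite E => ga; apply: (no_interior_touch m0 m1 a0 _ H); first exact: ain.
by apply/eqP; rewrite eq_le ga H ?ain// ltW.
Qed.


(** Beyond [M] the values of [r^2 w] lie where [x g(x)] is nondecreasing, so the ordinary maximum
    principle applies to [r^2 gap]: at a negative minimum [c] the values [p <= q] satisfy
    [p g(p) <= q g(q) <= mu^2 q g(q)], and the second derivative is negative. *)
Lemma gap_ge0_tail mu M : 0 < mu -> mu < 1 -> 0 <= M -> (M%:E < rho)%E ->
  (forall r, M < r -> 0 < r -> (r%:E < rho)%E -> 2 * s / 3 <= r ^+ 2 * w r) ->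
  (forall r, 0 <= r -> r <= M -> 0 <= gap mu r) ->
  forall r, 0 <= r -> (r%:E < rho)%E -> 0 <= gap mu r.
Proof.
move=> m0 m1 M0 Mrho HM HgM r r0 rrho; rewrite leNgt; apply/negP => gr.
pose y (t : R) := t ^+ 2 * gap mu t.
pose y1 t := 2 * t * gap mu t + t ^+ 2 * gap1 mu t.
have Mr : M < r by rewrite ltNge; apply/negP => /(HgM r r0); rewrite leNgt gr.
have rpos : 0 < r by exact: le_lt_trans Mr.
have yr : y r < 0 by rewrite /y pmulr_rlt0// exprn_gt0.
have yr0 : 0 < - y r by rewrite oppr_gt0.
have cy t : 0 <= t -> (t%:E < rho)%E -> {for t, continuous y}.
  by move=> t0 trho; apply: quad_cont; exact: gap_cont.
have [N Nrho HN] := profile_bc W yr0.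
have rho0 : (0 < rho)%E by exact: le_lt_trans rrho.
have [c [c0 crho Hc]] : exists c, [/\ 0 <= c, (c%:E < rho)%E &
    forall t, 0 <= t -> (t%:E < rho)%E -> - y t <= - y c].
  apply: (@global_max R rho (fun t => - y t) r (Num.max N 0)) => //.
  - by move=> t t0 trho; apply: continuousN; exact: cy.
  - by rewrite EFin_max gt_max Nrho.
  - move=> t; rewrite gt_max => /andP[Nt t0] trho; rewrite lerN2.
    have [mt0 mtrho] := shrink m0 m1 (ltW t0) trho.
    have := profile_le hyp W (ltW t0) trho.
    have := profile_le hyp Z mt0 mtrho.
    have := HN t Nt t0 trho; rewrite ltr_norml => /andP[+ _].
    have -> : y t = t ^+ 2 * w t - (mu * t) ^+ 2 * z (mu * t).
      by rewrite /y /gap; ring.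
    lra.
have yc : y c < 0.
  by apply: le_lt_trans yr; rewrite -lerN2; exact: Hc.
have Mc : M < c.
  rewrite ltNge; apply/negP => cM; move: yc; rewrite ltNge => /negP; apply.
  by rewrite mulr_ge0 ?sqr_ge0// HgM.
have cpos : 0 < c by exact: le_lt_trans Mc.
have [e e0 He] := radius_nbhs cpos crho.
have Dy t : `|t - c| < e -> is_derive t 1 (fun t => - y t) (- y1 t).
  by move=> /He[t0 trho]; apply/is_deriveNf/is_derive_quad/dgap.
have My t : `|t - c| < e -> - y t <= - y c.
  by move=> /He[t0 trho]; apply: Hc => //; exact: ltW.
have Dy1 : is_derive c 1 (fun t => - y1 t)
    (- (6 * y c / c ^+ 2 + c ^+ 2 * source mu c - 2 * y1 c / c)).
  apply: is_deriveNf; have H1 := dgap m0 m1 cpos crho.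
  have H2 := dgap1 m0 m1 cpos crho.
  by rewrite /y1; derive_eq; rewrite /y /y1; field; rewrite gt_eqF.
have [Y1] := second_derive_max e0 Dy Dy1 My.
have {}Y1 : y1 c = 0 by apply/eqP; rewrite -oppr_eq0 Y1.
rewrite Y1 mulr0 mul0r subr0 oppr_le0 leNgt => /negP; apply.
rewrite -[ltRHS]addr0 ltr_leD//.
  by rewrite pmulr_llt0 ?invr_gt0 ?exprn_gt0// pmulr_rlt0.
have [mc0 mcrho] := shrink_pos m0 m1 cpos crho.
pose p := c ^+ 2 * w c; pose q := (mu * c) ^+ 2 * z (mu * c).
have -> : c ^+ 2 * source mu c =
    p * cubic C D s p - mu ^+ 2 * (q * cubic C D s q).
  by rewrite /p /q /source; ring.
have pq : p <= q.
  have : p - q <= 0.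
    by rewrite (_ : p - q = y c) ?(ltW yc)//; rewrite /p /q /y /gap; ring.
  by rewrite subr_le0.
have fpq : p * cubic C D s p <= q * cubic C D s q.
  by apply: (cubic_mono hyp) => //; exact: HM.
have q0 : q * cubic C D s q <= 0.
  have q0 : 0 <= q := profile_ge0 hyp Z (ltW mc0) mcrho.
  rewrite mulr_ge0_le0//; apply: (cubic_le0 hyp) => //.
  exact (profile_le hyp Z (ltW mc0) mcrho).
rewrite subr_le0 (le_trans fpq)// -subr_ge0.
rewrite (_ : _ - _ = (mu ^+ 2 - 1) * (q * cubic C D s q)); last by ring.
by rewrite mulr_le0// subr_le0 expr_le1// ltW.
Qed.

Let clamp_cont (f : R -> R) M : 0 <= M ->
  (forall r, 0 <= r -> r <= M -> {for r, continuous f}) ->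
  continuous (fun r : R => f (Num.min (Num.max r 0) M)).
Proof.
move=> M0 cf r.
have H : 0 <= Num.min (Num.max r 0) M <= M.
  by rewrite le_min le_max lexx orbT M0 ge_min lexx orbT.
have /andP[h1 h2] := H.
apply: (@continuous_comp _ _ _ (fun r : R => Num.min (Num.max r 0) M) f).
  apply: (@continuous_min _ _ (fun r => Num.max r 0) (fun=> M)).
    apply: (@continuous_max _ _ id (fun=> 0)); first exact: cvg_id.
    exact: cst_continuous.
  exact: cst_continuous.
exact: cf.
Qed.

(** Continuity method in [mu]: for [mu = 0] the gap is [w > 0]. If some gap with parameter at most
    [mu0] is nonpositive somewhere on [[0, M]], there is a least such [mu]; its gap is still
    nonnegative on [[0, M]], hence everywhere by [gap_ge0_tail], and it vanishes somewhere, against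
    [no_touch]. *)
Lemma gap_gt0_head mu0 M : 0 < mu0 -> mu0 < 1 -> 0 < M -> (M%:E < rho)%E ->
  (forall r, M < r -> 0 < r -> (r%:E < rho)%E -> 2 * s / 3 <= r ^+ 2 * w r) ->
  forall r, 0 <= r -> r <= M -> 0 < gap mu0 r.
Proof.
move=> m0 m1 M0 Mrho HM r r0 rM; rewrite ltNge; apply/negP => gr.
(* Clamping the argument to [[0, M]] gives functions continuous on the whole line, so that [g] is
   jointly continuous in [mu] and [r] and [K] is compact. *)
pose cl (f : R -> R) := fun r : R => f (Num.min (Num.max r 0) M).
have clE f t : 0 <= t -> t <= M -> cl f t = f t.
  by move=> t0 tM; rewrite /cl (max_idPl t0) (min_idPl tM).
pose g (p : R * R) := cl w p.2 - p.1 ^+ 2 * cl z (p.1 * p.2).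
have rho_in t : t <= M -> (t%:E < rho)%E by move=> tM; exact: lte_finW Mrho.
have gE mu t : 0 <= mu -> mu <= 1 -> 0 <= t -> t <= M -> g (mu, t) = gap mu t.
  move=> mu_ge0 mu_le1 t0 tM; rewrite /g /= !clE ?mulr_ge0//.
  by apply: le_trans tM; rewrite ler_piMl.
have cg : continuous g.
  have cw : continuous (cl w).
    by apply: clamp_cont => [|t t0 tM]; [exact: ltW|exact: profile_cont W _ t0 (rho_in _ tM)].
  have cz : continuous (cl z).
    by apply: clamp_cont => [|t t0 tM]; [exact: ltW|exact: profile_cont Z _ t0 (rho_in _ tM)].
  have c1 : continuous (fun p : R * R => p.1) by move=> p; exact: cvg_fst.
  have c2 : continuous (fun p : R * R => p.2) by move=> p; exact: cvg_snd.
  have c12 : continuous (fun p : R * R => cl z (p.1 * p.2)).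
    move=> p; apply: (@continuous_comp _ _ _ (fun p : R * R => p.1 * p.2) (cl z)).
      by apply: (@continuousM _ _ (fun p : R * R => p.1) (fun p => p.2)); [exact: c1|exact: c2].
    exact: cz.
  have c22 : continuous (fun p : R * R => cl w p.2).
    by move=> p; apply: (@continuous_comp _ _ _ (fun p : R * R => p.2) (cl w));
      [exact: c2|exact: cw].
  have c11 : continuous (fun p : R * R => p.1 ^+ 2).
    move=> p; apply: (@continuous_comp _ _ _ (fun p : R * R => p.1) (fun x => x ^+ 2));
      first exact: c1.
    exact: exprn_continuous.
  move=> p; apply: (@continuousB _ _ _ (fun p : R * R => cl w p.2)
     (fun p : R * R => p.1 ^+ 2 * cl z (p.1 * p.2))); first exact: c22.
  by apply: (@continuousM _ _ (fun p : R * R => p.1 ^+ 2) (fun p : R * R => cl z (p.1 * p.2)));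
    [exact: c11|exact: c12].
pose K := (`[0, mu0] `*` `[0, M]) `&` (g @^-1` [set x | x <= 0]).
have K0 : K !=set0.
  exists (mu0, r); split => /=; first by rewrite !in_itv /= lexx r0 rM (ltW m0).
  by rewrite gE// ltW.
have cK : compact K.
  apply: compact_closedI.
    by apply: compact_setX; exact: segment_compact.
  by apply: preimage_closed => [p _|]; [exact: cg | exact: closed_le].
have [[mu t]] := @compact_EVT_min _ R (fun p : R * R => p.1) K K0 cK
   (continuous_subspaceT (fun p => cvg_fst)).
rewrite inE => -[/= []]; rewrite !in_itv /= => /andP[mu_ge0 mu_le] /andP[t0 tM].
rewrite gE//; last by exact: le_trans (ltW m1).
move=> gt Hmin.
have mu_lt1 : mu < 1 by exact: le_lt_trans m1.
have mu_gt0 : 0 < mu.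
  rewrite lt_neqAle mu_ge0 andbT; apply/eqP => mu0E; move: gt.
  rewrite -mu0E /gap expr0n /= mul0r subr0 leNgt => /negP; apply.
  by apply: (profile_gt0 hyp W) => //; exact: rho_in.
have low nu x : 0 <= nu -> nu < mu -> 0 <= x -> x <= M -> 0 < gap nu x.
  move=> nu0 numu x0 xM; rewrite ltNge; apply/negP => gx.
  have : mu <= nu.
    apply: (Hmin (nu, x)); rewrite inE; split => /=.
      by rewrite !in_itv /= nu0 x0 xM (ltW (lt_le_trans numu mu_le)).
    by rewrite gE//; lra.
  by rewrite leNgt numu.
have gap0 x : 0 <= x -> x <= M -> 0 <= gap mu x.
  move=> x0 xM; rewrite leNgt; apply/negP => gx.
  have cgx : {for mu, continuous (fun nu : R => g (nu, x))}.
    apply: (@continuous_comp _ _ _ (fun nu : R => (nu, x)) g); last exact: cg.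
    exact: (@cvg_pair _ _ _ (nbhs mu) (nbhs mu) (nbhs x) _ _ _ id (fun=> x) cvg_id (cvg_cst x)).
  have gx0 : g (mu, x) < 0 by rewrite gE// ltW.
  have /nbhs_ballP[e /= e0 He] : \forall nu \near mu, g (nu, x) < 0.
    exact: (cvgr_lt (g (mu, x)) cgx 0 gx0).
  pose nu := Num.max 0 (mu - e / 2).
  have nu0 : 0 <= nu by rewrite /nu le_max lexx.
  have numu : nu < mu by rewrite /nu gt_max mu_gt0 /=; lra.
  have nue : mu - e / 2 <= nu by rewrite /nu le_max lexx orbT.
  have := He nu; rewrite /ball /= gtr0_norm ?subr_gt0// => H.
  have := low nu x nu0 numu x0 xM.
  rewrite -gE ?(ltW (lt_trans numu mu_lt1))// ltNge => /negP; apply.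
  by apply/ltW/H; lra.
apply: (no_touch mu_gt0 mu_lt1 t0 (rho_in _ tM)).
  exact: gap_ge0_tail (ltW M0) Mrho HM gap0.
by apply/eqP; rewrite eq_le gt gap0.
Qed.

Lemma profile_sliding mu r : 0 < mu -> mu < 1 -> 0 <= r -> (r%:E < rho)%E ->
  mu ^+ 2 * z (mu * r) <= w r.
Proof.
(* The margin [s / 3] gives [r^2 w >= 2 s / 3] beyond [M], the range of [cubic_mono]. *)
move=> m0 m1 r0 rrho; have s30 : 0 < s / 3 by rewrite divr_gt0.
have [N Nrho HN] := profile_bc W s30.
have rho0 : (0 < rho)%E by exact: le_lt_trans rrho.
have [M NM Mrho] : exists2 M, Num.max N 0 < M & (M%:E < rho)%E.
  by apply: ereal_between; rewrite EFin_max gt_max Nrho.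
move: NM; rewrite gt_max => /andP[NM M0].
have HM t : M < t -> 0 < t -> (t%:E < rho)%E -> 2 * s / 3 <= t ^+ 2 * w t.
  move=> Mt t0 trho; have := HN t (lt_trans NM Mt) t0 trho.
  by rewrite ltr_norml => /andP[+ _]; lra.
rewrite -subr_ge0; apply: (gap_ge0_tail m0 m1 (ltW M0) Mrho HM) => // t t0 tM.
by apply/ltW/(gap_gt0_head m0 m1 M0 Mrho HM).
Qed.

Lemma profile_comparison r : 0 <= r -> (r%:E < rho)%E -> z r <= w r.
Proof.
move=> r0 rrho; rewrite leNgt; apply/negP => wz.
have cz : {for 1, continuous (fun mu : R => mu ^+ 2 * z (mu * r))}.
  apply: continuousM; first exact: exprn_continuous.
  apply: (@continuous_comp _ _ _ (fun mu => mu * r) z); first exact: mulrr_continuous.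
  by rewrite mul1r; exact: profile_cont Z _ _ _.
have w1z : w r < 1 ^+ 2 * z (1 * r) by rewrite expr1n !mul1r.
have /nbhs_ballP[e /= e0 He] :
    \forall mu \near (1 : R), w r < mu ^+ 2 * z (mu * r).
  exact: (cvgr_gt (1 ^+ 2 * z (1 * r)) cz (w r) w1z).
pose mu := Num.max (1 / 2) (1 - e / 2).
have mu0 : 0 < mu by rewrite /mu lt_max; apply/orP; left; lra.
have mu1 : mu < 1 by rewrite /mu gt_max; apply/andP; split; lra.
have mue : 1 - e / 2 <= mu by rewrite /mu le_max lexx orbT.
have := He mu; rewrite /ball /= gtr0_norm ?subr_gt0// => H.
have := profile_sliding mu0 mu1 r0 rrho.
by rewrite leNgt => /negP; apply; apply: H; lra.
Qed.
End Sliding.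

Lemma profile_unique {R : realType} (C D s : R) (rho : \bar R) (w w1 z z1 : R -> R) (r : R) :
  cubic_ok C D s -> radial_profile C D s rho w w1 ->
  radial_profile C D s rho z z1 -> 0 <= r -> (r%:E < rho)%E -> w r = z r.
Proof.
move=> hyp W Z r0 rrho; apply/eqP; rewrite eq_le.
by rewrite (profile_comparison hyp Z W) ?(profile_comparison hyp W Z).
Qed.

(** A solution is compared with its own dilation: [mu = x / y] at the point [y] turns
    [profile_sliding] into this inequality. *)
Lemma profile_monotone {R : realType} (C D s : R) (rho : \bar R) (w w1 : R -> R) (x y : R) :
  cubic_ok C D s -> radial_profile C D s rho w w1 ->
  0 <= x -> x <= y -> (y%:E < rho)%E -> x ^+ 2 * w x <= y ^+ 2 * w y.
Proof.
move=> hyp W; rewrite le_eqVlt => /orP[/eqP <- y0 yrho|x0].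
  rewrite expr0n /= mul0r; exact (profile_ge0 hyp W y0 yrho).
rewrite le_eqVlt => /orP[/eqP -> //|xy] yrho.
have y0 : 0 < y by exact: lt_trans xy.
have := @profile_sliding R C D s hyp rho w w1 w w1 W W (x / y) y.
rewrite divr_gt0// ltr_pdivrMr// mul1r xy (ltW y0) => /(_ isT isT isT yrho).
rewrite divfK ?gt_eqF// => H.
have -> : x ^+ 2 * w x = y ^+ 2 * ((x / y) ^+ 2 * w x).
  by field; rewrite gt_eqF.
by rewrite ler_wpM2l// sqr_ge0.
Qed.

(** * The initial value problem *)

(** Integrating from [-1] makes the derivative two-sided at the origin, where later arguments
    start. *)
Lemma antiderivative {R : realType} (h : R -> R) : continuous h ->
  exists H : R -> R, forall r : R, -1 < r -> is_derive r 1 H (h r).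
Proof.
move=> ch; exists (fun x => \int[lebesgue_measure]_(t in `[-1, x]) h t) => r r1.
have r_lt : r < r + 1 by rewrite ltrDl.
have hint : lebesgue_measure.-integrable `[-1, (r + 1)] (EFin \o h).
  apply: continuous_compact_integrable; first exact: segment_compact.
  exact: continuous_subspaceT.
have [Dh hE] := continuous_FTC1_closed r_lt hint r1 (ch r).
by apply: DeriveDef; [exact: Dh | rewrite -hE derive1E].
Qed.

(* [y] is a radial solution of [y'' + 6 y' / r = h], regular at the origin. *)
Record radial_pair {R : realType} (h y y1 : R -> R) : Prop := RadialPair {
  pair_cont : forall r : R, 0 <= r -> {for r, continuous y};
  pair_d1 : forall r : R, 0 < r -> is_derive r 1 y (y1 r);
  pair_d2 : forall r : R, 0 < r -> is_derive r 1 y1 (h r - 6 * y1 r / r);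
  pair_0 : exists M d, 0 < d /\ forall r, 0 < r < d -> `|r ^+ 6 * y1 r| <= M * r }.

Lemma radial_pair_lin {R : realType} (h y y1 k z z1 : R -> R) (a b : R) :
  radial_pair h y y1 -> radial_pair k z z1 ->
  radial_pair (fun t => a * h t + b * k t) (fun t => a * y t + b * z t)
    (fun t => a * y1 t + b * z1 t).
Proof.
move=> Y Z; split.
- move=> r r0; apply: continuousD; apply: continuousM.
  + exact: cst_continuous.
  + exact: pair_cont Y _ _.
  + exact: cst_continuous.
  + exact: pair_cont Z _ _.
- move=> r r0; have HY := pair_d1 Y r0; have HZ := pair_d1 Z r0.
  by derive_eq; ring.
- move=> r r0; have HY := pair_d2 Y r0; have HZ := pair_d2 Z r0.
  by derive_eq; ring.
- have [M [d [d0 HM]]] := pair_0 Y; have [N [e [e0 HN]]] := pair_0 Z.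
  exists (`|a| * M + `|b| * N), (Num.min d e); split; first by rewrite lt_min d0.
  move=> r /andP[r0]; rewrite lt_min => /andP[rd re].
  have -> : r ^+ 6 * (a * y1 r + b * z1 r) =
    a * (r ^+ 6 * y1 r) + b * (r ^+ 6 * z1 r) by ring.
  apply: (le_trans (ler_normD _ _)); rewrite !(normrM a, normrM b).
  have -> : (`|a| * M + `|b| * N) * r = `|a| * (M * r) + `|b| * (N * r) by ring.
  apply: lerD; apply: ler_wpM2l => //. 
    by apply: HM; rewrite r0.
  by apply: HN; rewrite r0.
Qed.

Lemma radial_pair_le0 {R : realType} (h y y1 : R -> R) (r : R) :
  radial_pair h y y1 -> 0 < r -> (forall t, 0 < t < r -> h t <= 0) ->
  y1 r <= 0 /\ y r <= y 0.
Proof.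
move=> Y r0 h0; have [M [d [d0 HM]]] := pair_0 Y.
have y1_le0 x : 0 < x -> x <= r -> y1 x <= 0.
  move=> x0 xr; suff : x ^+ 6 * y1 x <= 0 by rewrite pmulr_rle0// exprn_gt0.
  apply: (@le0_of_origin R (fun t => t ^+ 6 * y1 t)
    (fun t => t ^+ 6 * h t) x M d) => // t /andP[t0 tx].
  - have Hy1 := pair_d2 Y t0.
    by derive_eq; rewrite /=; field; rewrite gt_eqF.
  - rewrite mulr_ge0_le0 ?exprn_ge0 ?(ltW t0)// h0// t0/=.
    exact: lt_le_trans xr.
split; first exact: y1_le0.
apply: (@nonincr_of_derive R y y1) => [|t /andP[t0 _]|t /andP[t0 _]|t /andP[t0 tr]].
- exact: ltW.
- exact: pair_cont Y _ _.
- exact: pair_d1 Y _ _.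
- by apply: y1_le0 => //; exact: ltW.
Qed.

Lemma radial_pair_le {R : realType} (h y y1 k z z1 : R -> R) (r : R) :
  radial_pair h y y1 -> radial_pair k z z1 -> 0 < r ->
  (forall t, 0 < t < r -> h t <= k t) ->
  y1 r <= z1 r /\ y r - y 0 <= z r - z 0.
Proof.
move=> Y Z r0 hk.
have [t /hk|] := radial_pair_le0 (radial_pair_lin 1 (-1) Y Z) r0.
  by lra.
by lra.
Qed.

(** The pair [z] is a barrier for both [y] and [- y], the latter being the combination with
    coefficients [-1] and [0]. *)
Lemma radial_pair_norm_le {R : realType} (h y y1 k z z1 : R -> R) (r : R) :
  radial_pair h y y1 -> radial_pair k z z1 -> 0 <= r ->
  (forall t, 0 < t < r -> `|h t| <= k t) -> `|y r - y 0| <= z r - z 0.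
Proof.
move=> Y Z; rewrite le_eqVlt => /orP[/eqP <- _|r0 hk].
  by rewrite !subrr normr0.
have hk1 t : 0 < t < r -> h t <= k t.
  by move=> /hk; apply: le_trans; exact: ler_norm.
have hk2 t : 0 < t < r -> -1 * h t + 0 * h t <= k t.
  move=> /hk; apply: le_trans; rewrite mul0r addr0 mulN1r -normrN; exact: ler_norm.
have [_ H1] := radial_pair_le Y Z r0 hk1.
have [_ H2] := radial_pair_le (radial_pair_lin (-1) 0 Y Y) Z r0 hk2.
by rewrite ler_norml; apply/andP; split; lra.
Qed.

(** The equation in divergence form is integrated twice from [0]: [y1] is [r^-6] times a primitive
    of [t^6 h], and [y] is a primitive of [y1]. *)
Lemma radial_pair_exists {R : realType} (h : R -> R) : continuous h ->
  exists y, [/\ continuous y, y 0 = 0 & exists y1, radial_pair h y y1].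
Proof.
move=> ch.
have ch6 : continuous (fun t : R => t ^+ 6 * h t).
  move=> t; apply: (@continuousM _ _ (fun t : R => t ^+ 6) h); last exact: ch.
  exact: exprn_continuous.
have [P0 HP0] := antiderivative ch6.
pose P r := P0 r - P0 0.
have DP (r : R) : 0 <= r -> is_derive r 1 P (r ^+ 6 * h r).
  move=> r0; have H : is_derive r 1 P0 (r ^+ 6 * h r) by apply: HP0; lra.
  by rewrite /P; derive_eq; ring.
(* The value [0] for [r <= 0] makes [y1] continuous, since the mean value theorem for [P] bounds it
   by [M r] on the right. *)
pose y1 (r : R) := if r <= 0 then 0 else P r / r ^+ 6.
have [M M0 HM] : exists2 M, 0 <= M & forall t, 0 <= t <= 1 -> `|h t| <= M.
  have [c _ Hc] := @EVT_max R (fun t => `|h t|) 0 1 ler01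
    (continuous_subspaceT (fun t => continuous_comp (ch t) (@norm_continuous _ _ (h t)))).
  by exists `|h c| => // t t01; apply: Hc; rewrite in_itv.
have y1_bound (r : R) : `|r| < 1 -> `|y1 r| <= M * `|r|.
  move=> r1; rewrite /y1; case: ifPn => [_|]; first by rewrite normr0 mulr_ge0.
  rewrite -ltNge => r0; rewrite (gtr0_norm r0) in r1 *.
  have [x /andP[x0 _]|x /andP[x0 _]|c /andP[c0 cr]] :=
    @mean_value R P (fun t => t ^+ 6 * h t) 0 r r0.
  - exact: is_derive_continuous (DP x x0).
  - by apply: DP; exact: ltW.
  rewrite /P subrr !subr0 => ->.
  have r6 : 0 < r ^+ 6 by exact: exprn_gt0.
  have H : `|c ^+ 6 * h c * r| <= r ^+ 6 * M * r.
    rewrite normrM (gtr0_norm r0) ler_pM2r// normrM ger0_norm; last first.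
      by rewrite exprn_ge0// ltW.
    apply: ler_pM => //; first by rewrite exprn_ge0// ltW.
      by rewrite lerXn2r ?nnegrE ?ltW.
    by apply: HM; lra.
  have -> : M * r = r ^+ 6 * M * r / r ^+ 6 by field; rewrite gt_eqF.
  by rewrite normrM normfV (gtr0_norm r6) ler_pM2r// invr_gt0.
have Dy1 (r : R) : 0 < r -> is_derive r 1 y1 (h r - 6 * y1 r / r).
  move=> r0; have DPr := DP r (ltW r0).
  apply: (@near_eq_is_derive _ _ _ (fun t => P t / t ^+ 6)).
    near=> t; rewrite /y1 leNgt ifF//; apply/negbF.
    by near: t; exact: lt_nbhsr.
  have rn0 : r != 0 by rewrite gt_eqF.
  derive_eq; first exact: expf_neq0.
  by rewrite /y1 leNgt r0 /=; field.
have cy1 : continuous y1.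
  move=> r; have [r0|r0|r0] := ltgtP r 0; last rewrite r0.
  - apply: (@is_derive_continuous _ _ _ 0).
    have H0 : is_derive (r : R) 1 (fun=> 0 : R) 0 := is_derive_cstf 0 r 1.
    apply: near_eq_is_derive H0.
    near=> t; rewrite /y1 ifT//; apply: ltW.
    by near: t; exact: lt_nbhsl.
  - exact: is_derive_continuous (Dy1 r r0).
  - apply/cvgrPdist_le => e e0.
    have Me : 0 < e / (M + 1) by rewrite divr_gt0// ltr_wpDl.
    near=> t.
    rewrite {1}/y1 lexx sub0r normrN.
    have t1 : `|t| < Num.min 1 (e / (M + 1)).
      near: t; apply/nbhs_ballP; exists (Num.min 1 (e / (M + 1))) => /=.
        by rewrite lt_min ltr01 Me.
      by move=> t; rewrite /ball /= sub0r normrN.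
    move: t1; rewrite lt_min => /andP[t1 te].
    apply: (le_trans (y1_bound t t1)).
    apply: (@le_trans _ _ ((M + 1) * `|t|)); first by rewrite ler_wpM2r// lerDl.
    by rewrite mulrC -ler_pdivlMr ?ltW// ltr_wpDl.
have [Y0 HY0] := antiderivative cy1.
have neg1 : -1 < (0 : R) by lra.
have cY0 : continuous (fun r : R => Y0 (Num.max r 0) - Y0 0).
  move=> r; apply: (@continuousB _ _ _ (fun r : R => Y0 (Num.max r 0)) (fun=> Y0 0));
    last exact: cst_continuous.
  apply: (@continuous_comp _ _ _ (fun r : R => Num.max r 0) Y0).
    apply: (@continuous_max _ _ id (fun=> 0)); first exact: cvg_id.
    exact: cst_continuous.
  apply: is_derive_continuous; apply: HY0.
  by rewrite lt_max neg1 orbT.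
(* The maximum keeps the argument in the half-line on which [Y0] is known to be differentiable and
   extends [y] by a constant to the left. *)
exists (fun r => Y0 (Num.max r 0) - Y0 0); split => //.
  by rewrite maxxx subrr.
exists y1; split => [r _|r r0|//|].
- exact: cY0.
- apply: (@near_eq_is_derive _ _ _ (fun t => Y0 t - Y0 0)).
    near=> t; rewrite (max_idPl _)//; apply: ltW.
    by near: t; exact: lt_nbhsr.
  have H : is_derive r 1 Y0 (y1 r) by apply: HY0; lra.
  by derive_eq; rewrite subr0.
- exists M, 1; split => // r /andP[r0 r1].
  have r1' : `|r| < 1 by rewrite gtr0_norm.
  have := y1_bound r r1'; rewrite (gtr0_norm r0) => H.
  rewrite normrM ger0_norm ?exprn_ge0 ?(ltW r0)//.
  rewrite -[leRHS]mul1r ler_pM ?exprn_ge0 ?(ltW r0)//.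
  by rewrite exprn_ile1 ?ltW.
Unshelve. all: by end_near. Qed.

(** Only the argument of [cubic] is cut off at [s]; the outer factor stays unbounded. The result is
    nonpositive, Lipschitz in [a] uniformly in [r], and vanishes once [r^2 a] passes [s]. A solution
    with [w >= 0] and [r^2 w <= s] solves the original equation. *)
Definition trunc {R : realType} (C D s r a : R) : R :=
  Num.max a 0 * cubic C D s (Num.min (r ^+ 2 * Num.max a 0) s).

Section Trunc.
Context {R : realType} (C D s : R) (hyp : cubic_ok C D s).
Implicit Types (a b r x y p q : R).

Let C0 : 0 < C. Proof. by case: hyp. Qed.
Let D0 : 0 < D. Proof. by case: hyp. Qed.
Let s0 : 0 < s. Proof. by case: hyp. Qed.

Let max0 a : 0 <= Num.max a 0. Proof. by rewrite le_max lexx orbT. Qed.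

Let clampP r a : 0 <= Num.min (r ^+ 2 * Num.max a 0) s <= s.
Proof. by rewrite le_min ge_min lexx orbT (ltW s0) mulr_ge0 ?sqr_ge0//. Qed.

Let k := s * (C * s + D).

Let k_gt0 : 0 < k.
Proof. by rewrite mulr_gt0// addr_gt0// mulr_gt0. Qed.

Lemma cubic_norm_le x : 0 <= x -> x <= s -> `|cubic C D s x| <= (s - x) * (C * s + D).
Proof.
move=> x_ge0 xs; have Cx : C * x <= C * s by rewrite ler_pM2l.
have Cx0 : 0 <= C * x by rewrite mulr_ge0// ltW.
have D0' := D0; rewrite /cubic normrM distrC.
rewrite (ger0_norm (x := s - x)) ?subr_ge0// (ger0_norm (x := C * x + D)).
  by rewrite ler_wpM2l ?subr_ge0// lerD2r.
by rewrite addr_ge0// ltW.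
Qed.

Let cubic_norm_le_k x : 0 <= x -> x <= s -> `|cubic C D s x| <= k.
Proof.
move=> x_ge0 xs; apply: (le_trans (cubic_norm_le x_ge0 xs)).
by rewrite ler_wpM2r ?lerBlDr ?lerDl// addr_ge0 ?mulr_ge0 ?ltW.
Qed.

Lemma trunc_le0 r a : trunc C D s r a <= 0.
Proof.
have /andP[c0 cs] := clampP r a.
by rewrite mulr_ge0_le0// (cubic_le0 hyp).
Qed.

Lemma trunc_norm_le r a : `|trunc C D s r a| <= k * Num.max a 0.
Proof.
have /andP[c0 cs] := clampP r a.
by rewrite /trunc normrM ger0_norm// mulrC ler_wpM2r// cubic_norm_le_k.
Qed.

(** Where [r^2 a] exceeds [s] the cubic vanishes, and elsewhere [r^2 a] itself is at most [s]. *)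
Lemma trunc_norm_le2 r a : r ^+ 2 * `|trunc C D s r a| <= k * s.
Proof.
have /andP[c0 cs] := clampP r a; rewrite /trunc normrM ger0_norm// mulrA.
set p := r ^+ 2 * _ in c0 cs *; have p0 : 0 <= p by rewrite mulr_ge0// sqr_ge0.
have [ps|sp] := leP p s; last first.
  by rewrite /cubic subrr mul0r normr0 mulr0 mulr_ge0// ltW.
by rewrite mulrC ler_pM// cubic_norm_le_k.
Qed.

(** The constant is independent of [r]: the variation of the cubic carries a factor [r^2], but only
    in combination with [y], and [r^2 y <= s] as long as the truncation is inactive at [b]. *)
Let trunc_lip_le r a b : b <= a ->
  `|trunc C D s r a - trunc C D s r b| <=
     (k + s * (3 * C * s + D)) * (Num.max a 0 - Num.max b 0).
Proof.
move=> ba; have /andP[a0 as_] := clampP r a; have /andP[b0 bs] := clampP r b.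
rewrite /trunc; set x := Num.max a 0 in a0 as_ *; set y := Num.max b 0 in b0 bs *.
set p := Num.min _ s in a0 as_ *; set q := Num.min _ s in b0 bs *.
have xy : y <= x by rewrite /x /y ge_max !le_max ba lexx !orbT.
have y_ge0 : 0 <= y by exact: max0.
have -> : x * cubic C D s p - y * cubic C D s q =
    (x - y) * cubic C D s p + (y * (p - q)) * (C * (p + q) + D - C * s).
  by rewrite /cubic; ring.
have -> : (k + s * (3 * C * s + D)) * (x - y) =
    (x - y) * k + s * (x - y) * (3 * C * s + D) by ring.
apply: (le_trans (ler_normD _ _)); apply: lerD.
  by rewrite normrM ger0_norm ?subr_ge0// ler_wpM2l ?subr_ge0// cubic_norm_le_k.
rewrite normrM; apply: ler_pM => //.
  have qp : q <= p.
    rewrite /p /q le_min ge_min ge_min lexx orbT andbT.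
    by rewrite ler_wpM2l ?sqr_ge0.
  rewrite ger0_norm ?mulr_ge0 ?subr_ge0//.
  have [ys|sy] := leP (r ^+ 2 * y) s.
    have qE : q = r ^+ 2 * y by rewrite /q min_l.
    have pE : p <= r ^+ 2 * x by rewrite /p ge_min lexx.
    apply: (@le_trans _ _ (y * (r ^+ 2 * (x - y)))).
      by rewrite ler_wpM2l// qE mulrBr lerB.
    by rewrite mulrCA mulrA ler_wpM2r ?subr_ge0// .
  have qE : q = s by rewrite /q min_r// ltW.
  have pE : p = s by apply/eqP; rewrite eq_le as_ -qE.
  by rewrite pE qE subrr mulr0 mulr_ge0 ?subr_ge0// ltW.
have h1 : C * (p + q) <= C * (s + s) by rewrite ler_pM2l// lerD.
have h2 : 0 <= C * (p + q) by rewrite mulr_ge0 ?addr_ge0 ?(ltW C0).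
have h3 : 0 < C * s by rewrite mulr_gt0.
by have := D0; rewrite ler_norml => D0'; apply/andP; split; lra.
Qed.

Definition trunc_lip := k + s * (3 * C * s + D).

Lemma trunc_lip_gt0 : 0 < trunc_lip.
Proof.
rewrite addr_gt0// mulr_gt0// addr_gt0// mulr_gt0// mulr_gt0//.
Qed.

Lemma trunc_lipschitz r a b :
  `|trunc C D s r a - trunc C D s r b| <= trunc_lip * `|a - b|.
Proof.
wlog ba : a b / b <= a.
  move=> H; have [/H//|/ltW /H] := leP b a.
  by rewrite distrC [in leRHS]distrC.
apply: (le_trans (trunc_lip_le r ba)).
rewrite ler_wpM2l ?(ltW trunc_lip_gt0)// ger0_norm ?subr_ge0//.
rewrite {1}/Num.max; case: ifPn => a0; rewrite /Num.max; case: ifPn => b0; lra.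
Qed.

Lemma trunc_cont (w : R -> R) : continuous w ->
  continuous (fun r : R => trunc C D s r (w r)).
Proof.
move=> cw.
have cm : continuous (fun r : R => Num.max (w r) 0).
  move=> r; apply: (@continuous_max _ _ w (fun=> 0)); first exact: cw.
  exact: cst_continuous.
have c2 : continuous (fun r : R => r ^+ 2 * Num.max (w r) 0).
  move=> r; apply: (@continuousM _ _ (fun r : R => r ^+ 2) (fun r : R => Num.max (w r) 0)).
    exact: exprn_continuous.
  exact: cm.
have c3 : continuous (fun r : R => Num.min (r ^+ 2 * Num.max (w r) 0) s).
  move=> r; apply: (@continuous_min _ _ (fun r : R => r ^+ 2 * Num.max (w r) 0) (fun=> s)).
    exact: c2.
  exact: cst_continuous.
have cc : continuous (cubic C D s).
  by move=> x; apply: (@is_derive_continuous _ _ _ _); rewrite /cubic; der.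
move=> r; apply: (@continuousM _ _ (fun r : R => Num.max (w r) 0)
  (fun r : R => cubic C D s (Num.min (r ^+ 2 * Num.max (w r) 0) s))); first exact: cm.
apply: (@continuous_comp _ _ _
  (fun r : R => Num.min (r ^+ 2 * Num.max (w r) 0) s) (cubic C D s)).
  exact: c3.
exact: cc.
Qed.

Lemma trunc_id r a : 0 <= a -> r ^+ 2 * a <= s ->
  trunc C D s r a = a * cubic C D s (r ^+ 2 * a).
Proof. by move=> a0 ras; rewrite /trunc max_l// min_l. Qed.

Lemma trunc_ge r a : 0 <= a -> s <= r ^+ 2 * a -> trunc C D s r a = 0.
Proof. by move=> a0 ras; rewrite /trunc max_l// min_r// /cubic subrr mul0r mulr0. Qed.
End Trunc.

(** * Picard iteration in a weighted norm *)

Lemma halves_lt {R : realType} (M e : R) : 0 < e -> exists n, M / 2 ^+ n < e.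
Proof.
move=> e0; have Me : 0 <= `|M| / e by rewrite divr_ge0// ltW.
exists (Num.bound (`|M| / e)).
rewrite ltr_pdivrMr ?exprn_gt0// mulrC -ltr_pdivrMr//.
have /(le_lt_trans _) := archi_boundP Me; move/(_ (M / e)).
rewrite ler_pM2r ?invr_gt0// ler_norm => /(_ isT) /lt_le_trans; apply.
by rewrite -natrX ler_nat ltnW// ltn_expl.
Qed.

Lemma le_of_halves {R : realType} (x a M : R) :
  (forall n, x <= a + M / 2 ^+ n) -> x <= a.
Proof.
move=> H; rewrite leNgt; apply/negP; rewrite -subr_gt0 => /(halves_lt M)[n].
by have := H n; lra.
Qed.

(** The intervals around [u n] whose radius [2 c / 2^n] is the tail of the geometric series are
    nested; the limit is the supremum of their left ends. *)
Lemma geometric_limit {R : realType} (u : nat -> R) (c : R) :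
  (forall n, `|u n.+1 - u n| <= c / 2 ^+ n) ->
  exists l, forall n, `|l - u n| <= 2 * c / 2 ^+ n.
Proof.
move=> H; pose d n := 2 * c / 2 ^+ n.
have dS n : d n.+1 = d n - c / 2 ^+ n.
  by rewrite /d exprS; field; rewrite expf_neq0.
have d0 n : 0 <= d n.
  rewrite /d -mulrA mulr_ge0//; apply: le_trans (H n); exact: normr_ge0.
have up n k : u n - d n <= u (n + k)%N - d (n + k)%N.
  elim: k => [|k IH]; first by rewrite addn0.
  by apply: (le_trans IH); rewrite addnS dS; have := H (n + k)%N; rewrite ler_norml; lra.
have down n k : u (n + k)%N + d (n + k)%N <= u n + d n.
  elim: k => [|k IH]; first by rewrite addn0.
  by apply: le_trans IH; rewrite addnS dS; have := H (n + k)%N; rewrite ler_norml; lra.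
have ab n m : u n - d n <= u m + d m.
  apply: (le_trans (up n m)); apply: le_trans (down m n).
  by rewrite addnC; have := d0 (m + n)%N; lra.
pose A := [set u n - d n | n in setT].
have sA : has_sup A.
  by split; [exists (u 0%N - d 0%N), 0%N | exists (u 0%N + d 0%N) => _ [n _ <-]].
exists (sup A) => n; rewrite ler_norml -/(d n); apply/andP; split.
  have : u n - d n <= sup A by apply: sup_upper_bound => //; exists n.
  lra.
have : sup A <= u n + d n by apply: ge_sup; [exists (u 0%N - d 0%N), 0%N | move=> _ [m _ <-]].
lra.
Qed.

(** For [L > 0] the source is at least [14 L] times the function. Inverting the radial operator thus
    gains [1 / (14 L)] in the norm with weight [exp(L r^2)], which compensates any Lipschitz
    constant. *)
Lemma radial_pair_exp {R : realType} (L : R) : radial_pair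
  (fun r => (4 * L ^+ 2 * r ^+ 2 + 14 * L) * expR (L * r ^+ 2))
  (fun r => expR (L * r ^+ 2)) (fun r => 2 * L * r * expR (L * r ^+ 2)).
Proof.
have DE (r : R) : is_derive r 1 (fun r => expR (L * r ^+ 2)) (2 * L * r * expR (L * r ^+ 2)).
  have H : is_derive r 1 (fun r => L * r ^+ 2) (2 * L * r) by derive_eq; ring.
  have HE : is_derive (L * r ^+ 2) 1 expR (expR (L * r ^+ 2)) := is_derive_expR _.
  have := @is_derive1_comp R expR (fun r => L * r ^+ 2) r _ _ HE H.
  by rewrite mulrC.
split => [r r0|r r0|r r0|].
- exact: is_derive_continuous (DE r).
- exact: DE.
- by have HD := DE r; derive_eq; field; rewrite gt_eqF.
- exists (`|2 * L| * expR `|L|), 1; split => // r /andP[r0 r1].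
  have -> : r ^+ 6 * (2 * L * r * expR (L * r ^+ 2)) =
    r ^+ 6 * ((2 * L) * expR (L * r ^+ 2) * r) by ring.
  rewrite normrM ger0_norm ?exprn_ge0 ?(ltW r0)//.
  rewrite normrM (gtr0_norm r0) mulrA ler_pM2r// normrM (gtr0_norm (expR_gt0 _)).
  have r01 : 0 <= r <= 1 by rewrite !ltW.
  have /andP[r_ge0 r_le1] := r01.
  rewrite -[leRHS]mul1r; apply: ler_pM.
  - exact: exprn_ge0.
  - by rewrite mulr_ge0 ?expR_ge0.
  - exact: exprn_ile1.
  rewrite ler_wpM2l// ler_expR; apply: (@le_trans _ _ (`|L| * r ^+ 2)).
    by rewrite ler_wpM2r ?ler_norm// sqr_ge0.
  by rewrite ler_piMr// exprn_ile1.
Qed.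

Lemma radial_pair_exp_le {R : realType} (L M r : R) (h y y1 : R -> R) :
  0 < L -> 0 <= M -> radial_pair h y y1 -> 0 <= r ->
  (forall t, 0 < t < r -> `|h t| <= 14 * L * M * expR (L * t ^+ 2)) ->
  `|y r - y 0| <= M * expR (L * r ^+ 2).
Proof.
move=> L0 M0 Y r0 H.
have := radial_pair_norm_le Y (radial_pair_lin M 0 (radial_pair_exp L) (radial_pair_exp L)) r0.
move=> /(_ _)/le_trans; apply.
  move=> t /H /le_trans; apply; rewrite mul0r addr0 mulrA ler_wpM2r ?expR_ge0//.
  have := mulr_ge0 M0 (mulr_ge0 (sqr_ge0 L) (sqr_ge0 t)); lra.
by rewrite !mul0r !addr0 expr0n mulr0 expR0 mulr1 lerBlDr lerDl.
Qed.

Section Ivp.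
Context {R : realType} (C D s : R) (hyp : cubic_ok C D s).
Let N := trunc C D s.
Let K := trunc_lip C D s.
Let K0 : 0 < K. Proof. exact: trunc_lip_gt0. Qed.
(** With this choice [14 L = 2 K], and the Picard map contracts by the factor [1/2]. *)
Let L := K / 7.
Let L0 : 0 < L. Proof. by rewrite divr_gt0. Qed.
Let E (r : R) := expR (L * r ^+ 2).
Let E0 r : 0 < E r. Proof. exact: expR_gt0. Qed.

Lemma picard_contraction (v w y y1 z z1 : R -> R) (M r : R) : 0 <= M -> 0 <= r ->
  radial_pair (fun t => N t (v t)) y y1 -> radial_pair (fun t => N t (w t)) z z1 ->
  (forall t, 0 <= t -> t <= r -> `|v t - w t| <= M * E t) ->
  `|(y r - y 0) - (z r - z 0)| <= M / 2 * E r.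
Proof.
move=> M0 r0 Y Z H.
have -> : (y r - y 0) - (z r - z 0) = (1 * y r + -1 * z r) - (1 * y 0 + -1 * z 0) by ring.
apply: (radial_pair_exp_le L0 _ (radial_pair_lin 1 (-1) Y Z) r0).
  by rewrite divr_ge0.
move=> t /andP[t0 tr]; rewrite mul1r mulN1r.
apply: (le_trans (trunc_lipschitz hyp t (v t) (w t))).
have := H t (ltW t0) (ltW tr); rewrite -(ler_pM2l K0) => /le_trans; apply.
have -> : 14 * L * (M / 2) * expR (L * t ^+ 2) = K * (M * E t); last by [].
have -> : K = 7 * L by rewrite /L; field.
by rewrite /E; field.
Qed.

Lemma ivp_exists (b : R) : 0 <= b -> exists w w1,
  [/\ continuous w, w 0 = b & radial_pair (fun r => N r (w r)) w w1].
Proof.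
move=> b0.
have : forall h : R -> R, exists y : R -> R, continuous h ->
    [/\ continuous y, y 0 = 0 & exists y1, radial_pair h y y1].
  move=> h; have [/radial_pair_exists[y Hy]|nc] := pselect (continuous h); by [exists y|exists h].
move=> /choice[S HS].
pose T (w : R -> R) (r : R) : R := b + S (fun t => N t (w t)) r.
have TP w : continuous w ->
    [/\ continuous (T w), T w 0 = b & exists y1, radial_pair (fun r => N r (w r)) (T w) y1].
  move=> /(@trunc_cont R C D s) /HS [cS S0 [y1 Y]]; split.
  - move=> r; apply: (@continuousD _ _ _ (fun=> b) (S (fun t => N t (w t)))); last exact: cS.
    exact: cst_continuous.
  - by rewrite /T S0 addr0.
  - exists y1; split.
    + move=> r r0; apply: (@continuousD _ _ _ (fun=> b) (S (fun t => N t (w t)))); last exact: cS.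
      exact: cst_continuous.
    + by move=> r r0; have H := pair_d1 Y r0; rewrite /T; derive_eq; rewrite add0r.
    + by move=> r r0; exact: pair_d2 Y _ _.
    + exact: pair_0 Y.
pose W n := iter n T (fun=> b).
have cW n : continuous (W n).
  by elim: n => [|n /TP[]//] r; exact: cst_continuous.
have WS n r : 0 <= r -> `|W n.+1 r - W n r| <= b * E r / 2 ^+ n.
  elim: n r => [|n IH] r r0.
    have [_ T0 [y1 Y]] := TP _ (cW 0%N).
    rewrite expr0 divr1 -[X in _ - X]T0.
    apply: (radial_pair_exp_le L0 b0 Y r0) => t /andP[t0 _].
    apply: (le_trans (trunc_norm_le hyp t b)).
    have E1 : 1 <= expR (L * t ^+ 2).
      rewrite -[X in X <= _]expR0 ler_expR.
      by apply: mulr_ge0; [exact: ltW|exact: sqr_ge0].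
    apply: (@le_trans _ _ (14 * L * b)); last first.
      apply: ler_peMr => //; apply: mulr_ge0 => //; apply: mulr_ge0 => //.
      exact: ltW.
    have [C0 D0 s0 _] := hyp; rewrite max_l// ler_wpM2r// /L /K /trunc_lip.
    have := mulr_gt0 s0 (mulr_gt0 C0 s0); have := mulr_gt0 s0 D0; lra.
  have [_ T0 [y1 Y]] := TP _ (cW n.+1); have [_ T0' [y1' Y']] := TP _ (cW n).
  have -> : W n.+2 r - W n.+1 r = (T (W n.+1) r - T (W n.+1) 0) - (T (W n) r - T (W n) 0).
    by rewrite T0 T0' /=; ring.
  have -> : b * E r / 2 ^+ n.+1 = b / 2 ^+ n / 2 * E r.
    by rewrite exprS; field; rewrite expf_neq0.
  apply: (picard_contraction _ r0 Y Y'); first by rewrite divr_ge0// exprn_ge0.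
  by move=> t t0 _; rewrite mulrAC; exact: IH.
have : forall r, exists l, 0 <= r -> forall n, `|l - W n r| <= 2 * (b * E r) / 2 ^+ n.
  move=> r; have [r0|nr] := pselect (0 <= r); last by exists 0.
  by have [l Hl] := geometric_limit (fun n => WS n r r0); exists l.
move=> /choice[l Hl].
pose w r := l (Num.max r 0).
have mx0 (r : R) : 0 <= Num.max r 0 by rewrite le_max lexx orbT.
have wW n r : `|w r - W n (Num.max r 0)| <= 2 * (b * E (Num.max r 0)) / 2 ^+ n.
  exact: Hl.
have cw : continuous w.
  move=> r; apply/cvgrPdist_le => e e0.
  pose B := E (`|r| + 1).
  have Ele (t : R) : 0 <= t -> t <= `|r| + 1 -> E t <= B.
    by move=> t0 tr; rewrite ler_expR ler_pM2l// lerXn2r ?nnegrE.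
  have e30 : 0 < e / 3 by rewrite divr_gt0.
  have [n Hn] := halves_lt (2 * (b * B)) e30.
  have wWn (t : R) : t <= `|r| + 1 -> `|w t - W n (Num.max t 0)| <= e / 3.
    move=> tr; apply: (le_trans (wW n t)); apply: le_trans (ltW Hn).
    rewrite ler_pM2r ?invr_gt0 ?exprn_gt0// ler_pM2l// ler_wpM2l// Ele//.
    by rewrite ge_max tr addr_ge0.
  have cWm : {for r, continuous (fun t : R => W n (Num.max t 0))}.
    apply: (@continuous_comp _ _ _ (fun r : R => Num.max r 0) (W n)); last exact: cW.
    apply: (@continuous_max _ _ id (fun=> 0)); first exact: cvg_id.
    exact: cst_continuous.
  have rr : r < `|r| + 1 by apply: (le_lt_trans (ler_norm r)); rewrite ltrDl.
  near=> t.
  have h1 : `|w r - W n (Num.max r 0)| <= e / 3 by apply: wWn; exact: ltW.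
  have h2 : `|w t - W n (Num.max t 0)| <= e / 3.
    by apply: wWn; apply: ltW; near: t; exact: lt_nbhsl.
  have h3 : `|W n (Num.max r 0) - W n (Num.max t 0)| <= e / 3.
    by near: t; move/cvgrPdist_le: cWm; apply.
  move: h1 h2 h3; rewrite !ler_norml; lra.
have [cT T0 [y1 Y]] := TP _ cw.
(* Both [T w r] and [w r] lie within [b E(r) / 2^n] of the iterate [W n.+1], for every [n]. *)
have Tw r : 0 <= r -> T w r = w r.
  move=> r0; apply/eqP; rewrite -subr_eq0 -normr_le0.
    apply: (@le_of_halves _ _ _ (3 * b * E r)) => n.
  have [_ T0' [y1' Y']] := TP _ (cW n).
  have Mn : 0 <= 2 * b / 2 ^+ n by rewrite divr_ge0 ?exprn_ge0// mulr_ge0.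
  have := picard_contraction Mn r0 Y Y' _.
  rewrite T0 T0' => H1.
  have {H1} : `|T w r - b - (T (W n) r - b)| <= 2 * b / 2 ^+ n / 2 * E r.
    apply: H1 => t t0 tr; have := wW n t; rewrite (max_idPl t0) => /le_trans; apply.
    by rewrite mulrA mulrAC.
  have := wW n.+1 r; rewrite (max_idPl r0) -[W n.+1 r]/(T (W n) r).
  have -> : 2 * (b * E r) / 2 ^+ n.+1 = b * E r / 2 ^+ n.
    by rewrite exprS; field; rewrite expf_neq0.
  have -> : 2 * b / 2 ^+ n / 2 * E r = b * E r / 2 ^+ n.
    by field; rewrite expf_neq0.
  have -> : 3 * b * E r / 2 ^+ n = 3 * (b * E r / 2 ^+ n) by ring.
  have : 0 <= b * E r / 2 ^+ n by rewrite divr_ge0 ?exprn_ge0// mulr_ge0// ltW.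
  set q := b * E r / _; rewrite !ler_norml; lra.
exists (T w), y1; split => //; split.
- exact: pair_cont Y.
- exact: pair_d1 Y.
- by move=> r r0; rewrite Tw ?(ltW r0)//; exact: pair_d2 Y _ _.
- exact: pair_0 Y.
Unshelve. all: by end_near. Qed.
End Ivp.

(** * Shooting *)

Section Flow.
Context {R : realType} (C D s : R) (hyp : cubic_ok C D s).
Implicit Types (a b r x y t eps d : R).

Let C0 : 0 < C. Proof. by case: hyp. Qed.
Let D0 : 0 < D. Proof. by case: hyp. Qed.
Let s0 : 0 < s. Proof. by case: hyp. Qed.

Lemma flow_exists : exists W W1 : R -> R -> R, forall b, 0 <= b ->
  [/\ continuous (W b), W b 0 = b &
    radial_pair (fun r => trunc C D s r (W b r)) (W b) (W1 b)].
Proof.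
have : forall b, exists p : (R -> R) * (R -> R), 0 <= b -> [/\ continuous p.1, p.1 0 = b &
    radial_pair (fun r => trunc C D s r (p.1 r)) p.1 p.2].
  move=> b; have [b0|nb] := pselect (0 <= b); last by exists (id, id).
  by have [w [w1 H]] := ivp_exists hyp b0; exists (w, w1).
move=> /choice[f Hf].
by exists (fun b => (f b).1), (fun b => (f b).2) => b /Hf.
Qed.

Variables (W W1 : R -> R -> R).
Hypothesis WP : forall b, 0 <= b -> [/\ continuous (W b), W b 0 = b &
    radial_pair (fun r => trunc C D s r (W b r)) (W b) (W1 b)].

Let cW b : 0 <= b -> continuous (W b). Proof. by case/WP. Qed.
Let W0 b : 0 <= b -> W b 0 = b. Proof. by case/WP. Qed.
Let WR b : 0 <= b ->
  radial_pair (fun r => trunc C D s r (W b r)) (W b) (W1 b).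
Proof. by case/WP. Qed.

Let k := s * (C * s + D).
Let k0 : 0 < k. Proof. by rewrite mulr_gt0// addr_gt0// mulr_gt0. Qed.

Lemma flow_nonincr b x y : 0 <= b -> 0 <= x -> x <= y -> W b y <= W b x.
Proof.
move=> b0 x0 xy; apply: (@nonincr_of_derive R (W b) (W1 b)) => // [z _|z /andP[xz _]|z /andP[xz _]].
- exact: cW.
- by apply: pair_d1 (WR b0) _ _; exact: le_lt_trans xz.
- have z0 : 0 < z by exact: le_lt_trans xz.
  by have [t _|] := radial_pair_le0 (WR b0) z0; first exact: trunc_le0.
Qed.

Lemma flow_le b r : 0 <= b -> 0 <= r -> W b r <= b.
Proof. by move=> b0 r0; rewrite -[leRHS](W0 b0) flow_nonincr. Qed.

Let pair_linear c : radial_pair (fun r => c / r) (fun r => c * r / 6) (fun=> c / 6).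
Proof.
split => [r r0|r r0|r r0|].
- by apply: (@is_derive_continuous _ _ _ (c / 6)); derive_eq; ring.
- by derive_eq; ring.
- by derive_eq; field; rewrite gt_eqF.
- exists (`|c / 6|), 1; split => // r /andP[r0 r1].
  rewrite normrM mulrC ler_wpM2l// ger0_norm ?exprn_ge0 ?(ltW r0)//.
  by rewrite -[leRHS]expr1 ler_wiXn2l ?ltW.
Qed.

(* The bounds [k b] and [k s / r^2] on the nonlinearity have the geometric mean
   [k sqrt (b s) / r], the source of a linear function. *)
Lemma flow_ge b r : 0 <= b -> 0 <= r ->
  b - k * Num.sqrt b * Num.sqrt s * r / 6 <= W b r.
Proof.
move=> b0 r0; pose c := k * Num.sqrt b * Num.sqrt s.
have c0 : 0 <= c by rewrite /c mulr_ge0 ?sqrtr_ge0// mulr_ge0 ?sqrtr_ge0// ltW.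
have := radial_pair_norm_le (WR b0) (pair_linear c) r0.
rewrite W0// mulr0 mul0r subr0 -/c => H.
have : `|W b r - b| <= c * r / 6.
  apply: H => t /andP[t0 tr].
  rewrite ler_pdivlMr// -(ler_pXn2r (ltn0Sn 1)) ?nnegrE//; last first.
    by rewrite mulr_ge0// ltW.
  have n1 := trunc_norm_le2 hyp t (W b t).
  have n2 : `|trunc C D s t (W b t)| <= k * b.
    apply: (le_trans (trunc_norm_le hyp t (W b t))).
    by rewrite ler_wpM2l ?(ltW k0)// ge_max b0 flow_le// ltW.
  have -> : c ^+ 2 = (k * b) * (k * s).
    by rewrite /c 2!exprMn !sqr_sqrtr ?(ltW s0)//; ring.
  set n := `|_| in n1 n2 *; have n0 : 0 <= n by exact: normr_ge0.
  have -> : (n * t) ^+ 2 = n * (t ^+ 2 * n) by ring.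
  apply: ler_pM => //; apply: mulr_ge0 => //; exact: sqr_ge0.
by rewrite ler_norml => /andP[+ _]; rewrite /c; lra.
Qed.

Let L := trunc_lip C D s / 7.

(** Starting from the maximum [M] of the difference on [[0, r]], each bound is fed into the
    contraction; the bounds converge to [2 |a - b|], the fixed point of [X -> X / 2 + |a - b|]. *)
Lemma flow_lipschitz a b r : 0 <= a -> 0 <= b -> 0 <= r ->
  `|W a r - W b r| <= 2 * `|a - b| * expR (L * r ^+ 2).
Proof.
move=> a0 b0 r0.
have L0 : 0 < L by rewrite divr_gt0// trunc_lip_gt0.
have E1 t : 1 <= expR (L * t ^+ 2).
  by rewrite -[X in X <= _]expR0 ler_expR mulr_ge0 ?sqr_ge0// ltW.
have cd : continuous (fun t : R => `|W a t - W b t|).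
  move=> t; apply: (@continuous_comp _ _ _ (fun t => W a t - W b t) (fun x : R => `|x|)).
    by apply: (@continuousB _ _ _ (W a) (W b)); [exact: cW|exact: cW].
  exact: norm_continuous.
have [c _ Hc] := EVT_max r0 (continuous_subspaceT cd).
set M := `|W a c - W b c| in Hc.
have M0 : 0 <= M by exact: normr_ge0.
have H n : forall t, 0 <= t -> t <= r ->
    `|W a t - W b t| <= (2 * `|a - b| + M / 2 ^+ n) * expR (L * t ^+ 2).
  have X0 m : 0 <= 2 * `|a - b| + M / 2 ^+ m.
    by rewrite addr_ge0// ?mulr_ge0// divr_ge0// exprn_ge0.
  elim: n => [|n IH] t t0 tr.
    apply: (@le_trans _ _ M); first by apply: Hc; rewrite in_itv /= t0.
    rewrite expr0 divr1; apply: (@le_trans _ _ (2 * `|a - b| + M)).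
      by rewrite lerDr mulr_ge0.
    by apply: ler_peMr => //; rewrite addr_ge0// mulr_ge0.
  have H := picard_contraction hyp (X0 n) t0 (WR a0) (WR b0) _.
  have {H} : `|W a t - W a 0 - (W b t - W b 0)| <=
      (2 * `|a - b| + M / 2 ^+ n) / 2 * expR (L * t ^+ 2).
    by apply: H => x x0 xt; apply: IH => //; exact: le_trans tr.
  rewrite !W0// => H.
  have -> : W a t - W b t = (W a t - a - (W b t - b)) + (a - b) by ring.
  apply: (le_trans (ler_normD _ _)); apply: (le_trans (lerD H (lexx _))).
  have : `|a - b| <= `|a - b| * expR (L * t ^+ 2) by exact: ler_peMr.
  have -> : M / 2 ^+ n.+1 = M / 2 ^+ n / 2.
    by rewrite exprS; field; rewrite expf_neq0.
  lra.
have H' : `|W a r - W b r| / expR (L * r ^+ 2) <= 2 * `|a - b|.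
  apply: (@le_of_halves _ _ _ M) => n.
  by rewrite ler_pdivrMr ?expR_gt0//; exact: H.
by rewrite -ler_pdivrMr ?expR_gt0.
Qed.

(** The absolute value extends the flow continuously to negative initial values, for which [WP] says
    nothing. *)
Lemma flow_cont r : 0 <= r -> continuous (fun b : R => W `|b| r).
Proof.
move=> r0 b; apply/cvgrPdist_le => e e0.
have E0 : 0 < 2 * expR (L * r ^+ 2) by rewrite mulr_gt0// expR_gt0.
have eE : 0 < e / (2 * expR (L * r ^+ 2)) by rewrite divr_gt0.
apply/nbhs_ballP; exists (e / (2 * expR (L * r ^+ 2))) => //= a.
rewrite /ball /= => ab; apply: (le_trans (flow_lipschitz _ _ r0)) => //.
rewrite mulrAC mulrC -ler_pdivlMr//.
by apply: le_trans (ltW ab); exact: ler_dist_dist.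
Qed.

Lemma flow_profile b rho : 0 <= b -> (0 < rho)%E ->
  (forall r, 0 <= r -> (r%:E < rho)%E -> 0 <= W b r) ->
  (forall r, 0 <= r -> (r%:E < rho)%E -> r ^+ 2 * W b r <= s) ->
  (forall eps, 0 < eps -> exists2 M, (M%:E < rho)%E &
    forall r, M < r -> 0 < r -> (r%:E < rho)%E -> `|r ^+ 2 * W b r - s| < eps) ->
  radial_profile C D s rho (W b) (W1 b).
Proof.
move=> b0 rho0 W_ge0 W_le bc; split => //.
- by move=> r _ _; exact: cW.
- by move=> r r0 _; exact: pair_d1 (WR b0) _ _.
- move=> r r0 rrho; rewrite -trunc_id ?W_ge0 ?W_le ?(ltW r0)//.
  exact: pair_d2 (WR b0) _ _.
- exact: pair_0 (WR b0).
Qed.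

(** Intermediate values in [b]: the flow from [0] stays nonpositive, and a large [b] overshoots
    because [flow_ge] loses only a multiple of [sqrt b]. *)
Lemma flow_hit (rho : R) : 0 < rho -> exists2 b, 0 <= b & rho ^+ 2 * W b rho = s.
Proof.
move=> rho0; pose kap := k * Num.sqrt s * rho / 6.
have kap0 : 0 <= kap.
  by rewrite divr_ge0// mulr_ge0 ?(ltW rho0)// mulr_ge0 ?sqrtr_ge0// ltW.
have srho : 0 < s / rho ^+ 2 by rewrite divr_gt0// exprn_gt0.
(* With [b = q^2] the lower bound of [flow_ge] at [rho] is [q (q - kap)], which is at least
   [s / rho^2] for this [q]. *)
pose q := kap + s / rho ^+ 2 + 1.
have q0 : 1 <= q by rewrite /q; lra.
pose b1 := q ^+ 2; have b10 : 0 <= b1 by exact: sqr_ge0.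
pose F (b : R) := rho ^+ 2 * W `|b| rho.
have cF : continuous F.
  move=> b; apply: (@continuousM _ _ (fun=> rho ^+ 2) (fun b : R => W `|b| rho)).
    exact: cst_continuous.
  exact: flow_cont (ltW rho0) b.
have F0 : F 0 <= s.
  apply: le_trans (ltW s0); rewrite /F normr0 mulr_ge0_le0 ?sqr_ge0//.
  by apply: flow_le => //; exact: ltW.
have F1 : s <= F b1.
  rewrite /F ger0_norm// mulrC -ler_pdivrMr ?exprn_gt0//.
  apply: le_trans (flow_ge b10 (ltW rho0)).
  rewrite /b1 sqrtr_sqr ger0_norm ?(le_trans ler01)//.
  have -> : q ^+ 2 - k * q * Num.sqrt s * rho / 6 = q * (q - kap) by rewrite /kap; ring.
  have -> : q - kap = s / rho ^+ 2 + 1 by rewrite /q; ring.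
  by apply: (@le_trans _ _ (s / rho ^+ 2 + 1)); [lra | apply: ler_peMl => //; lra].
have Fs : Num.min (F 0) (F b1) <= s <= Num.max (F 0) (F b1).
  by rewrite ge_min F0 le_max F1 orbT.
have [b] := IVT b10 (continuous_subspaceT cF) Fs.
rewrite in_itv /= => /andP[b0 _] Fb; exists b => //.
by move: Fb; rewrite /F ger0_norm.
Qed.

(** The truncation is inactive up to [rho]: [W b] is nonincreasing and positive at [rho], and at an
    interior maximum of [v] above [s] the truncated source vanishes, leaving the second derivative
    [6 v / c^2 > 0]. *)
Lemma flow_hit_profile (rho b : R) : 0 < rho -> 0 <= b -> rho ^+ 2 * W b rho = s ->
  radial_profile C D s rho%:E (W b) (W1 b).
Proof.
move=> rho0 b0 Ws; have Wrho : 0 < W b rho.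
  by have := s0; rewrite -Ws pmulr_rgt0// exprn_gt0.
have Wpos r : 0 <= r -> r <= rho -> 0 < W b r.
  by move=> r0 rrho; apply: lt_le_trans Wrho _; exact: flow_nonincr.
pose v (r : R) := r ^+ 2 * W b r.
have cv : continuous v by move=> r; apply: quad_cont; exact: cW.
apply: flow_profile => //.
- by move=> r r0; rewrite lte_fin => /ltW rrho; exact/ltW/Wpos.
- move=> r r0; rewrite lte_fin => rrho; rewrite leNgt; apply/negP => vr.
  have [c] := EVT_max (ltW rho0) (continuous_subspaceT cv).
  rewrite in_itv /= => /andP[c0 crho] Hc.
  have vc : s < v c by apply: (lt_le_trans vr); apply: Hc; rewrite in_itv /= r0 ltW.
  have {}c0 : 0 < c.
    rewrite lt_neqAle c0 andbT; apply/eqP => c0E; move: vc.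
    by rewrite /v -c0E expr0n /= mul0r ltNge (ltW s0).
  have {}crho : c < rho.
    rewrite lt_neqAle crho andbT; apply/eqP => cE; move: vc.
    by rewrite /v cE Ws ltxx.
  have [e e0 He] := @radius_nbhs R c rho%:E c0 crho.
  have Dv t : `|t - c| < e -> is_derive t 1 v (2 * t * W b t + t ^+ 2 * W1 b t).
    by move=> /He[t0 _]; apply: is_derive_quad; exact: pair_d1 (WR b0) _ _.
  have Mv t : `|t - c| < e -> v t <= v c.
    by move=> /He[t0 tr]; apply: Hc; rewrite in_itv /= !ltW.
  have D1 : is_derive c 1 (W1 b) (W b c * 0 - 6 * W1 b c / c).
    have := pair_d2 (WR b0) c0; rewrite trunc_ge ?mulr0//; last exact: ltW.
    by apply/ltW/Wpos; exact: ltW.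
  have [E] := second_derive_max e0 Dv
    (is_derive_quad1 (lt0r_neq0 c0) (pair_d1 (WR b0) c0) D1) Mv.
  rewrite E mulr0 mulr0 mul0r subr0 addr0 leNgt => /negP; apply.
  by rewrite divr_gt0 ?exprn_gt0// mulr_gt0// (lt_trans s0).
- move=> eps eps0; have /nbhs_ballP[e /= e0 He] : \forall t \near rho, `|v rho - v t| < eps.
    by move/cvgrPdist_lt: (cv rho); apply.
  exists (rho - e); first by rewrite lte_fin; lra.
  move=> t t1 t0; rewrite lte_fin => trho.
  by rewrite -Ws distrC; apply: He; rewrite /ball /= gtr0_norm; lra.
Qed.

Lemma profile_exists_finite (rho : R) : 0 < rho -> exists w w1,
  [/\ radial_profile C D s rho%:E w w1, continuous w, 0 <= w 0,
     radial_pair (fun r => trunc C D s r (w r)) w w1 & rho ^+ 2 * w rho = s].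
Proof.
move=> rho0; have [b b0 Hb] := flow_hit rho0.
exists (W b), (W1 b); split => //; first exact: flow_hit_profile.
- exact: cW.
- by rewrite W0.
- exact: WR.
Qed.

(** This bound is independent of [rho]. If [v r] were smaller, monotonicity would keep [v] below it
    on [[0, r]], where [g <= - D s / 2]; integrating the flux gives [v' <= r w (2 - D s r^2 / 14)]
    at [r], negative once [D s r^2 > 28], against monotonicity beyond [r]. *)
Lemma profile_ge_delta rho (w w1 : R -> R) r :
  radial_profile C D s rho w w1 -> 0 < r -> (r%:E < rho)%E ->
  28 < D * s * r ^+ 2 -> Num.sqrt (D * s / (2 * C)) <= r ^+ 2 * w r.
Proof.
move=> P r0 rrho hr; rewrite leNgt; apply/negP => vd.
(* The term [C d^2] is half of [D s], and the linear term of [g] has the coefficient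
   [D - C s <= 0]. *)
pose d := Num.sqrt (D * s / (2 * C)).
have d2 : C * d ^+ 2 = D * s / 2.
  rewrite /d sqr_sqrtr ?divr_ge0 ?mulr_ge0 ?ltW//.
  by field; rewrite gt_eqF.
have rin t : t <= r -> (t%:E < rho)%E by move=> tr; exact: lte_finW rrho.
have wr : 0 < w r by exact (profile_gt0 hyp P (ltW r0) rrho).
pose kap := D * s / 2 * w r.
have kap0 : 0 < kap by rewrite mulr_gt0// divr_gt0// mulr_gt0.
have [M [e [e0 HM]]] := profile_0 P.
have H1 : r ^+ 6 * w1 r + kap / 7 * r ^+ 7 <= 0.
  apply: (@le0_of_origin R (fun t => t ^+ 6 * w1 t + kap / 7 * t ^+ 7)
    (fun t => t ^+ 6 * (w t * cubic C D s (t ^+ 2 * w t) + kap)) r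
    (M + kap / 7) (Num.min e 1)) => //.
  - by rewrite lt_min e0 ltr01.
  - move=> t /andP[t0]; rewrite lt_min => /andP[te t1].
    apply: (le_trans (ler_normD _ _)); rewrite mulrDl; apply: lerD; first by apply: HM; rewrite t0.
    rewrite ger0_norm; last by rewrite mulr_ge0 ?exprn_ge0 ?(ltW t0)// divr_ge0// ltW.
    rewrite ler_wpM2l ?divr_ge0 ?(ltW kap0)//.
    by rewrite -[leRHS]expr1 ler_wiXn2l ?ltW.
  - move=> t /andP[t0 tr]; have Hw1 := profile_d2 P t0 (rin t tr).
    by derive_eq; rewrite /=; field; rewrite gt_eqF.
  - move=> t /andP[t0 tr]; rewrite mulr_ge0_le0 ?exprn_ge0 ?(ltW t0)//.
    have trho := rin t (ltW tr).
    have vt : t ^+ 2 * w t <= d.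
      by apply: le_trans (ltW vd); apply: (profile_monotone hyp P) => //; exact: ltW.
    have vt0 : 0 <= t ^+ 2 * w t := profile_ge0 hyp P (ltW t0) trho.
    have wt : w r <= w t by apply: (profile_nonincr hyp P) => //; exact: ltW.
    have g : cubic C D s (t ^+ 2 * w t) <= - (D * s / 2).
      set x := t ^+ 2 * w t in vt vt0 *.
      have : C * x ^+ 2 <= D * s / 2 by rewrite -d2 ler_pM2l// lerXn2r ?nnegrE ?sqrtr_ge0.
      have : (D - C * s) * x <= 0 by rewrite mulr_le0_ge0// subr_le0; case: hyp.
      by rewrite /cubic; lra.
    have gp : 0 <= - (D * s / 2) - cubic C D s (t ^+ 2 * w t) by rewrite subr_ge0.
    have Ds0 : 0 < D * s / 2 by rewrite divr_gt0// mulr_gt0.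
    have := mulr_ge0 (ltW (lt_le_trans wr wt)) gp.
    have : D * s / 2 * w r <= D * s / 2 * w t by rewrite ler_pM2l.
    by rewrite /kap; lra.
pose v (t : R) := t ^+ 2 * w t.
have Dv := is_derive_quad (profile_d1 P r0 rrho).
have vneg : 0 < - (2 * r * w r + r ^+ 2 * w1 r).
  have -> : - (2 * r * w r + r ^+ 2 * w1 r) =
    - (r ^+ 6 * w1 r + kap / 7 * r ^+ 7) / r ^+ 4 + r * w r * (D * s * r ^+ 2 - 28) / 14.
    by rewrite /kap; field; rewrite gt_eqF.
  rewrite ltr_wpDl//; first by rewrite divr_ge0 ?oppr_ge0// exprn_ge0// ltW.
  by rewrite divr_gt0// mulr_gt0 ?subr_gt0// mulr_gt0.
have [h h0 Hh] := incr_right_of_derive (is_deriveNf Dv) vneg.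
have [t rt trho] := ereal_between rrho.
pose x := Num.min h (t - r) / 2.
have [x0 xh xt] : [/\ 0 < x, x < h & x < t - r].
  have : 0 < Num.min h (t - r) by rewrite lt_min h0 subr_gt0.
  have : Num.min h (t - r) <= h by rewrite ge_min lexx.
  have : Num.min h (t - r) <= t - r by rewrite ge_min lexx orbT.
  by rewrite /x; split; lra.
have := Hh x; rewrite x0 xh => /(_ isT); rewrite ltrN2 ltNge => /negP; apply.
apply: (profile_monotone hyp P); first exact: ltW.
  by rewrite lerDl ltW.
by apply: lte_finW trho; lra.
Qed.

(** If [v] never exceeded [s - eps], it would lie in [[d, s - eps]] from [r0] on, where
    [v g(v) <= - d eps D]. Then [(r^2 v')' <= 6 s - kap r^2] drives [r^2 v'] to minus infinity,
    while [v] is nondecreasing. *)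
Lemma flow_tendsto b : 0 <= b -> (forall r, 0 <= r -> 0 <= W b r) ->
  (forall r, 0 <= r -> r ^+ 2 * W b r <= s) ->
  (forall x y, 0 <= x -> x <= y -> x ^+ 2 * W b x <= y ^+ 2 * W b y) ->
  (exists r d, [/\ 0 < r, 0 < d & d <= r ^+ 2 * W b r]) ->
  forall eps, 0 < eps -> exists M, forall r, M < r -> 0 < r ->
    `|r ^+ 2 * W b r - s| < eps.
Proof.
move=> b0 W_ge0 W_le mono [r0 [d [r0_gt0 d0 dr]]] eps eps0.
pose v (t : R) := t ^+ 2 * W b t.
pose v1 t := 2 * t * W b t + t ^+ 2 * W1 b t.
have [[x x0 vx]|H] := pselect (exists2 x, 0 < x & s - eps < v x).
  exists x => r xr r_gt0; rewrite ler0_norm ?subr_le0 ?W_le ?ltW//.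
  have : v x <= v r by apply: mono; exact: ltW.
  by rewrite /v in vx *; lra.
have far x : 0 < x -> v x <= s - eps.
  by move=> x0; rewrite leNgt; apply/negP => vx; apply: H; exists x.
exfalso; pose kap := d * eps * D.
have kap0 : 0 < kap by rewrite !mulr_gt0.
pose Q t := t ^+ 2 * v1 t + kap / 3 * t ^+ 3 - 6 * s * t.
pose dQ t := 6 * (v t - s) + t ^+ 2 * (v t * cubic C D s (v t) + kap).
have Dv t : 0 < t -> is_derive t 1 v (v1 t).
  by move=> t0; apply: is_derive_quad; exact: pair_d1 (WR b0) _ _.
have DQ t : 0 < t -> is_derive t 1 Q (dQ t).
  move=> t0; have H1 := pair_d2 (WR b0) t0.
  rewrite trunc_id ?W_ge0 ?W_le ?(ltW t0)// in H1.
  have Hv1 : is_derive t 1 v1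
      (6 * v t / t ^+ 2 + v t * cubic C D s (v t) - 2 * v1 t / t).
    exact: is_derive_quad1 (lt0r_neq0 t0) (pair_d1 (WR b0) t0) H1.
  by rewrite /Q; derive_eq; rewrite /dQ /=; field; rewrite gt_eqF.
have dQ0 t : r0 <= t -> dQ t <= 0.
  move=> rt; have t0 : 0 < t by exact: lt_le_trans rt.
  have dv : d <= v t by apply: (le_trans dr); apply: mono => //; exact: ltW.
  have vs := W_le t (ltW t0); have ve := far t t0; rewrite -/(v t) in vs.
  rewrite /dQ -[leRHS]addr0 lerD//.
    by rewrite pmulr_rle0// subr_le0.
  rewrite mulr_ge0_le0 ?sqr_ge0// /cubic.
  have vpos : 0 < v t by exact: lt_le_trans dv.
  have h1 : D <= C * v t + D by rewrite lerDr mulr_ge0 ?ltW.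
  have h2 : eps <= s - v t by lra.
  have := ler_pM (ltW d0) (ltW eps0) dv h2.
  have de0 : 0 <= d * eps by rewrite mulr_ge0 ?(ltW d0) ?(ltW eps0).
  move=> h; have := ler_pM de0 (ltW D0) h h1.
  by rewrite /kap; lra.
have v1_ge0 t : 0 < t -> 0 <= v1 t.
  move=> t0; rewrite leNgt; apply/negP => v1neg.
  have v1neg' : 0 < - v1 t by rewrite oppr_gt0.
  have [h h0 Hh] := incr_right_of_derive (is_deriveNf (Dv t t0)) v1neg'.
  have hh : 0 < h / 2 < h by rewrite divr_gt0//=; lra.
  have := Hh _ hh; rewrite ltrN2 ltNge => /negP; apply; apply: mono; first exact: ltW.
  by rewrite lerDl divr_ge0// ltW.
pose A := `|Q r0| + 6 * s.
have A0 : 0 < A by rewrite /A ltr_wpDl// mulr_gt0.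
(* At this [t >= 1] one has [kap t > 3 A], so the cubic term of [Q] exceeds
   [A t >= |Q r0| + 6 s t]. *)
pose t := r0 + 1 + 3 * A / kap.
have At : 0 < 3 * A / kap by rewrite divr_gt0// mulr_gt0.
have rt : r0 <= t by rewrite /t; lra.
have t1 : 1 <= t by rewrite /t; lra.
have t0 : 0 < t by lra.
have : Q t <= Q r0.
  apply: (@nonincr_of_derive R Q dQ) => // [x /andP[rx _]|x /andP[rx _]|x /andP[rx _]].
  - by apply: is_derive_continuous (DQ x _); exact: lt_le_trans rx.
  - by apply: DQ; exact: lt_trans rx.
  - by apply: dQ0; exact: ltW.
apply/negP; rewrite -ltNge; apply: (le_lt_trans (ler_norm _)).
have : 0 <= t ^+ 2 * v1 t by rewrite mulr_ge0 ?sqr_ge0// v1_ge0.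
have kt : 3 * A < kap * t.
  by rewrite [ltRHS]mulrC -ltr_pdivrMr// /t ltrDr; lra.
have : A * t < kap / 3 * t ^+ 3.
  have -> : kap / 3 * t ^+ 3 = (kap * t) / 3 * t * t by ring.
  rewrite ltr_pM2r//; apply: (@lt_le_trans _ _ (kap * t / 3)); first lra.
  by apply: ler_peMr => //; lra.
have : `|Q r0| <= `|Q r0| * t by exact: ler_peMr.
by rewrite /Q /A -/(Q r0); set q := `|_|; lra.
Qed.

(** The hitting values [bn] for the radii [n + 1] are bounded. At a cluster point [b] the bounds
    survive, because each is an affine inequality between values [W b x] at fixed radii, which are
    continuous in [b]. *)
Lemma profile_exists_infty : exists w w1,
  [/\ radial_profile C D s +oo%E w w1, continuous w, 0 <= w 0 &
     radial_pair (fun r => trunc C D s r (w r)) w w1].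
Proof.
have : forall n : nat, exists b, 0 <= b /\ n.+1%:R ^+ 2 * W b n.+1%:R = s.
  by move=> n; have [//|b b0 Hb] := @flow_hit n.+1%:R; exists b.
move=> /choice[bn Hbn].
have bn0 n : 0 <= bn n by case: (Hbn n).
have Pn n : radial_profile C D s (n.+1%:R)%:E (W (bn n)) (W1 (bn n)).
  by have [_ H] := Hbn n; apply: flow_hit_profile.
(* At radius [1] every profile satisfies [w <= s], so [q = sqrt (bn n)] obeys [q (q - kap) <= s] by
   [flow_ge], which fails for [q > kap + s + 1]. *)
pose kap := k * Num.sqrt s / 6; pose B := (kap + s + 1) ^+ 2.
have kap0 : 0 <= kap by rewrite divr_ge0// mulr_ge0 ?sqrtr_ge0// ltW.
have bnB n : bn n <= B.
  have q0 : 0 <= kap + s + 1 by have := s0; lra.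
  rewrite leNgt; apply/negP => Bb.
  have Bq : kap + s + 1 < Num.sqrt (bn n).
    by rewrite -(ltr_pXn2r (ltn0Sn 1)) ?nnegrE ?sqrtr_ge0// sqr_sqrtr.
  have ws : W (bn n) 1 <= s.
    case: n Bb Bq => [|n] Bb Bq.
      by have [_ <-] := Hbn 0%N; rewrite expr1n mul1r.
    have := profile_le hyp (Pn n.+1) ler01.
    by rewrite expr1n mul1r; apply; rewrite lte_fin ltr1n.
  have := le_trans (flow_ge (bn0 n) ler01) ws; rewrite leNgt => /negP; apply.
  set q := Num.sqrt (bn n) in Bq *.
  have -> : bn n - k * q * Num.sqrt s * 1 / 6 = q * (q - kap).
    by rewrite -[X in X - _](sqr_sqrtr (bn0 n)) -/q /kap; ring.
  apply: (@lt_le_trans _ _ (q - kap)); first by lra.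
  by apply: ler_peMl; have := s0; lra.
have inB : (bn @ \oo) `[0, B]%classic.
  by exists 0%N => // n _ /=; rewrite in_itv /= bn0 bnB.
have [b [/= bB clb]] := @segment_compact R 0 B (bn @ \oo) _ inB.
have b0 : 0 <= b by move: bB; rewrite in_itv /= => /andP[].
have near_b (F : R -> R) : continuous F ->
    (exists N, forall n, (N <= n)%N -> F (bn n) <= 0) -> F b <= 0.
  move=> cF [N HN]; rewrite leNgt; apply/negP => Fb.
  have nbF : nbhs b [set x | 0 < F x] by exact: (cvgr_gt (F b) (cF b) 0 Fb).
  have tail : (bn @ \oo) [set x | F x <= 0] by exists N => // n /= /HN.
  have [x [/= Fx Fx']] := clb _ _ tail nbF.
  by move: Fx; rewrite leNgt Fx'.
have lin x y c1 c2 c3 : 0 <= x -> 0 <= y ->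
    (exists N, forall n, (N <= n)%N -> c1 * W (bn n) x + c2 * W (bn n) y + c3 <= 0) ->
    c1 * W b x + c2 * W b y + c3 <= 0.
  move=> x0 y0 [N HN].
  pose F (b : R) := c1 * W `|b| x + c2 * W `|b| y + c3.
  have cF : continuous F.
    move=> t; apply: (@continuousD _ _ _ (fun t : R => c1 * W `|t| x + c2 * W `|t| y) (fun=> c3)).
      apply: (@continuousD _ _ _ (fun t : R => c1 * W `|t| x) (fun t : R => c2 * W `|t| y)).
        apply: (@continuousM _ _ (fun=> c1) (fun t : R => W `|t| x)).
          exact: cst_continuous.
        exact: flow_cont x0 t.
      apply: (@continuousM _ _ (fun=> c2) (fun t : R => W `|t| y)).
        exact: cst_continuous.
      exact: flow_cont y0 t.
    exact: cst_continuous.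
  have := near_b F cF; rewrite /F (ger0_norm b0); apply; exists N => n /HN.
  by rewrite ger0_norm.
have big x : exists N, forall n, (N <= n)%N -> (x%:E < (n.+1%:R)%:E)%E.
  exists (Num.bound `|x|) => n Nn; rewrite lte_fin; apply: (le_lt_trans (ler_norm x)).
  apply: (lt_le_trans (archi_boundP (normr_ge0 x))).
  by rewrite ler_nat (leq_trans Nn).
have Wge0 x : 0 <= x -> 0 <= W b x.
  move=> x0; have := lin x x (-1) 0 0 x0 x0; rewrite mul0r !addr0 mulN1r oppr_le0; apply.
  have [N HN] := big x; exists N => n /HN xn.
  rewrite mul0r !addr0 mulN1r oppr_le0; apply: ltW.
  exact (profile_gt0 hyp (Pn n) x0 xn).
have Wle x : 0 <= x -> x ^+ 2 * W b x <= s.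
  move=> x0; have := lin x x (x ^+ 2) 0 (- s) x0 x0.
  rewrite mul0r addr0 subr_le0; apply.
  have [N HN] := big x; exists N => n /HN xn.
  rewrite mul0r addr0 subr_le0; exact (profile_le hyp (Pn n) x0 xn).
have Wmono x y : 0 <= x -> x <= y -> x ^+ 2 * W b x <= y ^+ 2 * W b y.
  move=> x0 xy; have y0 := le_trans x0 xy.
  have := lin x y (x ^+ 2) (- y ^+ 2) 0 x0 y0.
  rewrite addr0 mulNr subr_le0; apply.
  have [N HN] := big y; exists N => n /HN yn.
  rewrite addr0 mulNr subr_le0; exact (profile_monotone hyp (Pn n) x0 xy yn).
(* A radius for [profile_ge_delta]: [D s r > 28], and [r > 1] gives [r <= r^2]. *)
pose r := 28 / (D * s) + 1.
have Ds : 0 < D * s by rewrite mulr_gt0.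
have r1 : 1 < r by rewrite /r ltrDr divr_gt0.
have r0 : 0 < r by lra.
have r28 : 28 < D * s * r ^+ 2.
  apply: (@lt_le_trans _ _ (D * s * r)).
    by rewrite mulrC -ltr_pdivrMr// /r ltrDl.
  by rewrite ler_pM2l// expr2 ler_peMr// ltW.
pose d := Num.sqrt (D * s / (2 * C)).
have d0 : 0 < d by rewrite sqrtr_gt0 divr_gt0// mulr_gt0.
have Wd : d <= r ^+ 2 * W b r.
  have := lin r r (- r ^+ 2) 0 d (ltW r0) (ltW r0).
  rewrite mul0r addr0 addrC mulNr subr_le0; apply.
  have [N HN] := big r; exists N => n /HN rn.
  rewrite mul0r addr0 addrC mulNr subr_le0.
  exact (profile_ge_delta (Pn n) r0 rn r28).
exists (W b), (W1 b); split; [|exact: cW|by rewrite W0|exact: WR].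
apply: flow_profile => //; first by move=> x x0 _; exact: Wge0.
  by move=> x x0 _; exact: Wle.
move=> eps eps0; have [|M HM] := flow_tendsto b0 Wge0 Wle Wmono _ eps0.
  by exists r, d.
by exists M; rewrite ?ltry// => x Mx x0 _; exact: HM.
Qed.
End Flow.

Lemma profile_exists {R : realType} (C D s : R) (rho : \bar R) :
  cubic_ok C D s -> (0 < rho)%E -> exists w w1,
  [/\ radial_profile C D s rho w w1, continuous w, 0 <= w 0,
     radial_pair (fun r => trunc C D s r (w r)) w w1 &
     forall r, r%:E = rho -> r ^+ 2 * w r = s].
Proof.
move=> hyp; have [W [W1 WP]] := flow_exists hyp.
case: rho => [rho|_|//]; last first.
  by have [w [w1 [? ? ? ?]]] := profile_exists_infty hyp WP; exists w, w1; split.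
rewrite lte_fin => rho0.
have [w [w1 [? ? ? ? E]]] := profile_exists_finite hyp WP rho0.
by exists w, w1; split => // r [->].
Qed.

(** * The elastic operator on radial tensors *)

Notation o0 := (@Ordinal 3 0 isT).
Notation o1 := (@Ordinal 3 1 isT).
Notation o2 := (@Ordinal 3 2 isT).

Lemma ord3P (i : 'I_3) : [\/ i = o0, i = o1 | i = o2].
Proof.
by case: i => [[|[|[|//]]] Hi]; [apply: Or31|apply: Or32|apply: Or33]; exact: val_inj.
Qed.

Lemma sum3E {V : zmodType} (F : 'I_3 -> V) : \sum_(k < 3) F k = F o0 + F o1 + F o2.
Proof.
rewrite !big_ord_recl big_ord0 addr0 addrA.
by congr (F _ + F _ + F _); exact: val_inj.
Qed.

Lemma is_derive_line {R : realType} {V : normedModType R} (f : V -> R) (x v : V) (d : R) :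
  is_derive (0 : R) 1 (fun h : R => f (h *: v + x)) d -> is_derive x v f d.
Proof.
move=> [D E]; have Df : derivable f x v := (@derivable1P _ _ _ f x v).2 D.
apply: DeriveDef => //; rewrite -E /derive; apply: (congr1 (fun g : R -> R => lim (g @ 0^'))).
by apply/funext => h /=; rewrite addr0 scale0r add0r [_%:A]mulr1.
Qed.

Lemma is_derive_on_line {R : realType} {V : normedModType R} (f : V -> R) (x v : V) (d : R) :
  is_derive x v f d -> is_derive (0 : R) 1 (fun h : R => f (h *: v + x)) d.
Proof.
move=> [D E]; have Df := (@derivable1P _ _ _ f x v).1 D.
apply: DeriveDef => //; rewrite -E /derive; apply: (congr1 (fun g : R -> R => lim (g @ 0^'))).
by apply/funext => h /=; rewrite addr0 scale0r add0r [_%:A]mulr1.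
Qed.

Lemma is_derive_compf {R : realType} {V : normedModType R} (f : R -> R) (g : V -> R)
    (x v : V) (c d : R) :
  is_derive (g x) 1 f c -> is_derive x v g d ->
  is_derive x v (fun y => f (g y)) (c * d).
Proof.
move=> Hf /is_derive_on_line Hg; apply: is_derive_line.
apply: (@is_derive1_comp R f (fun h => g (h *: v + x)) 0) => //.
by rewrite scale0r add0r.
Qed.

Lemma is_derive_coord {R : realType} m n (x v : 'M[R]_(m, n)) i j :
  is_derive x v (fun y : 'M[R]_(m, n) => y i j) (v i j).
Proof.
apply: is_derive_line.
have -> : (fun h : R => (h *: v + x) i j) = (fun h => h * v i j + x i j).
  by apply/funext => h; rewrite !mxE.
by derive_eq; ring.
Qed.

Lemma derivative_eq0 {R : realType} (g : R -> R) (M e : R) : 0 < e ->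
  (forall h, `|h| < e -> `|g h - g 0| <= M * h ^+ 2) -> is_derive (0 : R) 1 g 0.
Proof.
move=> e0 H.
have C : h^-1 *: (g (h *: 1 + 0) - g 0) @[h --> 0^'] --> (0 : R).
  apply/cvgrPdist_le => d d0.
  have M1 : 0 < `|M| + 1 by rewrite ltr_wpDl.
  have dM : 0 < Num.min e (d / (`|M| + 1)) by rewrite lt_min e0 divr_gt0.
  apply/nbhs_ballP; exists (Num.min e (d / (`|M| + 1))) => //= h.
  rewrite /ball /= sub0r normrN lt_min => /andP[he hd] h0.
  rewrite sub0r normrN addr0 [_ *: 1]mulr1 normrM normfV ler_pdivrMl ?normr_gt0//.
  apply: (le_trans (H h he)); rewrite -[h ^+ 2]ger0_norm ?sqr_ge0// normrX expr2 mulrA.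
  rewrite mulrC ler_wpM2l//; apply: (@le_trans _ _ ((`|M| + 1) * `|h|)).
    by rewrite ler_wpM2r// (le_trans (ler_norm M))// lerDl.
  by rewrite mulrC -ler_pdivlMr// ltW.
apply: DeriveDef; last exact/cvg_lim.
by apply/cvg_ex; exists 0.
Qed.

Lemma is_derive_mul_id {R : realType} (f : R -> R) : {for 0, continuous f} ->
  is_derive (0 : R) 1 (fun h => f h * h) (f 0).
Proof.
move=> cf.
have C : h^-1 *: (f (h *: 1 + 0) * (h *: 1 + 0) - f 0 * 0) @[h --> 0^'] --> f 0.
  have cf' : f h @[h --> 0^'] --> f 0 by apply: cvg_trans cf; exact/cvg_app/nbhs_dnbhs.
  apply: cvg_trans cf'; apply: near_eq_cvg; near=> h.
  have h0 : h != 0 by near: h; exact: nbhs_dnbhs_neq.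
  rewrite addr0 mulr0 subr0 [h *: 1]mulr1.
  have E : h^-1 * (f h * h) = f h by field.
  exact: (esym E).
apply: DeriveDef; last exact/cvg_lim.
by apply/cvg_ex; exists (f 0).
Unshelve. all: by end_near. Qed.

Definition sqnorm {R : realType} (x : 'cV[R]_3) : R := \sum_k x k 0 ^+ 2.

Lemma sqnormE {R : realType} (x : 'cV[R]_3) :
  sqnorm x = x o0 0 ^+ 2 + x o1 0 ^+ 2 + x o2 0 ^+ 2.
Proof. exact: sum3E. Qed.

Lemma sqnorm_ge0 {R : realType} (x : 'cV[R]_3) : 0 <= sqnorm x.
Proof. by apply: sumr_ge0 => k _; exact: sqr_ge0. Qed.

Lemma enorm_ge0 {R : realType} (x : 'cV[R]_3) : 0 <= enorm x.
Proof. exact: sqrtr_ge0. Qed.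

Lemma enorm_sqr {R : realType} (x : 'cV[R]_3) : enorm x ^+ 2 = sqnorm x.
Proof. by rewrite sqr_sqrtr// sqnorm_ge0. Qed.

Lemma enorm_gt0 {R : realType} (x : 'cV[R]_3) : x != 0 -> 0 < enorm x.
Proof.
move=> x0; rewrite lt_neqAle enorm_ge0 andbT; apply: contra_neq x0 => e0.
have /eqP : sqnorm x = 0 by rewrite -enorm_sqr -e0 expr0n.
rewrite /sqnorm psumr_eq0; last by move=> k _; exact: sqr_ge0.
move=> /allP H; apply/matrixP => i j; rewrite ord1 mxE; apply/eqP.
by rewrite -sqrf_eq0; apply: H; rewrite mem_index_enum.
Qed.

Lemma enorm0 {R : realType} : enorm (0 : 'cV[R]_3) = 0.
Proof. by rewrite /enorm sum3E !mxE expr0n /= !addr0 sqrtr0. Qed.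

Lemma enorm_eq0 {R : realType} (x : 'cV[R]_3) : (enorm x == 0) = (x == 0).
Proof.
apply/idP/idP => [/eqP e0|/eqP ->]; last by rewrite enorm0.
by apply: contraPT e0 => /enorm_gt0 /lt0r_neq0 /eqP.
Qed.

Ltac der3 := lazymatch goal with
  | |- is_derive _ _ (fun y => @?f y + @?g y) _ =>
      eapply (@is_deriveDf _ _ f g); der3
  | |- is_derive _ _ (fun y => - @?f y) _ => eapply (@is_deriveNf _ _ f); der3
  | |- is_derive _ _ (fun y => @?f y * @?g y) _ =>
      first [eassumption | eapply (@is_deriveMf _ _ f g); der3]
  | |- is_derive _ _ (fun y => @?f y ^+ ?n) _ =>
      eapply (@is_deriveXf _ _ f n); der3
  | |- is_derive _ _ (fun y => fun_of_matrix y ?i ?j) _ =>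
      exact (is_derive_coord _ _ _ _)
  | |- is_derive _ _ (fun y => ?f y) _ => change (fun y => f y) with f;
      try eassumption
  | |- is_derive _ _ (fun y => ?c) _ => first [eassumption | exact (is_derive_cstf _ _ _)]
  | |- _ => try eassumption
  end.

Lemma is_derive_sqnorm {R : realType} (x : 'cV[R]_3) k :
  is_derive x (delta_mx k 0) (@sqnorm R) (2 * x k 0).
Proof.
have -> : @sqnorm R = (fun x => x o0 0 ^+ 2 + x o1 0 ^+ 2 + x o2 0 ^+ 2).
  by apply/funext => y; exact: sqnormE.
eapply is_derive_eq; first der3.
by case: (ord3P k) => ->; rewrite !mxE /=; ring.
Qed.

Lemma is_derive_enorm {R : realType} (x : 'cV[R]_3) k : x != 0 ->
  is_derive x (delta_mx k 0) (@enorm R) (x k 0 / enorm x).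
Proof.
move=> x0; have e0 := enorm_gt0 x0.
have s0 : 0 < sqnorm x by rewrite -enorm_sqr exprn_gt0.
have H := is_derive_compf (is_derive1_sqrt s0) (is_derive_sqnorm x k).
eapply is_derive_eq; first exact H.
rewrite -[Num.sqrt (sqnorm x)]/(enorm x); field.
by rewrite gt_eqF.
Qed.

Lemma coord_cont {R : realType} m n i j :
  continuous (fun y : 'M[R]_(m.+1, n.+1) => y i j).
Proof. by move=> x; apply: coord_continuous. Qed.

Lemma enorm_cont {R : realType} : continuous (@enorm R).
Proof.
move=> x; apply: (@continuous_comp _ _ _ (@sqnorm R) Num.sqrt); last exact: sqrt_continuous.
have -> : @sqnorm R = (fun x => x o0 0 ^+ 2 + x o1 0 ^+ 2 + x o2 0 ^+ 2).
  by apply/funext => y; exact: sqnormE.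
have c2 i : {for x, continuous (fun x : 'cV[R]_3 => x i 0 ^+ 2)}.
  apply: (@continuous_comp _ _ _ (fun x : 'cV[R]_3 => x i 0) (fun t => t ^+ 2)).
    exact: coord_cont.
  exact: exprn_continuous.
by do 2! [apply: continuousD => //]; exact: c2.
Qed.

Definition dlt {R : realType} (i j : 'I_3) : R := (i == j)%:R.

(** A harmonic polynomial, homogeneous of degree two; [hedge1] and [hedge2] are its first and second
    partial derivatives. *)
Definition hedge {R : realType} (i j : 'I_3) (x : 'cV[R]_3) : R :=
  x i 0 * x j 0 - dlt i j / 3 * sqnorm x.

Definition hedge1 {R : realType} (i j k : 'I_3) (x : 'cV[R]_3) : R :=
  dlt i k * x j 0 + x i 0 * dlt j k - dlt i j * (2 / 3) * x k 0.

Definition hedge2 {R : realType} (i j k l : 'I_3) : R :=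
  dlt i k * dlt j l + dlt i l * dlt j k - dlt i j * (2 / 3) * dlt k l.

Lemma is_derive_coord_delta {R : realType} (x : 'cV[R]_3) (i k : 'I_3) :
  is_derive x (delta_mx k 0) (fun y : 'cV[R]_3 => y i 0) (dlt i k).
Proof.
by eapply is_derive_eq; [exact: is_derive_coord | rewrite mxE andbT].
Qed.

Lemma is_derive_hedge {R : realType} (i j k : 'I_3) (x : 'cV[R]_3) :
  is_derive x (delta_mx k 0) (hedge i j) (hedge1 i j k x).
Proof.
have Hi := is_derive_coord_delta x i k; have Hj := is_derive_coord_delta x j k.
have Hs := is_derive_sqnorm x k.
rewrite /hedge; eapply is_derive_eq; first der.
by rewrite /hedge1; ring.
Qed.

Lemma is_derive_hedge1 {R : realType} (i j k l : 'I_3) (x : 'cV[R]_3) :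
  is_derive x (delta_mx l 0) (hedge1 i j k) (hedge2 i j k l).
Proof.
have Hi := is_derive_coord_delta x i l; have Hj := is_derive_coord_delta x j l.
have Hk := is_derive_coord_delta x k l.
rewrite /hedge1; eapply is_derive_eq; first der.
by rewrite /hedge2; ring.
Qed.

(* [w], [z] and [q] play the roles of the profile, of [w' / r] and of
   [(w' / r)' / r]. *)
Record radial_C2 {R : realType} (U : set 'cV[R]_3) (w z q : R -> R) : Prop :=
  RadialC2 {
  radial_grad : forall x, U x -> forall k, is_derive x (delta_mx k 0)
    (fun y => w (enorm y)) (z (enorm x) * x k 0);
  radial_hess : forall x, U x -> forall k l, is_derive x (delta_mx l 0)
    (fun y => z (enorm y) * y k 0)
    (z (enorm x) * dlt k l + q (enorm x) * (x k 0 * x l 0)) }.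

Section RadialTensor.
Context {R : realType} (U : set 'cV[R]_3) (w z q : R -> R).
Hypothesis oU : open U.
Hypothesis HC : radial_C2 U w z q.
Implicit Types (i j k l : 'I_3) (x y : 'cV[R]_3).

Definition tensor1 i j k x :=
  z (enorm x) * x k 0 * hedge i j x + w (enorm x) * hedge1 i j k x.

Definition tensor2 i j k l x :=
  (z (enorm x) * dlt k l + q (enorm x) * (x k 0 * x l 0)) * hedge i j x
  + z (enorm x) * x k 0 * hedge1 i j l x + z (enorm x) * x l 0 * hedge1 i j k x
  + w (enorm x) * hedge2 i j k l.

Variable Q : 'cV[R]_3 -> 'M[R]_3.
Hypothesis QE : forall x, U x -> forall i j, Q x i j = w (enorm x) * hedge i j x.

Let nearU x (P : 'cV[R]_3 -> Prop) : U x -> (forall y, U y -> P y) ->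
  \forall y \near x, P y.
Proof.
move=> Ux H; have : \forall y \near x, U y by exact: open_nbhs_nbhs.
by apply: filterS.
Qed.

Lemma tensor_derive1 x i j k : U x ->
  is_derive x (delta_mx k 0) (fun y => Q y i j) (tensor1 i j k x).
Proof.
move=> Ux.
have H : is_derive x (delta_mx k 0) (fun y => w (enorm y) * hedge i j y) (tensor1 i j k x).
  have Hw := radial_grad HC Ux k; have Hp := is_derive_hedge i j k x.
  eapply is_derive_eq; first exact: is_deriveMf Hw Hp.
  by rewrite /tensor1; ring.
apply: near_eq_is_derive H; apply: nearU => // y Uy; exact/esym/QE.
Qed.

Lemma tensor_partial1 x i j k : U x ->
  partial k (fun y => Q y i j) x = tensor1 i j k x.
Proof. by move=> Ux; have [_ ] := tensor_derive1 i j k Ux. Qed.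

Lemma tensor_derive2 x i j k l : U x ->
  is_derive x (delta_mx l 0) (partial k (fun y => Q y i j)) (tensor2 i j k l x).
Proof.
move=> Ux.
have H : is_derive x (delta_mx l 0) (tensor1 i j k) (tensor2 i j k l x).
  have Hw := radial_grad HC Ux l; have Hz := radial_hess HC Ux k l.
  have Hp := is_derive_hedge i j l x; have Hp1 := is_derive_hedge1 i j k l x.
  eapply is_derive_eq.
    exact: is_deriveDf (is_deriveMf Hz Hp) (is_deriveMf Hw Hp1).
  by rewrite /tensor2; ring.
apply: near_eq_is_derive H; apply: nearU => // y Uy; exact/esym/tensor_partial1.
Qed.

Lemma tensor_partial2 x i j k l : U x ->
  partial l (partial k (fun y => Q y i j)) x = tensor2 i j k l x.
Proof. by move=> Ux; have [_ ] := tensor_derive2 i j k l Ux. Qed.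

End RadialTensor.

(** With [w' = r z] and [w'' = z + r^2 q], the bracket is [w'' + 6 w'/r]. The Laplacian contributes
    it because [hedge] is harmonic of degree two. The divergence of [w] times the hedgehog tensor is
    a field [f(r) x], whose gradient has trace-free part [f'/r] times that tensor, and [f'/r] is two
    thirds of the same bracket; the two mixed terms add up to [4/3]. *)
Lemma tensor_elastic {R : realType} (U : set 'cV[R]_3) (w z q : R -> R) (oU : open U)
    (HC : radial_C2 U w z q) (Q : 'cV[R]_3 -> 'M[R]_3)
    (QE : forall x, U x -> forall i j, Q x i j = w (enorm x) * hedge i j x)
    (L1 L2 L3 : R) x i j : U x ->
  elastic L1 L2 L3 Q x i j = (2 * L1 + 4 * (L2 + L3) / 3) *
    (q (enorm x) * sqnorm x + 7 * z (enorm x)) * hedge i j x.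
Proof.
move=> Ux; pose T a b c d := tensor2 w z q a b c d x.
have TE a b c d : partial d (partial c (fun y => Q y a b)) x = T a b c d.
  exact: (tensor_partial2 oU HC QE).
have sumT (F : 'I_3 -> R) (G : 'I_3 -> R) : (forall k, F k = G k) ->
    \sum_k F k = G o0 + G o1 + G o2.
  by move=> FG; rewrite (eq_bigr G)// (sum3E G).
have E1 := sumT _ (fun k => T i j k k) (fun k => TE i j k k).
have E2 a b := sumT _ (fun k => T a k k b) (fun k => TE a k k b).
have E3 := sumT _ _ (fun l => sumT _ (fun k => T l k k l) (fun k => TE l k k l)).
have elE A B B' C :
    \sum_k partial k (partial k (fun y => Q y i j)) x = A ->
    \sum_k partial j (partial k (fun y => Q y i k)) x = B ->
    \sum_k partial i (partial k (fun y => Q y j k)) x = B' ->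
    \sum_l \sum_k partial l (partial k (fun y => Q y l k)) x = C ->
    elastic L1 L2 L3 Q x i j = 2 * L1 * A + (L2 + L3) * (B + B')
      - 2 / 3 * (L2 + L3) * C * (i == j)%:R.
  by move=> <- <- <- <-.
rewrite (elE _ _ _ _ E1 (E2 i j) (E2 j i) E3) /T /tensor2 /hedge /hedge1 /hedge2 /dlt sqnormE.
move: (w _) (z _) (q _) => W Z K.
case: (ord3P i) => ->; case: (ord3P j) => ->; rewrite /=.
all: move: (x o0 0) (x o1 0) (x o2 0) => a b c.
all: by field.
Qed.

(** * Second-order regularity at the origin *)

Lemma continuous_distP {R : realType} {T : topologicalType} (f : T -> R) (x : T) :
  {for x, continuous f} <->
  forall e, 0 < e -> \forall y \near x, `|f x - f y| <= e.
Proof. by split=> [/cvgrPdist_le//|H]; apply/cvgrPdist_le. Qed.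

(** The quotient [w'/r]. Its value at [0] is the limit, since [r^6 w'] is the integral of [t^6 h]
    and behaves like [h(0) r^7 / 7]. *)
Definition quot1 {R : realType} (h w1 : R -> R) (r : R) : R :=
  if r == 0 then h 0 / 7 else w1 r / r.

(** The quantity [(w'/r)'/r], solved from [h = r^2 q + 7 z] rather than differentiated. At [r = 0]
    division by zero gives [0]; there it only occurs multiplied by quadratic expressions in [x]. *)
Definition quot2 {R : realType} (h w1 : R -> R) (r : R) : R :=
  (h r - 7 * quot1 h w1 r) / r ^+ 2.

Lemma quot12 {R : realType} (h w1 : R -> R) (x : 'cV[R]_3) :
  quot2 h w1 (enorm x) * sqnorm x + 7 * quot1 h w1 (enorm x) = h (enorm x).
Proof.
rewrite -enorm_sqr /quot2 /quot1; have [->|n0] := eqVneq (enorm x) 0.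
  by rewrite expr0n mulr0 add0r; field.
by field.
Qed.

Lemma radial_derive_grad {R : realType} (h w w1 : R -> R) (x : 'cV[R]_3) k : x != 0 ->
  is_derive (enorm x) 1 w (w1 (enorm x)) ->
  is_derive x (delta_mx k 0) (fun y => w (enorm y)) (quot1 h w1 (enorm x) * x k 0).
Proof.
move=> x0 Hw; have e0 := enorm_gt0 x0.
eapply is_derive_eq; first exact: is_derive_compf Hw (is_derive_enorm k x0).
by rewrite /quot1 gt_eqF//; field; rewrite gt_eqF.
Qed.

Lemma near_neq0 {R : realType} (x : 'cV[R]_3) : x != 0 -> \forall y \near x, y != 0.
Proof.
move=> /enorm_gt0 e0; have H : \forall y \near x, 0 < enorm y.
  exact (cvgr_gt (enorm x) (@enorm_cont R x) 0 e0).
by apply: filterS H => y; rewrite -enorm_eq0 => /lt0r_neq0.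
Qed.

Lemma radial_derive_hess {R : realType} (h w1 : R -> R) (x : 'cV[R]_3) k l : x != 0 ->
  is_derive (enorm x) 1 w1 (h (enorm x) - 6 * w1 (enorm x) / enorm x) ->
  is_derive x (delta_mx l 0) (fun y => quot1 h w1 (enorm y) * y k 0)
    (quot1 h w1 (enorm x) * dlt k l + quot2 h w1 (enorm x) * (x k 0 * x l 0)).
Proof.
move=> x0 Hw1; have e0 := lt0r_neq0 (enorm_gt0 x0).
have H1 := is_derive_compf Hw1 (is_derive_enorm l x0).
have Hi : is_derive (enorm x) 1 (fun r : R => r^-1) (- enorm x ^- 2).
  by derive_eq => //; rewrite mulr1.
have H2 := is_derive_compf Hi (is_derive_enorm l x0).
have H3 := is_derive_coord_delta x k l.
have H : is_derive x (delta_mx l 0) (fun y => w1 (enorm y) * (enorm y)^-1 * y k 0)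
    (quot1 h w1 (enorm x) * dlt k l + quot2 h w1 (enorm x) * (x k 0 * x l 0)).
  eapply is_derive_eq; first exact: is_deriveMf (is_deriveMf H1 H2) H3.
  by rewrite /quot2 /quot1 (negbTE e0); field.
apply: near_eq_is_derive H; near=> y.
rewrite /quot1 ifF//; apply/negbTE; rewrite enorm_eq0.
by near: y; exact: near_neq0.
Unshelve. all: by end_near. Qed.

Lemma radial_C2_punctured {R : realType} (U : set 'cV[R]_3) (h w w1 : R -> R) :
  (forall x, U x -> [/\ x != 0, is_derive (enorm x) 1 w (w1 (enorm x)) &
     is_derive (enorm x) 1 w1 (h (enorm x) - 6 * w1 (enorm x) / enorm x)]) ->
  radial_C2 U w (quot1 h w1) (quot2 h w1).
Proof.
move=> H; split => x /H[x0 H1 H2] k; first exact: radial_derive_grad.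
by move=> l; exact: radial_derive_hess.
Qed.

Lemma radial_pair_const {R : realType} (c : R) :
  radial_pair (fun=> c) (fun r => c * r ^+ 2 / 14) (fun r => c * r / 7).
Proof.
split => [r r0|r r0|r r0|].
- by apply: (@is_derive_continuous _ _ _ (c * r / 7)); derive_eq; field.
- by derive_eq; field.
- by derive_eq; field; rewrite gt_eqF.
- exists (`|c| / 7), 1; split => // r /andP[r0 r1].
  have -> : r ^+ 6 * (c * r / 7) = c * (r ^+ 6 * (r / 7)) by ring.
  rewrite normrM -[leRHS]mulrA ler_wpM2l// ger0_norm; last first.
    by rewrite mulr_ge0 ?exprn_ge0 ?divr_ge0 ?(ltW r0).
  have -> : 7^-1 * r = r / 7 by ring.
  by rewrite ler_piMl ?divr_ge0 ?(ltW r0)// exprn_ile1 ?(ltW r0) ?(ltW r1).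
Qed.

Section RadialC2Global.
Context {R : realType} (h w w1 : R -> R).
Hypothesis ch : continuous h.
Hypothesis Y : radial_pair h w w1.

(** On [(0, r)] the source lies between the constants [h 0 - e] and [h 0 + e], and a constant source
    [c] gives [y1 / r = c / 7]. *)
Lemma quot1_near0 (e : R) : 0 < e -> exists2 d, 0 < d &
  forall r, 0 < r -> r < d -> `|quot1 h w1 r - h 0 / 7| <= e.
Proof.
move=> e0; have /nbhs_ballP[d /= d0 Hd] : \forall t \near (0 : R), `|h 0 - h t| < e.
  by move/cvgrPdist_lt: (@ch 0); apply.
exists d => // r r0 rd.
have hb t : 0 < t < r -> h 0 - e <= h t <= h 0 + e.
  move=> /andP[t0 tr]; have := Hd t; rewrite /ball /= sub0r normrN gtr0_norm//.
  by move=> /(_ (lt_trans tr rd)); rewrite ltr_norml; lra.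
have [t /hb /andP[]//|+ _] := radial_pair_le (radial_pair_const (h 0 - e)) Y r0.
have [t /hb /andP[]//|+ _] := radial_pair_le Y (radial_pair_const (h 0 + e)) r0.
rewrite /quot1 gt_eqF// => h1 h2.
have g1 : w1 r / r <= (h 0 + e) / 7 by rewrite ler_pdivrMr// mulrAC.
have g2 : (h 0 - e) / 7 <= w1 r / r by rewrite ler_pdivlMr// mulrAC.
by rewrite ler_norml; apply/andP; split; lra.
Qed.

Let quot1_cont0 : {for 0, continuous (fun x : 'cV[R]_3 => quot1 h w1 (enorm x))}.
Proof.
apply/continuous_distP => e e0; have [d d0 Hd] := quot1_near0 e0.
have H : \forall x \near (0 : 'cV[R]_3), enorm x < d.
  apply: (cvgr_lt (enorm (0 : 'cV[R]_3)) (@enorm_cont R 0)).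
  by rewrite enorm0.
near=> x; have xd : enorm x < d by near: x.
rewrite enorm0 [quot1 _ _ 0]/quot1 eqxx distrC.
have [x0|x0] := eqVneq (enorm x) 0.
  by rewrite x0 /quot1 eqxx subrr normr0 ltW.
by apply: Hd => //; rewrite lt_neqAle eq_sym x0 enorm_ge0.
Unshelve. all: by end_near. Qed.

Let derivable_pos (r : R) : 0 < r ->
  is_derive r 1 (quot1 h w1) (quot2 h w1 r * r).
Proof.
move=> r0; have H1 := pair_d2 Y r0.
have H : is_derive r 1 (fun t => w1 t / t) (quot2 h w1 r * r).
  derive_eq; first by rewrite gt_eqF.
  by rewrite /quot2 /quot1 gt_eqF//; field; rewrite gt_eqF.
apply: near_eq_is_derive H; near=> t.
rewrite /quot1 gt_eqF//; near: t; exact: lt_nbhsr.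
Unshelve. all: by end_near. Qed.

Lemma quot1_cont : continuous (fun x : 'cV[R]_3 => quot1 h w1 (enorm x)).
Proof.
move=> x; have [->|x0] := eqVneq x 0; first exact: quot1_cont0.
apply: (@continuous_comp _ _ _ (@enorm R) (quot1 h w1)); first exact: enorm_cont.
exact: is_derive_continuous (derivable_pos (enorm_gt0 x0)).
Qed.

Lemma enorm_line (k : 'I_3) (t : R) : enorm (t *: delta_mx k 0 + 0 : 'cV[R]_3) = `|t|.
Proof.
rewrite addr0 -[RHS]sqrtr_sqr /enorm; congr Num.sqrt; rewrite sum3E !mxE.
by case: (ord3P k) => -> /=; rewrite ?mulr1 ?mulr0 ?expr0n ?addr0 ?add0r.
Qed.

(** At the origin the chain rule through [enorm] fails. The first derivative is [0] because [w]
    differs from [w 0] by a multiple of [t^2]; the second is that of the continuous factor [w'/r]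
    times a coordinate. *)
Lemma radial_C2_global : radial_C2 setT w (quot1 h w1) (quot2 h w1).
Proof.
split => x _ k.
  have [->|x0] := eqVneq x 0; last first.
    by apply: radial_derive_grad => //; exact: (pair_d1 Y (enorm_gt0 x0)).
  rewrite mxE mulr0; apply: is_derive_line.
  have -> : (fun t : R => w (enorm (t *: delta_mx k 0 + 0 : 'cV[R]_3))) = (fun t => w `|t|).
    by apply/funext => t; rewrite enorm_line.
  have [c _ Hc] := @EVT_max R (fun t => `|h t|) 0 1 ler01
    (continuous_subspaceT (fun t => continuous_comp (@ch t) (@norm_continuous _ _ (h t)))).
  apply: (@derivative_eq0 R _ (`|h c| / 14) 1) => // t t1; rewrite normr0.
  have := radial_pair_norm_le Y (radial_pair_const `|h c|) (normr_ge0 t).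
  rewrite real_normK ?num_real// expr0n !mulr0 mul0r subr0 mulrAC; apply.
  by move=> r /andP[r0 rt]; apply: Hc; rewrite in_itv /=; lra.
move=> l; have [->|x0] := eqVneq x 0; last first.
  by apply: radial_derive_hess => //; exact: (pair_d2 Y (enorm_gt0 x0)).
rewrite !mxE !mulr0 addr0; apply: is_derive_line.
have -> : (fun t : R => quot1 h w1 (enorm (t *: delta_mx l 0 + 0 : 'cV[R]_3)) *
    (t *: delta_mx l 0 + 0 : 'cV[R]_3) k 0) =
  (fun t => quot1 h w1 `|t| * dlt k l * t).
  by apply/funext => t; rewrite enorm_line addr0 !mxE eqxx andbT /dlt; ring.
rewrite enorm0; have -> : quot1 h w1 0 = quot1 h w1 `|0 : R| by rewrite normr0.
apply: (@is_derive_mul_id R (fun t => quot1 h w1 `|t| * dlt k l)).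
apply: continuousM; last exact: cst_continuous.
have -> : (fun t : R => quot1 h w1 `|t|) =
    (fun t : R => quot1 h w1 (enorm (t *: delta_mx l 0 + 0 : 'cV[R]_3))).
  by apply/funext => t; rewrite enorm_line.
apply: (@continuous_comp _ _ _ (fun t : R => t *: delta_mx l 0 + 0 : 'cV[R]_3)
  (fun x => quot1 h w1 (enorm x))); last exact: quot1_cont.
apply: continuousD; last exact: cst_continuous.
exact: scalel_continuous.
Qed.

(** Near the origin [|x k 0 * x l 0| <= |x|^2] cancels the denominator of [quot2], and the numerator
    [h - 7 w'/r] tends to [0]. *)
Lemma quot2_tensor_cont (k l : 'I_3) : continuous (fun x : 'cV[R]_3 =>
  quot2 h w1 (enorm x) * (x k 0 * x l 0)).
Proof.
move=> x; have [->|x0] := eqVneq x 0; last first.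
  have e0 := enorm_gt0 x0.
  have cz : {for x, continuous (fun x : 'cV[R]_3 => quot2 h w1 (enorm x))}.
    apply: (@continuous_comp _ _ _ (@enorm R) (quot2 h w1)); first exact: enorm_cont.
    have cq := is_derive_continuous (derivable_pos e0).
    have cn : {for enorm x, continuous (fun r : R => h r - 7 * quot1 h w1 r)}.
      apply: (@continuousB _ _ _ h (fun r : R => 7 * quot1 h w1 r)); first exact: ch.
      by apply: (@continuousM _ _ (fun=> 7) (quot1 h w1)) => //; exact: cst_continuous.
    apply: (@continuousM _ _ (fun r : R => h r - 7 * quot1 h w1 r)
      (fun r : R => (r ^+ 2)^-1)) => //.
    apply: (@is_derive_continuous _ _ _ (- (enorm x ^+ 2) ^- 2 * (2 * enorm x))).
    by derive_eq; rewrite ?expf_neq0 ?gt_eqF//; ring.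
  apply: (@continuousM _ _ (fun x : 'cV[R]_3 => quot2 h w1 (enorm x))
    (fun x : 'cV[R]_3 => x k 0 * x l 0)) => //.
  by apply: (@continuousM _ _ (fun x : 'cV[R]_3 => x k 0) (fun x : 'cV[R]_3 => x l 0));
    exact: coord_cont.
have cd : {for 0, continuous (fun x : 'cV[R]_3 => h (enorm x) - 7 * quot1 h w1 (enorm x))}.
  apply: continuousB.
    by apply: (@continuous_comp _ _ _ (@enorm R) h); [exact: enorm_cont | exact: ch].
  by apply: continuousM; [exact: cst_continuous | exact: quot1_cont].
apply/continuous_distP => e e0; move/continuous_distP: cd => /(_ e e0).
apply: filterS => y; rewrite enorm0 {1}/quot1 eqxx.
have -> : h 0 - 7 * (h 0 / 7) = 0 by field.
rewrite !mxE !mulr0 !sub0r !normrN => H.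
apply: le_trans H; rewrite /quot2 -mulrA normrM.
rewrite ler_piMr// normrM normfV normrX (ger0_norm (enorm_ge0 y)) normrM.
have [y0|y0] := eqVneq (enorm y) 0; first by rewrite y0 expr0n invr0 mul0r ler01.
have ypos : 0 < enorm y by rewrite lt_neqAle eq_sym y0 enorm_ge0.
rewrite ler_pdivrMl ?exprn_gt0// mulr1 expr2.
have yk m : `|y m 0| <= enorm y.
  rewrite -(ler_pXn2r (ltn0Sn 1)) ?nnegrE ?enorm_ge0// real_normK ?num_real// enorm_sqr.
  by rewrite /sqnorm (bigD1 m)//= lerDl; apply: sumr_ge0 => i _; exact: sqr_ge0.
by apply: ler_pM.
Qed.
End RadialC2Global.

(** * From radial profiles to solutions *)

Definition radial_tensor {R : realType} (w : R -> R) (x : 'cV[R]_3) : 'M[R]_3 :=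
  \matrix_(i < 3, j < 3) (w (enorm x) * hedge i j x).

Lemma radial_tensorE {R : realType} (w : R -> R) (x : 'cV[R]_3) i j :
  radial_tensor w x i j = w (enorm x) * hedge i j x.
Proof. by rewrite mxE. Qed.

Lemma sqnorm_cont {R : realType} : continuous (@sqnorm R).
Proof.
have -> : @sqnorm R = (fun x : 'cV[R]_3 => x o0 0 ^+ 2 + x o1 0 ^+ 2 + x o2 0 ^+ 2).
  by apply/funext => y; exact: sqnormE.
have c2 i : continuous (fun x : 'cV[R]_3 => x i 0 ^+ 2).
  move=> x; apply: (@continuous_comp _ _ _ (fun x : 'cV[R]_3 => x i 0) (fun t => t ^+ 2)).
    exact: coord_cont.
  exact: exprn_continuous.
move=> x; apply: (@continuousD _ _ _ (fun x : 'cV[R]_3 => x o0 0 ^+ 2 + x o1 0 ^+ 2)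
  (fun x : 'cV[R]_3 => x o2 0 ^+ 2)); last exact: c2.
by apply: (@continuousD _ _ _ (fun x : 'cV[R]_3 => x o0 0 ^+ 2)
  (fun x : 'cV[R]_3 => x o1 0 ^+ 2)); exact: c2.
Qed.

Lemma cst_cont_at {R : realType} (c : R) (x : 'cV[R]_3) :
  {for x, continuous (fun _ : 'cV[R]_3 => c)}.
Proof. exact: cst_continuous. Qed.

Lemma continuousDf {R : realType} {T : topologicalType} (f g : T -> R) (x : T) :
  {for x, continuous f} -> {for x, continuous g} ->
  {for x, continuous (fun y => f y + g y)}.
Proof. exact: continuousD. Qed.

Lemma continuousNf {R : realType} {T : topologicalType} (f : T -> R) (x : T) :
  {for x, continuous f} -> {for x, continuous (fun y => - f y)}.
Proof. exact: continuousN. Qed.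

Lemma continuousMf {R : realType} {T : topologicalType} (f g : T -> R) (x : T) :
  {for x, continuous f} -> {for x, continuous g} ->
  {for x, continuous (fun y => f y * g y)}.
Proof. exact: continuousM. Qed.

Ltac cont3 := first [exact (@cst_cont_at _ _ _) | eassumption | exact (@sqnorm_cont _ _) |
  lazymatch goal with
  | |- {for _, continuous (fun y => @?f y + @?g y)} =>
      refine (@continuousDf _ _ f g _ _ _); cont3
  | |- {for _, continuous (fun y => - @?f y)} =>
      refine (@continuousNf _ _ f _ _); cont3
  | |- {for _, continuous (fun y => @?f y * @?g y)} =>
      first [eassumption | refine (@continuousMf _ _ f g _ _ _); cont3]
  | |- {for _, continuous (fun y => fun_of_matrix y _ _)} => exact (@coord_cont _ _ _ _ _ _)
  end].

Lemma hedge_cont {R : realType} i j : continuous (@hedge R i j).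
Proof.
move=> x; have H : {for x, continuous (fun x : 'cV[R]_3 =>
  x i 0 * x j 0 - dlt i j / 3 * sqnorm x)} by cont3.
exact: H.
Qed.

Lemma hedge1_cont {R : realType} i j k : continuous (@hedge1 R i j k).
Proof.
move=> x; have H : {for x, continuous (fun x : 'cV[R]_3 =>
  dlt i k * x j 0 + x i 0 * dlt j k - dlt i j * (2 / 3) * x k 0)} by cont3.
exact: H.
Qed.

Lemma radial_tensor_C2 {R : realType} (h w w1 : R -> R) (A : set 'cV[R]_3) i j :
  continuous h -> continuous w -> radial_pair h w w1 ->
  C2_on A (fun x => radial_tensor w x i j).
Proof.
move=> ch cw Y x _.
have oT : open [set: 'cV[R]_3] by exact: openT.
have HC := radial_C2_global ch Y.
have QE y : [set: 'cV[R]_3] y -> forall i j, radial_tensor w y i j = w (enorm y) * hedge i j y.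
  by move=> _ a b; exact: radial_tensorE.
have cW : {for x, continuous (fun x : 'cV[R]_3 => w (enorm x))}.
  by apply: (@continuous_comp _ _ _ (@enorm R) w); [exact: enorm_cont|exact: cw].
have cZ := @quot1_cont R h w w1 ch Y x.
have cK k l := @quot2_tensor_cont R h w w1 ch Y k l x.
have cP := @hedge_cont R i j x.
have cP1 k := @hedge1_cont R i j k x.
have p1 k : partial k (fun y => radial_tensor w y i j) = tensor1 w (quot1 h w1) i j k.
  by apply/funext => y; exact: (tensor_partial1 oT HC QE).
split.
  have -> : (fun y => radial_tensor w y i j) = (fun y => w (enorm y) * hedge i j y).
    by apply/funext => y; rewrite radial_tensorE.
  by cont3.
move=> k; split.
- by have [] := tensor_derive1 oT HC QE i j k (I : setT x).
- by rewrite p1 /tensor1; have := cP1 k => cP1'; cont3.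
- move=> l; split; first by have [] := tensor_derive2 oT HC QE i j k l (I : setT x).
  have -> : partial l (partial k (fun y => radial_tensor w y i j)) =
      tensor2 w (quot1 h w1) (quot2 h w1) i j k l.
    by apply/funext => y; exact: (tensor_partial2 oT HC QE).
  have cP1k := cP1 k; have cP1l := cP1 l; have cKkl := cK k l.
  by rewrite /tensor2; cont3.
Qed.

(** * The bulk force on radial tensors *)

Lemma mxtrace_mul_delta {R : realType} (A : 'M[R]_3) i j :
  \tr (A *m delta_mx i j) = A j i.
Proof.
rewrite /mxtrace (bigD1 j)//= big1 ?addr0.
  rewrite mxE (bigD1 i)//= big1 ?addr0; first by rewrite mxE !eqxx mulr1.
  by move=> k ki; rewrite mxE (negbTE ki) mulr0.
move=> k kj; rewrite mxE big1// => l _.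
by rewrite mxE (negbTE kj) andbF mulr0.
Qed.

(** Along the line [h E + Q] the potential is a polynomial in [h] whose linear coefficient is the
    derivative; [tr(A E) = A j i] for the matrix unit [E] explains the transposed indices. *)
Lemma dfbulkE {R : realType} (a2 b2 c2 : R) (Q : 'M[R]_3) i j :
  dfbulk a2 b2 c2 Q i j = - a2 * Q j i - b2 * (Q *m Q) j i + c2 * qnorm2 Q * Q j i.
Proof.
rewrite mxE; pose E : 'M[R]_3 := delta_mx i j.
pose t2 := \tr (E *m E); pose c1 := \tr (E *m E *m Q); pose c0 := \tr (E *m E *m E).
have trQE (h : R) : qnorm2 (h *: E + Q) = h ^+ 2 * t2 + h * (2 * Q j i) + qnorm2 Q.
  rewrite /qnorm2 mulmxDl !mulmxDr -!scalemxAl -!scalemxAr !mxtraceD !mxtraceZ.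
  have e1 : \tr (Q *m E) = Q j i by exact: mxtrace_mul_delta.
  have e2 : \tr (E *m Q) = Q j i by rewrite mxtrace_mulC.
  by rewrite e1 e2 -/t2; ring.
have tr3 (h : R) : \tr ((h *: E + Q) *m (h *: E + Q) *m (h *: E + Q)) =
    h ^+ 3 * c0 + h ^+ 2 * (3 * c1) + h * (3 * (Q *m Q) j i) + \tr (Q *m Q *m Q).
  rewrite !(mulmxDl, mulmxDr) -!(scalemxAl, scalemxAr) !mxtraceD !mxtraceZ.
  have e1 : \tr (E *m Q *m E) = c1 by rewrite mxtrace_mulC mulmxA.
  have e2 : \tr (Q *m E *m E) = c1 by rewrite -mulmxA mxtrace_mulC.
  have e3 : \tr (Q *m Q *m E) = (Q *m Q) j i by exact: mxtrace_mul_delta.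
  have e4 : \tr (Q *m E *m Q) = (Q *m Q) j i by rewrite mxtrace_mulC mulmxA.
  have e5 : \tr (E *m Q *m Q) = (Q *m Q) j i by rewrite -mulmxA mxtrace_mulC.
  by rewrite e1 e2 e3 e4 e5 -/c1 -/c0; ring.
have D : is_derive (0 : R) 1 (fun h : R => fbulk a2 b2 c2 (h *: E + Q))
    (- a2 * Q j i - b2 * (Q *m Q) j i + c2 * qnorm2 Q * Q j i).
  have -> : (fun h : R => fbulk a2 b2 c2 (h *: E + Q)) = (fun h =>
    - (a2 / 2) * (h ^+ 2 * t2 + h * (2 * Q j i) + qnorm2 Q) -
    b2 / 3 * (h ^+ 3 * c0 + h ^+ 2 * (3 * c1) + h * (3 * (Q *m Q) j i) + \tr (Q *m Q *m Q)) +
    c2 / 4 * (h ^+ 2 * t2 + h * (2 * Q j i) + qnorm2 Q) ^+ 2).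
    by apply/funext => h; rewrite /fbulk trQE tr3.
  derive_eq; rewrite /= !expr0n /= !(mul0r, mulr0, addr0, add0r, oppr0) expr1.
  by field.
by have [_ ] := is_derive_line D.
Qed.

Definition hedge_mx {R : realType} (x : 'cV[R]_3) : 'M[R]_3 :=
  x *m x^T - (sqnorm x / 3)%:M.

Lemma hedge_mxE {R : realType} (x : 'cV[R]_3) i j : hedge_mx x i j = hedge i j x.
Proof.
rewrite !mxE big_ord1 !mxE /hedge /dlt; congr (_ - _).
by case: eqP => _; rewrite /= ?mulr1n ?mulr0n; field.
Qed.

Lemma radial_tensor_mx {R : realType} (w : R -> R) (x : 'cV[R]_3) :
  radial_tensor w x = w (enorm x) *: hedge_mx x.
Proof. by apply/matrixP => i j; rewrite radial_tensorE mxE hedge_mxE. Qed.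

Lemma hedge_sym {R : realType} i j (x : 'cV[R]_3) : hedge i j x = hedge j i x.
Proof. by rewrite /hedge /dlt mulrC eq_sym. Qed.

Lemma hedge_tr {R : realType} (x : 'cV[R]_3) : \sum_k hedge k k x = 0.
Proof. by rewrite sum3E /hedge /dlt sqnormE /=; field. Qed.

Lemma radial_tensor_S0 {R : realType} (w : R -> R) (x : 'cV[R]_3) : S0 (radial_tensor w x).
Proof.
split; first by apply/matrixP => i j; rewrite mxE !radial_tensorE hedge_sym.
rewrite /mxtrace (eq_bigr (fun k => w (enorm x) * hedge k k x)).
  by rewrite -mulr_sumr hedge_tr mulr0.
by move=> k _; rewrite radial_tensorE.
Qed.

(** The hedgehog tensor has the eigenvalues [2/3 |x|^2] and, twice, [-1/3 |x|^2]; this is their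
    common quadratic equation. *)
Lemma hedge_sq {R : realType} i j (x : 'cV[R]_3) :
  \sum_k hedge i k x * hedge k j x =
  sqnorm x / 3 * hedge i j x + (i == j)%:R * (2 / 9 * sqnorm x ^+ 2).
Proof.
rewrite (sum3E (fun k => hedge i k x * hedge k j x)) /hedge /dlt sqnormE.
case: (ord3P i) => ->; case: (ord3P j) => ->; rewrite /=.
all: move: (x o0 0) (x o1 0) (x o2 0) => a b c.
all: by field.
Qed.

Lemma radial_tensor_rhs {R : realType} (a2 b2 c2 : R) (w : R -> R) (x : 'cV[R]_3) i j :
  let Q := radial_tensor w x in
  dfbulk a2 b2 c2 Q i j - (i == j)%:R / 3 * \tr (dfbulk a2 b2 c2 Q) =
  w (enorm x) * hedge i j x * (- a2 - b2 / 3 * (sqnorm x * w (enorm x))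
     + 2 * c2 / 3 * (sqnorm x * w (enorm x)) ^+ 2).
Proof.
move=> Q; set W := w (enorm x).
have QQ a b : (Q *m Q) a b = W ^+ 2 * (sqnorm x / 3 * hedge a b x +
    (a == b)%:R * (2 / 9 * sqnorm x ^+ 2)).
  rewrite mxE -hedge_sq mulr_sumr; apply: eq_bigr => k _.
  by rewrite !radial_tensorE -/W; ring.
have nQ : qnorm2 Q = W ^+ 2 * (2 / 3 * sqnorm x ^+ 2).
  rewrite /qnorm2 /mxtrace sum3E !QQ -!mulrDr; congr (_ * _).
  have := hedge_tr x; rewrite sum3E.
  set p := hedge o0 o0 x; set q := hedge o1 o1 x; set r := hedge o2 o2 x => H.
  have -> : r = - (p + q) by apply/eqP; rewrite -addr_eq0 addrC H.
  by rewrite /=; field.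
have E a b : dfbulk a2 b2 c2 Q a b = (- a2 + c2 * (W ^+ 2 * (2 / 3 * sqnorm x ^+ 2))
    - b2 * W * sqnorm x / 3) * W * hedge a b x
    - (a == b)%:R * (b2 * W ^+ 2 * (2 / 9 * sqnorm x ^+ 2)).
  by rewrite dfbulkE nQ QQ radial_tensorE -/W (hedge_sym b a) eq_sym; ring.
have -> : \tr (dfbulk a2 b2 c2 Q) = - 3 * (b2 * W ^+ 2 * (2 / 9 * sqnorm x ^+ 2)).
  rewrite /mxtrace sum3E !E /=.
  have := hedge_tr x; rewrite sum3E.
  set p := hedge o0 o0 x; set q := hedge o1 o1 x; set r := hedge o2 o2 x => H.
  have -> : r = - (p + q) by apply/eqP; rewrite -addr_eq0 addrC H.
  by ring.
by rewrite E; field.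
Qed.

(** * Radially symmetric maps *)

Lemma point3E {R : realType} (p : R * R * R) :
  [/\ point3 p o0 0 = p.1.1, point3 p o1 0 = p.1.2 & point3 p o2 0 = p.2].
Proof. by split; rewrite mxE (tnth_nth 0). Qed.

Lemma point3_surj {R : realType} (x : 'cV[R]_3) : exists p, x = point3 p.
Proof.
exists (x o0 0, x o1 0, x o2 0); apply/matrixP => i j; rewrite ord1.
have [h0 h1 h2] := point3E (x o0 0, x o1 0, x o2 0).
by case: (ord3P i) => ->; rewrite ?h0 ?h1 ?h2.
Qed.

Lemma sqnorm_mx {R : realType} (x : 'cV[R]_3) : sqnorm x = (x^T *m x) 0 0.
Proof. by rewrite mxE; apply: eq_bigr => k _; rewrite mxE expr2. Qed.

Lemma SO3_trmx {R : realType} (O : 'M[R]_3) : SO3 O -> O^T *m O = 1%:M.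
Proof. by move=> [OO _]; apply: mulmx1C. Qed.

Lemma sqnorm_SO3 {R : realType} (O : 'M[R]_3) (x : 'cV[R]_3) :
  SO3 O -> sqnorm (O *m x) = sqnorm x.
Proof.
move=> /SO3_trmx OO.
by rewrite !sqnorm_mx trmx_mul mulmxA -(mulmxA x^T) OO mulmx1.
Qed.

Lemma enorm_SO3 {R : realType} (O : 'M[R]_3) (x : 'cV[R]_3) :
  SO3 O -> enorm (O *m x) = enorm x.
Proof. by move=> HO; congr Num.sqrt; exact: sqnorm_SO3. Qed.

Lemma hedge_mx_SO3 {R : realType} (O : 'M[R]_3) (x : 'cV[R]_3) :
  SO3 O -> hedge_mx (O *m x) = O *m hedge_mx x *m O^T.
Proof.
move=> HO; have [OO _] := HO.
rewrite /hedge_mx sqnorm_SO3// mulmxBr mulmxBl trmx_mul !mulmxA.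
by rewrite mul_mx_scalar -scalemxAl OO scalemx1.
Qed.

Lemma radial_tensor_SO3 {R : realType} (w : R -> R) (O : 'M[R]_3) (x : 'cV[R]_3) :
  SO3 O -> radial_tensor w (O *m x) = O *m radial_tensor w x *m O^T.
Proof.
by move=> HO; rewrite !radial_tensor_mx enorm_SO3// hedge_mx_SO3// scalemxAl scalemxAr.
Qed.

Lemma radial_tensor_symmetric {R : realType} (w : R -> R) (A : set 'cV[R]_3) :
  continuous w -> radially_symmetric A (radial_tensor w).
Proof.
move=> cw; split; last first.
  by move=> O HO; apply: aeW => p _; exact: radial_tensor_SO3.
move=> i j; apply: (@measurable_funS _ _ _ _ setT) => //.
have m11 : measurable_fun setT (fun p : R * R * R => p.1.1).
  exact: (measurableT_comp measurable_fst measurable_fst).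
have m12 : measurable_fun setT (fun p : R * R * R => p.1.2).
  exact: (measurableT_comp measurable_snd measurable_fst).
have m2 : measurable_fun setT (fun p : R * R * R => p.2) by exact: measurable_snd.
have mx (k : 'I_3) : measurable_fun setT (fun p : R * R * R => point3 p k 0).
  have [e|e|e] := ord3P k; rewrite e.
  - by apply: eq_measurable_fun m11 => p _; have [-> _ _] := point3E p.
  - by apply: eq_measurable_fun m12 => p _; have [_ -> _] := point3E p.
  - by apply: eq_measurable_fun m2 => p _; have [_ _ ->] := point3E p.
have ms : measurable_fun setT (fun p : R * R * R => sqnorm (point3 p)).
  apply: (eq_measurable_fun (fun p : R * R * R =>
    point3 p o0 0 ^+ 2 + point3 p o1 0 ^+ 2 + point3 p o2 0 ^+ 2)).
    by move=> p _; rewrite sqnormE.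
  apply: measurable_funD; last exact: measurable_funX.
  by apply: measurable_funD; exact: measurable_funX.
have mw : measurable_fun setT (fun p : R * R * R => w (enorm (point3 p))).
  apply: (measurableT_comp (continuous_measurable_fun cw)).
  exact: (measurableT_comp (continuous_measurable_fun (@sqrt_continuous R)) ms).
apply: (eq_measurable_fun (fun p : R * R * R => w (enorm (point3 p)) *
   (point3 p i 0 * point3 p j 0 - dlt i j / 3 * sqnorm (point3 p)))).
  by move=> p _; rewrite radial_tensorE.
apply: measurable_funM => //; apply: measurable_funB; first exact: measurable_funM.
by apply: measurable_funM.
Qed.

(** A cube of side [2 e] has positive measure, so it is not contained in the exceptional null
    set. *)
Lemma ae_dense {R : realType} (P : R * R * R -> Prop) (p : R * R * R) (e : R) :
  {ae lebesgue3, forall q, P q} -> 0 < e ->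
  exists q, [/\ P q, `|q.1.1 - p.1.1| < e, `|q.1.2 - p.1.2| < e & `|q.2 - p.2| < e].
Proof.
move=> [N [mN N0 HN]] e0; apply: contrapT => H.
pose I (x : R) : set R := `]x - e, x + e[%classic.
pose B : set (R * R * R) := (I p.1.1 `*` I p.1.2) `*` I p.2.
have mI x : measurable (I x) by exact: measurable_itv.
have mB : measurable B.
  by apply: measurableX; [apply: measurableX; exact: mI | exact: mI].
have BN : B `<=` N.
  move=> [[a b] c] [[/= a1 b1] c1]; apply: HN => /= Pq; apply: H.
  move: a1 b1 c1; rewrite /I /= !in_itv /= => a1 b1 c1.
  by exists (a, b, c); split => //=; rewrite ltr_distl.
have : (lebesgue3 B <= lebesgue3 N)%E.
  by apply: (@le_measure _ _ _ lebesgue3) => //; rewrite inE.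
rewrite N0 leNgt => /negP; apply.
have m12 : measurable (I p.1.1 `*` I p.1.2) by apply: measurableX; exact: mI.
have -> : lebesgue3 B = ((@lebesgue_measure R \x @lebesgue_measure R) (I p.1.1 `*` I p.1.2) *
    lebesgue_measure (I p.2))%E.
  exact (@product_measure1E _ _ _ _ R (lebesgue_measure \x lebesgue_measure)%E
    lebesgue_measure _ _ m12 (mI p.2)).
have -> : (@lebesgue_measure R \x @lebesgue_measure R)%E (I p.1.1 `*` I p.1.2) =
    (lebesgue_measure (I p.1.1) * lebesgue_measure (I p.1.2))%E.
  exact (@product_measure1E _ _ _ _ R lebesgue_measure lebesgue_measure _ _ (mI p.1.1) (mI p.1.2)).
have lI x : lebesgue_measure (I x) = (2 * e)%:E.
  rewrite lebesgue_measure_itv /= lte_fin ifT; last by lra.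
  by rewrite -EFinD; congr (_%:E); ring.
by rewrite !lI -!EFinM lte_fin !mulr_gt0.
Qed.

Lemma mx_continuous {R : realType} {T : topologicalType} m n (f : T -> 'M[R]_(m, n)) (x : T) :
  (forall i j, {for x, continuous (fun y => f y i j)}) -> {for x, continuous f}.
Proof.
move=> H; apply/cvg_ballP => e e0.
have : \forall y \near x, forall i j, `|f x i j - f y i j| < e.
  apply: filter_forall => i; apply: filter_forall => j.
  by have /cvgrPdist_lt := H i j; apply.
by apply: filterS => y Hy; split.
Qed.

(** Both sides are continuous in [x], so a difference at one point would persist on a neighbourhood,
    which meets the set of full measure by [ae_dense]. *)
Lemma radially_symmetric_everywhere {R : realType} (A : set 'cV[R]_3) (Q : 'cV[R]_3 -> 'M[R]_3) :
  open A -> (forall O x, SO3 O -> A x -> A (O *m x)) ->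
  (forall x, A x -> forall i j, {for x, continuous (fun y => Q y i j)}) ->
  radially_symmetric A Q -> forall O, SO3 O -> forall x, A x ->
  Q (O *m x) = O *m Q x *m O^T.
Proof.
move=> oA AO cQ [_ HQ] O HO x Ax; apply/matrixP => i j; apply/eqP; rewrite -subr_eq0.
pose F y : R := Q (O *m y) i j - (O *m Q y *m O^T) i j.
have cO : {for x, continuous (fun y : 'cV[R]_3 => O *m y)}.
  apply: mx_continuous => a b; rewrite ord1.
  have -> : (fun y : 'cV[R]_3 => (O *m y) a 0) =
      (fun y => O a o0 * y o0 0 + O a o1 * y o1 0 + O a o2 * y o2 0).
    by apply/funext => y; rewrite mxE (sum3E (fun k => O a k * y k 0)).
  by cont3.
have cQx a b : {for x, continuous (fun y => Q y a b)} by exact: cQ.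
have cQO : {for x, continuous (fun y => Q (O *m y) i j)}.
  apply: (@continuous_comp _ _ _ (fun y : 'cV[R]_3 => O *m y) (fun y => Q y i j)) => //.
  by apply: cQ; exact: AO.
have cF : {for x, continuous F}.
  have -> : F = (fun y => Q (O *m y) i j - (
      O j o0 * (O i o0 * Q y o0 o0 + O i o1 * Q y o1 o0 + O i o2 * Q y o2 o0) +
      O j o1 * (O i o0 * Q y o0 o1 + O i o1 * Q y o1 o1 + O i o2 * Q y o2 o1) +
      O j o2 * (O i o0 * Q y o0 o2 + O i o1 * Q y o1 o2 + O i o2 * Q y o2 o2))).
    apply/funext => y; rewrite /F mxE (sum3E (fun k => (O *m Q y) i k * O^T k j)).
    by rewrite !mxE !(sum3E (fun k => O i k * Q y k _)) !(mulrC (O j _)).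
  have lin (a b c : R) (f g h : 'cV[R]_3 -> R) : {for x, continuous f} ->
      {for x, continuous g} -> {for x, continuous h} ->
      {for x, continuous (fun y => a * f y + b * g y + c * h y)}.
    by move=> cf cg ch; cont3.
  by apply: continuousB; [exact: cQO | do 2!apply: (lin); exact: cQx].
apply/eqP; change (F x = 0); apply: contrapT => /eqP Fx.
have cnF : {for x, continuous (fun y => `|F y|)}.
  by apply: (@continuous_comp _ _ _ F (fun t => `|t|)) => //; exact: norm_continuous.
have nF : \forall y \near x, 0 < `|F y|.
  have Fx0 : 0 < `|F x| by rewrite normr_gt0.
  exact: (cvgr_gt `|F x| cnF 0 Fx0).
have nA : \forall y \near x, A y by exact: open_nbhs_nbhs.
have /nbhs_ballP[e /= e0 He] : \forall y \near x, A y /\ 0 < `|F y| by near=> y; split; near: y.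
have [p xp] := point3_surj x.
have [q [Pq q1 q2 q3]] := ae_dense p (HQ O HO) e0.
have [Aq Fq] : A (point3 q) /\ 0 < `|F (point3 q)|.
  apply: He; rewrite xp; split => // a b; rewrite ord1 /ball /= distrC.
  have [p1 p2 p3] := point3E p; have [r1 r2 r3] := point3E q.
  by case: (ord3P a) => ->; rewrite ?p1 ?p2 ?p3 ?r1 ?r2 ?r3.
by move: Fq; rewrite /F Pq// subrr normr0 ltxx.
Unshelve. all: by end_near. Qed.

(** * Explicit rotations *)

Lemma det3E {R : realType} (A : 'M[R]_3) : \det A =
  A o0 o0 * (A o1 o1 * A o2 o2 - A o1 o2 * A o2 o1)
  - A o0 o1 * (A o1 o0 * A o2 o2 - A o1 o2 * A o2 o0)
  + A o0 o2 * (A o1 o0 * A o2 o1 - A o1 o1 * A o2 o0).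
Proof.
(* Indexing by [nat] identifies the different ordinal terms that the cofactor expansion produces. *)
pose G (a b : nat) := A (inord a) (inord b).
have AE i j : A i j = G i j by rewrite /G !inord_val.
rewrite (expand_det_row _ ord0) !big_ord_recl big_ord0 /cofactor.
rewrite !(expand_det_row _ ord0) !big_ord_recl !big_ord0 /cofactor !det_mx11 !mxE.
rewrite !AE /= /bump /= !(expr0, expr1, addn0, add1n, addn1) /=; ring.
Qed.

Definition mx3 {R : realType} (a b c d e f g h i : R) : 'M[R]_3 :=
  \matrix_(k < 3, l < 3) nth 0 (nth [::] [:: [:: a; b; c]; [:: d; e; f]; [:: g; h; i]] k) l.

Lemma mx3_SO3 {R : realType} (a b c d e f g h i : R) :
  mx3 a b c d e f g h i *m (mx3 a b c d e f g h i)^T = 1%:M ->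
  a * (e * i - f * h) - b * (d * i - f * g) + c * (d * h - e * g) = 1 ->
  SO3 (mx3 a b c d e f g h i).
Proof. by move=> H1 H2; split => //; rewrite det3E !mxE. Qed.

Lemma mx3_mul {R : realType} (A B : 'M[R]_3) i j :
  (A *m B) i j = A i o0 * B o0 j + A i o1 * B o1 j + A i o2 * B o2 j.
Proof. by rewrite mxE (sum3E (fun k => A i k * B k j)). Qed.

Lemma mx3P {R : realType} (A B : 'M[R]_3) :
  A o0 o0 = B o0 o0 -> A o0 o1 = B o0 o1 -> A o0 o2 = B o0 o2 ->
  A o1 o0 = B o1 o0 -> A o1 o1 = B o1 o1 -> A o1 o2 = B o1 o2 ->
  A o2 o0 = B o2 o0 -> A o2 o1 = B o2 o1 -> A o2 o2 = B o2 o2 -> A = B.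
Proof.
move=> *; apply/matrixP => i j.
by case: (ord3P i) => ->; case: (ord3P j) => ->.
Qed.

Ltac mx3_orth := apply: mx3P; rewrite mx3_mul !mxE /=; ring.

Lemma turn_z {R : realType} : SO3 (mx3 0 (-1) 0 1 0 0 0 0 1 : 'M[R]_3).
Proof. by apply: mx3_SO3; [mx3_orth | ring]. Qed.

Lemma flip_z {R : realType} : SO3 (mx3 (-1) 0 0 0 (-1) 0 0 0 1 : 'M[R]_3).
Proof. by apply: mx3_SO3; [mx3_orth | ring]. Qed.

Lemma flip_x {R : realType} : SO3 (mx3 1 0 0 0 (-1) 0 0 0 (-1) : 'M[R]_3).
Proof. by apply: mx3_SO3; [mx3_orth | ring]. Qed.

Lemma cycle_axes {R : realType} : SO3 (mx3 0 0 1 1 0 0 0 1 0 : 'M[R]_3).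
Proof. by apply: mx3_SO3; [mx3_orth | ring]. Qed.

(** This is the rotation by the angle pi about [m]; orthogonality holds because [m m^T] is a
    symmetric projection. *)
Lemma half_turn {R : realType} (m : 'cV[R]_3) : sqnorm m = 1 ->
  SO3 (2 *: (m *m m^T) - 1%:M).
Proof.
move=> m1; have mm : m^T *m m = 1%:M.
  by apply/matrixP => i j; rewrite !ord1 -sqnorm_mx m1 mxE.
split.
  set P := m *m m^T; have PP : P *m P = P.
    by rewrite /P mulmxA -(mulmxA m) mm mulmx1.
  have -> : (2 *: P - 1%:M)^T = 2 *: P - 1%:M.
    by rewrite linearB linearZ /= trmx_mul trmxK trmx1.
  rewrite mulmxBl !mulmxBr -!scalemxAl -!scalemxAr PP mulmx1 !mul1mx.
  clearbody P; move: (1%:M : 'M[R]_3) => I1.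
  by apply/matrixP => i j; rewrite !mxE; ring.
transitivity (2 * sqnorm m - 1); last by rewrite m1; ring.
rewrite det3E sqnormE !mxE !big_ord1 !mxE /=; ring.
Qed.

Definition axis {R : realType} : 'cV[R]_3 := delta_mx o2 0.

Lemma cV3P {R : realType} (x y : 'cV[R]_3) :
  x o0 0 = y o0 0 -> x o1 0 = y o1 0 -> x o2 0 = y o2 0 -> x = y.
Proof. by move=> *; apply/matrixP => i j; rewrite ord1; case: (ord3P i) => ->. Qed.

Lemma mul_axis {R : realType} (O : 'M[R]_3) i : (O *m axis) i 0 = O i o2.
Proof. by rewrite mxE (sum3E (fun k => O i k * axis k 0)) !mxE /=; ring. Qed.

(** The half turn about the bisector of [axis] and [n] exchanges the two; for [n = - axis] the
    bisector degenerates, and a half turn about the first coordinate axis is used. *)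
Lemma rotate_axis {R : realType} (n : 'cV[R]_3) : sqnorm n = 1 ->
  exists2 O, SO3 O & O *m axis = n.
Proof.
rewrite sqnormE; set a := n o0 0; set b := n o1 0; set c := n o2 0 => n1.
have a2 : 0 <= a ^+ 2 by exact: sqr_ge0.
have b2 : 0 <= b ^+ 2 by exact: sqr_ge0.
have c1 : -1 <= c.
  rewrite leNgt; apply/negP => c1; have : 1 < c ^+ 2 by rewrite expr2; nra.
  by lra.
move: c1; rewrite le_eqVlt => /orP[/eqP c1|c1].
  exists (mx3 1 0 0 0 (-1) 0 0 0 (-1)); first exact: flip_x.
  have a0 : a = 0 by apply/eqP; rewrite -sqrf_eq0; apply/eqP; move: n1; rewrite -c1; lra.
  have b0 : b = 0 by apply/eqP; rewrite -sqrf_eq0; apply/eqP; move: n1; rewrite -c1; lra.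
  by apply: cV3P; rewrite mul_axis mxE /= -/a -/b -/c ?a0 ?b0 -?c1.
have c0 : 0 < 2 + 2 * c by lra.
pose t := Num.sqrt (2 + 2 * c)^-1.
have t2 : t ^+ 2 = (2 + 2 * c)^-1 by rewrite sqr_sqrtr// invr_ge0 ltW.
pose m := t *: (axis + n).
have t2c : t ^+ 2 * (2 + 2 * c) = 1 by rewrite t2 mulVf// gt_eqF.
have m1 : sqnorm m = 1.
  transitivity (t ^+ 2 * ((a ^+ 2 + b ^+ 2 + c ^+ 2) + 1 + 2 * c)).
    by rewrite sqnormE !mxE /= -/a -/b -/c; ring.
  by rewrite n1 -[RHS]t2c; ring.
exists (2 *: (m *m m^T) - 1%:M); first exact: half_turn.
apply: cV3P; rewrite mul_axis !mxE big_ord1 !mxE /= -/a -/b -/c.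
- by transitivity (t ^+ 2 * (2 + 2 * c) * a); [ring | rewrite t2c mul1r].
- by transitivity (t ^+ 2 * (2 + 2 * c) * b); [ring | rewrite t2c mul1r].
- by transitivity (t ^+ 2 * (2 + 2 * c) * (1 + c) - 1); [ring | rewrite t2c; ring].
Qed.

(** * Consequences of invariance under stabilisers *)

Section Equivariant.
Context {R : realType} (A : set 'cV[R]_3) (Q : 'cV[R]_3 -> 'M[R]_3).
Hypothesis QS : forall x, A x -> S0 (Q x).
Hypothesis QO : forall O, SO3 O -> forall x, A x -> Q (O *m x) = O *m Q x *m O^T.

Let fixed O x i j : SO3 O -> A x -> O *m x = x -> Q x i j = (O *m Q x *m O^T) i j.
Proof. by move=> HO Ax Ox; rewrite -QO// Ox. Qed.

Let conjE (O M : 'M[R]_3) i j : (O *m M *m O^T) i j =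
  (O i o0 * M o0 o0 + O i o1 * M o1 o0 + O i o2 * M o2 o0) * O j o0 +
  (O i o0 * M o0 o1 + O i o1 * M o1 o1 + O i o2 * M o2 o1) * O j o1 +
  (O i o0 * M o0 o2 + O i o1 * M o1 o2 + O i o2 * M o2 o2) * O j o2.
Proof. by rewrite mx3_mul !mx3_mul !mxE. Qed.

(** Two rotations about the axis suffice: [flip_z] kills the entries that mix the axis with its
    orthogonal plane, and [turn_z], with symmetry, makes the block in that plane scalar. The factor
    [3 / 2] inverts the entry [2/3] of [hedge_mx axis]. *)
Lemma equivariant_axis (r : R) : A (r *: axis) ->
  Q (r *: axis) = (3 / 2 * Q (r *: axis) o2 o2) *: hedge_mx axis.
Proof.
move=> Ar; set x := r *: axis in Ar *; have [sym tr] := QS Ar.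
have symE i j : Q x i j = Q x j i by rewrite -{1}sym mxE.
have zfix (a b c d : R) : mx3 a b 0 c d 0 0 0 1 *m x = x.
  rewrite /x -scalemxAr; congr (_ *: _).
  by apply: cV3P; rewrite mul_axis !mxE.
have fz i j := fixed i j flip_z Ar (zfix _ _ _ _).
have tz i j := fixed i j turn_z Ar (zfix _ _ _ _).
have := fz o0 o2; have := fz o1 o2; have := tz o0 o0; have := tz o0 o1.
rewrite !conjE !mxE /=.
move: tr; rewrite /mxtrace (sum3E (fun k => Q x k k)).
have := symE o0 o1; have := symE o0 o2; have := symE o1 o2.
move=> s12 s02 s01 tr e01 e00 e12 e02.
have q02 : Q x o0 o2 = 0 by lra.
have q12 : Q x o1 o2 = 0 by lra.
have q01 : Q x o0 o1 = 0 by lra.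
have q00 : Q x o0 o0 = - (1 / 2) * Q x o2 o2 by lra.
have q11 : Q x o1 o1 = - (1 / 2) * Q x o2 o2 by lra.
apply: mx3P; rewrite [RHS]mxE hedge_mxE /hedge /dlt sqnormE !mxE /=.
all: rewrite ?q02 ?q12 ?q01 -?s01 -?s02 -?s12 ?q01 ?q02 ?q12 ?q00 ?q11.
all: by field.
Qed.

(** A half turn about an orthogonal axis reverses [axis] and preserves this entry; evenness later
    yields [v1 0 = 0]. *)
Lemma equivariant_even (r : R) : A (r *: axis) ->
  Q (- r *: axis) o2 o2 = Q (r *: axis) o2 o2.
Proof.
move=> Ar; have : mx3 1 0 0 0 (-1) 0 0 0 (-1) *m (r *: axis) = - r *: axis :> 'cV[R]_3.
  by rewrite -scalemxAr scaleNr -scalerN; congr (_ *: _); apply: cV3P;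
    rewrite mul_axis !mxE /= ?oppr0.
by move=> <-; rewrite QO//; [rewrite conjE !mxE /=; ring | exact: flip_x].
Qed.

(** All rotations fix the origin: the cyclic permutation of the axes equates the diagonal entries of
    a multiple of [hedge_mx axis], which are in the ratio [-1 : -1 : 2]. *)
Lemma equivariant_origin : A 0 -> Q 0 = 0.
Proof.
move=> A0; have A0' : A (0 *: axis) by rewrite scale0r.
have := equivariant_axis A0'; rewrite scale0r => E.
have c00 : Q 0 o0 o0 = Q 0 o2 o2.
  have := fixed o0 o0 cycle_axes A0 (mulmx0 _ _).
  rewrite conjE !mxE /=; lra.
have : Q 0 o2 o2 = 0.
  move: c00; rewrite {1}E mxE hedge_mxE /hedge /dlt sqnormE !mxE /=; lra.
by move=> q0; rewrite E q0 mulr0 scale0r.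
Qed.

Lemma equivariant_hedgehog x : (forall r O, SO3 O -> A (r *: (O *m axis)) -> A (r *: axis)) ->
  A x -> x != 0 ->
  Q x = (3 / 2 * Q (enorm x *: axis) o2 o2 / enorm x ^+ 2) *: hedge_mx x.
Proof.
move=> AO Ax x0; have e0 := lt0r_neq0 (enorm_gt0 x0).
pose n := (enorm x)^-1 *: x.
have n1 : sqnorm n = 1.
  have : sqnorm n = (enorm x) ^- 2 * sqnorm x by rewrite !sqnormE !mxE; field.
  by move=> ->; rewrite -enorm_sqr mulVf// expf_neq0.
have [U HU On] := rotate_axis n1.
have xE : x = U *m (enorm x *: axis) by rewrite -scalemxAr On scalerA mulfV// scale1r.
have Ae : A (enorm x *: axis) by apply: (AO _ U) => //; rewrite scalemxAr -xE.
set q := 3 / 2 * _; rewrite {1}xE QO// equivariant_axis// -scalemxAr -scalemxAl -hedge_mx_SO3//.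
rewrite -/q -scalerA; congr (_ *: _).
rewrite On /n; apply/matrixP => i j; rewrite [RHS]mxE !hedge_mxE /hedge !sqnormE !mxE.
by field.
Qed.
End Equivariant.

(** * The profile of a symmetric solution *)

Lemma is_derive_ray {R : realType} {V : normedModType R} (F : V -> R) (e : V) (r d : R) :
  is_derive (r *: e) e F d -> is_derive r 1 (fun t => F (t *: e)) d.
Proof.
move=> /is_derive_on_line H; apply: is_derive_line.
have -> : (fun h : R => F ((h *: 1 + r) *: e)) = (fun h => F (h *: e + r *: e)).
  by apply/funext => h; rewrite scalerDl [h *: 1]mulr1.
exact: H.
Qed.

Lemma is_derive_eps {R : realType} (f : R -> R) (x d e : R) : is_derive x 1 f d -> 0 < e ->
  exists2 a, 0 < a & forall h, `|h| < a -> `|f (x + h) - f x - d * h| <= e * `|h|.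
Proof.
move=> [Df dE] e0; have := Df; rewrite /derivable => /cvg_ex[l Hl].
have ld : l = d by rewrite -dE; apply/esym/cvg_lim.
move: Hl; rewrite ld => /cvgrPdist_le /(_ e e0) /nbhs_ballP [a /= a0 Ha].
exists a => // h ha; have [->|h0] := eqVneq h 0.
  by rewrite addr0 subrr mulr0 subrr !normr0 mulr0.
have := Ha h; rewrite /ball /= sub0r normrN => /(_ ha h0).
change (`|d - h^-1 * (f (h * 1 + x) - f x)| <= e -> `|f (x + h) - f x - d * h| <= e * `|h|).
rewrite mulr1 [h + x]addrC => H.
have -> : f (x + h) - f x - d * h = - (d - h^-1 * (f (x + h) - f x)) * h by field.
by rewrite normrM normrN ler_wpM2r.
Qed.

Lemma is_derive_unique {R : realType} (f : R -> R) (x c d : R) :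
  is_derive x 1 f c -> is_derive x 1 f d -> c = d.
Proof. by move=> [_ <-] [_ <-]. Qed.

Lemma oball_open {R : realType} (rho : \bar R) : open (@oball R rho).
Proof.
case: rho => [r||].
- have -> : oball r%:E = @enorm R @^-1` [set t | t < r].
    by apply/seteqP; split => x; rewrite /oball /= lte_fin.
  by apply: open_comp; [move=> x _; exact: enorm_cont | exact: open_lt].
- have -> : oball +oo%E = [set: 'cV[R]_3]; last exact: openT.
  by apply/seteqP; split => x // _; rewrite /oball /= ltry.
- have -> : oball -oo%E = set0 :> set 'cV[R]_3; last exact: open0.
  by apply/seteqP; split => x //; rewrite /oball /= ltNge leNye.
Qed.

Lemma enorm_axis {R : realType} (r : R) : enorm (r *: @axis R) = `|r|.
Proof. by rewrite -[r *: _]addr0 enorm_line. Qed.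

Lemma splus_gt0 {R : realType} (a2 b2 c2 : R) : 0 < a2 -> 0 <= b2 -> 0 < c2 ->
  0 < splus a2 b2 c2.
Proof.
move=> a0 b0 c0; apply: divr_gt0; last by rewrite mulr_gt0.
by rewrite ltr_wpDl// sqrtr_gt0 ltr_wpDl ?sqr_ge0// !mulr_gt0.
Qed.

Lemma splus_root {R : realType} (a2 b2 c2 : R) : 0 < a2 -> 0 < c2 ->
  2 * c2 * splus a2 b2 c2 ^+ 2 = b2 * splus a2 b2 c2 + 3 * a2.
Proof.
move=> a0 c0; rewrite /splus; set t := Num.sqrt _.
have t2 : t ^+ 2 = b2 ^+ 2 + 24 * a2 * c2.
  by rewrite sqr_sqrtr// addr_ge0 ?sqr_ge0// !mulr_ge0// ltW.
have -> : 2 * c2 * ((b2 + t) / (4 * c2)) ^+ 2 = (b2 ^+ 2 + 2 * b2 * t + t ^+ 2) / (8 * c2).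
  by field; rewrite gt_eqF.
by rewrite t2; field; rewrite gt_eqF.
Qed.

Section Coefficients.
Context {R : realType} (a2 b2 c2 al : R).
Hypotheses (ha : 0 < a2) (hb : 0 <= b2) (hc : 0 < c2) (hal : 0 < al).
Let s := splus a2 b2 c2.
Let s0 : 0 < s. Proof. exact: splus_gt0. Qed.

(** These coefficients [C] and [D] factor the bulk quadratic [- a2 - b2/3 V + 2 c2/3 V^2] as
    [al (V - s) (C V + D)] with [s = splus a2 b2 c2]; they match its leading and constant terms. *)
Definition lead_coeff := 2 * c2 / (3 * al).
Definition tail_coeff := a2 / (al * splus a2 b2 c2).

(** After clearing denominators, [D <= C * s] reads [3 a2 <= 2 c2 s^2], and the right side is
    [3 a2 + b2 s] by [splus_root]. *)
Lemma coeffs_ok : cubic_ok lead_coeff tail_coeff (splus a2 b2 c2).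
Proof.
split => //.
- by rewrite divr_gt0 ?mulr_gt0.
- by apply: divr_gt0 => //; apply: mulr_gt0 => //; exact: s0.
- have als : 0 < al * s by apply: mulr_gt0 => //; exact: s0.
  rewrite /lead_coeff /tail_coeff -/s ler_pdivrMr//.
  have -> : 2 * c2 / (3 * al) * s * (al * s) = 2 * c2 * s ^+ 2 / 3.
    by field; rewrite gt_eqF.
  by rewrite /s splus_root// -/s; have := mulr_ge0 hb (ltW s0); lra.
Qed.

Lemma coeffs_cubic (V : R) : - a2 - b2 / 3 * V + 2 * c2 / 3 * V ^+ 2 =
  al * cubic lead_coeff tail_coeff (splus a2 b2 c2) V.
Proof.
rewrite /cubic /lead_coeff /tail_coeff -/s.
have E : b2 = (2 * c2 * s ^+ 2 - 3 * a2) / s.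
  by rewrite /s splus_root// -/s; field; rewrite gt_eqF.
by rewrite E; field; rewrite !gt_eqF.
Qed.
End Coefficients.

(** * Extraction of the profile and of its equation *)

Section Solution.
Context {R : realType} (rho : \bar R) (a2 b2 c2 L1 L2 L3 : R).
Hypotheses (hrho : (0 < rho)%E) (ha : 0 < a2) (hc : 0 < c2) (hb : 0 <= b2).
Let al := 2 * L1 + 4 * (L2 + L3) / 3.
Hypothesis hal : 0 < al.
Let s := splus a2 b2 c2.
Variable Q : 'cV[R]_3 -> 'M[R]_3.
Hypothesis HQ : classical_solution L1 L2 L3 a2 b2 c2 rho Q.
Hypothesis SQ : radially_symmetric (oball rho) Q.

Let A := @oball R rho.

Let AO (O : 'M[R]_3) x : SO3 O -> A x -> A (O *m x).
Proof. by move=> HO; rewrite /A /oball /= enorm_SO3. Qed.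

Let QO O : SO3 O -> forall x, A x -> Q (O *m x) = O *m Q x *m O^T.
Proof.
apply: radially_symmetric_everywhere => //; first exact: oball_open.
by move=> x Ax i j; case: HQ => _ H _ _ _; case: (H i j x Ax).
Qed.

Let QS x : A x -> S0 (Q x). Proof. by case: HQ => H _ _ _ _; exact: H. Qed.

Let axA r : (`|r|%:E < rho)%E -> A (r *: axis).
Proof. by rewrite /A /oball /= enorm_axis. Qed.

Let F x := Q x o2 o2.
(** On the axis the last diagonal entry of the hedgehog tensor is [2/3 r^2], so this is [r^2 w].
    Negative [r] are included, so that derivatives at [0] are two-sided. *)
Definition sol_v (r : R) := 3 / 2 * F (r *: axis).
Definition sol_v1 (r : R) := 3 / 2 * partial o2 F (r *: axis).
Definition sol_v2 (r : R) := 3 / 2 * partial o2 (partial o2 F) (r *: axis).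
Local Notation v := sol_v.
Local Notation v1 := sol_v1.
Local Notation v2 := sol_v2.

Let dv (r : R) : (`|r|%:E < rho)%E -> is_derive r 1 v (v1 r).
Proof.
move=> /axA Ar; have [_ H _ _ _] := HQ; have [_ /(_ o2)[Df _ _]] := H o2 o2 _ Ar.
have H1 := is_derive_ray (derivableP Df).
by rewrite /v; derive_eq; rewrite !(mulr0, addr0).
Qed.

Let dv1 (r : R) : (`|r|%:E < rho)%E -> is_derive r 1 v1 (v2 r).
Proof.
move=> /axA Ar; have [_ H _ _ _] := HQ.
have [_ /(_ o2)[_ _ /(_ o2)[Df _]]] := H o2 o2 _ Ar.
have H1 := is_derive_ray (derivableP Df).
by rewrite /v1; derive_eq; rewrite !(mulr0, addr0).
Qed.

Let v_even (r : R) : (`|r|%:E < rho)%E -> v (- r) = v r.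
Proof. by move=> /axA Ar; rewrite /v /F (equivariant_even QO). Qed.

Let rho_0 : (`|0 : R|%:E < rho)%E. Proof. by rewrite normr0. Qed.

Let v_0 : v 0 = 0.
Proof.
rewrite /v /F scale0r (equivariant_origin QS QO) ?mxE ?mulr0//.
by rewrite -(scale0r axis); exact: axA.
Qed.

Let rad : exists2 d, 0 < d & forall r : R, `|r| < d -> (`|r|%:E < rho)%E.
Proof.
have [d d0 drho] := ereal_between hrho.
by exists d => // r rd; apply: lte_finW drho; exact: ltW.
Qed.

Let v1_0 : v1 0 = 0.
Proof.
have [d d0 Hd] := rad.
have D0 := dv rho_0.
have DN : is_derive (0 : R) 1 (fun t => v (- t)) (- v1 0).
  have H1 : is_derive (0 : R) 1 (fun t : R => - t) (- 1) by derive_eq.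
  have H2 : is_derive (- (0 : R)) 1 v (v1 0) by rewrite oppr0.
  have := @is_derive1_comp R v (fun t => - t) 0 _ _ H2 H1.
  by rewrite mulrN1.
have := is_derive_unique D0 (near_eq_is_derive _ DN).
have near_even : \forall t \near (0 : R), v (- t) = v t.
  apply/nbhs_ballP; exists d => //= t; rewrite /ball /= sub0r normrN => td.
  exact/v_even/Hd.
by move=> /(_ near_even); lra.
Qed.

(** The value at [0] is the Taylor limit of [v / r^2], since [v] and [v1] vanish there. *)
Definition sol_w (r : R) := if r == 0 then v2 0 / 2 else v r / r ^+ 2.
Definition sol_w1 (r : R) := v1 r / r ^+ 2 - 2 * v r / r ^+ 3.
Definition sol_h (r : R) :=
  v2 r / r ^+ 2 - 4 * v1 r / r ^+ 3 + 6 * v r / r ^+ 4 + 6 * sol_w1 r / r.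

Let absr (r : R) : 0 < r -> (r%:E < rho)%E -> (`|r|%:E < rho)%E.
Proof. by move=> r0; rewrite gtr0_norm. Qed.

Let dw (r : R) : 0 < r -> (r%:E < rho)%E -> is_derive r 1 sol_w (sol_w1 r).
Proof.
move=> r0 rrho; have H1 := dv (absr r0 rrho).
have H : is_derive r 1 (fun t => v t / t ^+ 2) (sol_w1 r).
  derive_eq; first by rewrite expf_neq0// gt_eqF.
  by rewrite /sol_w1; field; rewrite gt_eqF.
apply: near_eq_is_derive H; near=> t.
by rewrite /sol_w gt_eqF//; near: t; exact: lt_nbhsr.
Unshelve. all: by end_near. Qed.

Let dw1 (r : R) : 0 < r -> (r%:E < rho)%E ->
  is_derive r 1 sol_w1 (sol_h r - 6 * sol_w1 r / r).
Proof.
move=> r0 rrho; have H1 := dv (absr r0 rrho); have H2 := dv1 (absr r0 rrho).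
rewrite /sol_w1; derive_eq.
- by rewrite expf_neq0// gt_eqF.
- by rewrite expf_neq0// gt_eqF.
- by rewrite /sol_h /sol_w1 /=; field; rewrite gt_eqF.
Qed.

Lemma sol_quad (r : R) : r != 0 -> r ^+ 2 * sol_w r = v r.
Proof. by move=> r0; rewrite /sol_w (negbTE r0); field. Qed.

Lemma sol_form x : A x -> x != 0 -> Q x = radial_tensor sol_w x.
Proof.
move=> Ax x0; rewrite (equivariant_hedgehog QS QO _ Ax x0).
  by rewrite radial_tensor_mx /sol_w enorm_eq0 (negbTE x0).
by move=> r O HO; rewrite /A /oball /= scalemxAr enorm_SO3.
Qed.

(** The system is read at the single point [r] times the axis and in the last diagonal entry, where
    the tensor is [2/3 r^2] and can be cancelled. Removing the origin from [U] allows the chain rule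
    through [enorm]. *)
Lemma sol_ode (r : R) : 0 < r -> (r%:E < rho)%E ->
  sol_h r = sol_w r * cubic (lead_coeff c2 al) (tail_coeff a2 b2 c2 al) s (r ^+ 2 * sol_w r).
Proof.
move=> r0 rrho; pose x : 'cV[R]_3 := r *: axis.
have ex : enorm x = r by rewrite enorm_axis gtr0_norm.
have Ax : A x by apply: axA; rewrite gtr0_norm.
have x0 : x != 0 by rewrite -enorm_eq0 ex gt_eqF.
pose U : set 'cV[R]_3 := A `&` [set x | x != 0].
have oU : open U.
  apply: openI; first exact: oball_open.
  by rewrite openE => y /= y0; exact: near_neq0.
have HC : radial_C2 U sol_w (quot1 sol_h sol_w1) (quot2 sol_h sol_w1).
  apply: radial_C2_punctured => y [Ay y0]; have e0 := enorm_gt0 y0.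
  by split; [exact: y0 | exact: dw | exact: dw1].
have QE y : U y -> forall i j, Q y i j = sol_w (enorm y) * hedge i j y.
  by move=> [Ay y0] i j; rewrite sol_form// radial_tensorE.
have := @tensor_elastic R U _ _ _ oU HC Q QE L1 L2 L3 x o2 o2 (conj Ax x0).
have [_ _ _ EL _] := HQ.
rewrite (EL x Ax) quot12 {1 2}sol_form// radial_tensor_rhs -/al ex => E.
have sx : sqnorm x = r ^+ 2 by rewrite -enorm_sqr ex.
have p0 : hedge o2 o2 x != 0.
  have -> : hedge o2 o2 x = 2 / 3 * r ^+ 2 by rewrite /hedge /dlt sx !mxE /=; field.
  by rewrite gt_eqF// mulr_gt0 ?exprn_gt0.
have aln0 : al != 0 by rewrite gt_eqF.
move: E; rewrite sx (coeffs_cubic ha hb hc hal) -/s.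
set K := cubic _ _ _ _ => E.
have : al * hedge o2 o2 x * sol_h r = al * hedge o2 o2 x * (sol_w r * K) by lra.
by apply: mulfI; rewrite mulf_neq0.
Qed.

(** Near [0] the derivative [v1 x] lies within [e x] of [v2 0 * x]; integrating, [v t] lies within
    [e t^2 / 2] of [v2 0 * t^2 / 2]. *)
Let w_cont0 : {for 0, continuous sol_w}.
Proof.
apply/continuous_distP => e e0.
have [d d0 Hd] := rad.
have [a a0 Ha] := is_derive_eps (dv1 rho_0) e0.
pose m := Num.min a d; have m0 : 0 < m by rewrite lt_min a0.
have pos (t : R) : 0 < t -> t < m -> `|v2 0 / 2 - v t / t ^+ 2| <= e.
  rewrite lt_min => t0 /andP[ta td].
  have in_ x : 0 <= x -> x <= t -> (`|x|%:E < rho)%E.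
    by move=> x0 xt; apply: Hd; rewrite ger0_norm//; lra.
  have b x : 0 < x -> x <= t -> `|v1 x - v2 0 * x| <= e * x.
    move=> x0 xt; have := Ha x; rewrite gtr0_norm// add0r v1_0 subr0; apply; lra.
  have up : v t - (v2 0 + e) / 2 * t ^+ 2 <= v 0 - (v2 0 + e) / 2 * 0 ^+ 2.
    apply: (@nonincr_of_derive R (fun x => v x - (v2 0 + e) / 2 * x ^+ 2)
      (fun x => v1 x - (v2 0 + e) * x)) => [|x /andP[x0 xt]|x /andP[x0 xt]|x /andP[x0 xt]].
    - exact: ltW.
    - have H := dv (in_ x x0 xt).
      apply: (@is_derive_continuous _ _ _ (v1 x - (v2 0 + e) * x)).
      by derive_eq; rewrite /=; field.
    - have H := dv (in_ x (ltW x0) (ltW xt)).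
      by derive_eq; rewrite /=; field.
    - by have := b x x0 (ltW xt); rewrite ler_norml; lra.
  have dn : v 0 - (v2 0 - e) / 2 * 0 ^+ 2 <= v t - (v2 0 - e) / 2 * t ^+ 2.
    apply: (@nondecr_of_derive R (fun x => v x - (v2 0 - e) / 2 * x ^+ 2)
      (fun x => v1 x - (v2 0 - e) * x)) => [|x /andP[x0 xt]|x /andP[x0 xt]|x /andP[x0 xt]].
    - exact: ltW.
    - have H := dv (in_ x x0 xt).
      apply: (@is_derive_continuous _ _ _ (v1 x - (v2 0 - e) * x)).
      by derive_eq; rewrite /=; field.
    - have H := dv (in_ x (ltW x0) (ltW xt)).
      by derive_eq; rewrite /=; field.
    - by have := b x x0 (ltW xt); rewrite ler_norml; lra.
  move: up dn; rewrite v_0 expr0n /= !mulr0 subr0 => up dn.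
  have t2 : 0 < t ^+ 2 by rewrite exprn_gt0.
  have h1 : v t / t ^+ 2 <= (v2 0 + e) / 2 by rewrite ler_pdivrMr//; lra.
  have h2 : (v2 0 - e) / 2 <= v t / t ^+ 2 by rewrite ler_pdivlMr//; lra.
  by rewrite ler_norml; apply/andP; split; lra.
apply/nbhs_ballP; exists m => //= t; rewrite /ball /= sub0r normrN => tm.
rewrite {1}/sol_w eqxx; have [t0|t0|->] := ltgtP t 0.
- rewrite /sol_w lt_eqF// -v_even.
    by rewrite -sqrrN; apply: pos; rewrite ?oppr_gt0// -ltr0_norm.
  by apply: Hd; apply: lt_le_trans tm _; rewrite ge_min lexx orbT.
- by rewrite /sol_w gt_eqF//; apply: pos => //; rewrite -(gtr0_norm t0).
- by rewrite /sol_w eqxx subrr normr0 ltW.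
Qed.

Let sol_w_near0 : exists M d, 0 < d /\
  forall r, 0 < r < d -> `|r ^+ 6 * sol_w1 r| <= M * r.
Proof.
have [a a0 Ha] := is_derive_eps (dv1 rho_0) ltr01.
have [b b0 Hb] := is_derive_eps (dv rho_0) ltr01.
exists (`|v2 0| + 3), (Num.min (Num.min a b) 1); split.
  by rewrite !lt_min a0 b0 ltr01.
move=> r /andP[r0]; rewrite !lt_min => /andP[/andP[ra rb] r1].
have := Ha r; rewrite gtr0_norm// add0r v1_0 subr0 mul1r => /(_ ra) h1.
have := Hb r; rewrite gtr0_norm// add0r v_0 v1_0 subr0 mul0r subr0 mul1r => /(_ rb) h2.
have -> : r ^+ 6 * sol_w1 r = r ^+ 4 * v1 r - 2 * (r ^+ 3 * v r).
  by rewrite /sol_w1; field; rewrite gt_eqF.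
have g1 : `|v1 r| <= `|v2 0| + 1.
  have -> : v1 r = (v1 r - v2 0 * r) + v2 0 * r by ring.
  apply: (le_trans (ler_normD _ _)); rewrite addrC normrM (gtr0_norm r0).
  apply: lerD; last by apply: (le_trans h1); exact: ltW.
  by rewrite ler_piMr// ltW.
have g2 : `|v r| <= 1 by apply: (le_trans h2); exact: ltW.
have p n : r ^+ n.+1 <= r by rewrite -[leRHS]expr1 ler_wiXn2l ?ltW.
have p0 n : 0 <= r ^+ n by rewrite exprn_ge0// ltW.
apply: (le_trans (ler_normB _ _)).
rewrite (normrM (r ^+ 4)) (normrM 2) (normrM (r ^+ 3)) (ger0_norm (p0 4%N)) (ger0_norm (p0 3%N)).
have k1 : r ^+ 4 * `|v1 r| <= r * (`|v2 0| + 1) by apply: ler_pM.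
have k2 : r ^+ 3 * `|v r| <= r * 1 by apply: ler_pM.
by rewrite (ger0_norm (x := 2))//; lra.
Qed.

Lemma hedgehog_axis (r : R) : 0 < r -> hedgehog s (r *: axis) = s *: hedge_mx axis.
Proof.
move=> r0; rewrite /hedgehog enorm_axis gtr0_norm// scalerA mulVf ?gt_eqF// scale1r.
by rewrite /hedge_mx sqnormE !mxE /= expr0n expr1n !add0r mul1r.
Qed.

Let sol_bc eps : 0 < eps -> exists2 M, (M%:E < rho)%E &
    forall r, M < r -> 0 < r -> (r%:E < rho)%E -> `|r ^+ 2 * sol_w r - s| < eps.
Proof.
move=> eps0; have [_ _ cQ _ [bc1 bc2]] := HQ.
have h22 : hedge_mx (@axis R) o2 o2 = 2 / 3.
  by rewrite hedge_mxE /hedge /dlt sqnormE !mxE /=; field.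
(* For finite [rho] the compared entry is [2/3] of [v - s]; for infinite [rho] the norm is
   [sqrt (2/3) |v - s|], and the same tolerance suffices. *)
have e0 : 0 < 2 / 3 * eps by rewrite mulr_gt0.
case rhoE : rho => [r0||].
- have r0_gt0 : 0 < r0 by have := hrho; rewrite rhoE lte_fin.
  pose x0 : 'cV[R]_3 := r0 *: axis.
  have ex0 : enorm x0 = r0 by rewrite enorm_axis gtr0_norm.
  have Qx0 : Q x0 o2 o2 = s * (2 / 3).
    by rewrite bc1 ?ex0 ?rhoE// hedgehog_axis// mxE h22.
  have cx0 : cball rho x0 by rewrite /cball /= ex0 rhoE.
  have := cQ; rewrite subspace_continuousP => /(_ x0 cx0) cQ0.
  have cF : Q x o2 o2 @[x --> within (cball rho) (nbhs x0)] --> Q x0 o2 o2.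
    apply: (@cvg_comp _ _ _ Q (fun M : 'M[R]_3 => M o2 o2) _ (nbhs (Q x0))) => //.
    exact: coord_cont.
  move/cvgrPdist_lt: cF => /(_ _ e0) /nbhs_ballP[d /= d0 Hd].
  exists (r0 - d); first by rewrite lte_fin; lra.
  move=> r rd r_gt0; rewrite lte_fin => rr0; rewrite sol_quad ?gt_eqF// /v /F.
  have := Hd (r *: axis); rewrite Qx0 => H.
  have {H} : `|s * (2 / 3) - Q (r *: axis) o2 o2| < 2 / 3 * eps.
    apply: H; last by rewrite /cball /= enorm_axis gtr0_norm// rhoE lee_fin ltW.
    split => // i j; rewrite /x0 !mxE /ball /= -mulrBl normrM gtr0_norm ?subr_gt0//.
    case: (_ && _); rewrite ?normr1 ?mulr1 ?normr0 ?mulr0//; lra.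
  by rewrite !ltr_norml; lra.
- have [M HM] := bc2 rhoE _ e0; exists M; first by rewrite ltry.
  move=> r Mr r_gt0 _; have Mr' : M < enorm (r *: @axis R) by rewrite enorm_axis gtr0_norm.
  have := HM _ Mr'; rewrite hedgehog_axis// sol_quad ?gt_eqF//.
  have Ar : A (r *: axis) by apply: axA; rewrite rhoE ltry.
  have -> : Q (r *: axis) - s *: hedge_mx axis = (v r - s) *: hedge_mx axis.
    by rewrite scalerBl; congr (_ - _); exact: (equivariant_axis QS QO).
  set c := v r - s.
  have -> : qnorm (c *: hedge_mx (@axis R)) = Num.sqrt (c ^+ 2 * (2 / 3)).
    congr Num.sqrt; rewrite /qnorm2 -scalemxAl -scalemxAr !mxtraceZ mulrA -expr2.
    congr (_ * _); rewrite /mxtrace (sum3E (fun k => (hedge_mx axis *m hedge_mx axis) k k)).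
    by rewrite !mx3_mul !hedge_mxE /hedge /dlt sqnormE !mxE /=; field.
  have c0 : 0 <= c ^+ 2 * (2 / 3) by rewrite mulr_ge0 ?sqr_ge0.
  rewrite -(ltr_pXn2r (ltn0Sn 1)) ?nnegrE ?sqrtr_ge0 ?(ltW e0)// sqr_sqrtr// => H.
  rewrite -(ltr_pXn2r (ltn0Sn 1)) ?nnegrE ?(ltW eps0)// real_normK ?num_real//.
  by have := exprn_gt0 2 eps0; move: H; rewrite exprMn; lra.
- by have := hrho; rewrite rhoE ltNge leNye.
Qed.

Lemma sol_profile :
  radial_profile (lead_coeff c2 al) (tail_coeff a2 b2 c2 al) s rho sol_w sol_w1.
Proof.
split.
- move=> r; rewrite le_eqVlt => /orP[/eqP <- _|r0 rrho]; first exact: w_cont0.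
  exact: is_derive_continuous (dw r0 rrho).
- exact: dw.
- by move=> r r0 rrho; rewrite -(sol_ode r0 rrho); exact: dw1.
- exact: sol_w_near0.
- exact: sol_bc.
Qed.

Lemma sol_origin : Q 0 = radial_tensor sol_w 0.
Proof.
have A0 : A 0 by rewrite -(scale0r axis); exact: axA.
rewrite (equivariant_origin QS QO A0) radial_tensor_mx.
by rewrite /hedge_mx mul0mx sqnormE !mxE expr0n /= !addr0 mul0r raddf0 subr0 scaler0.
Qed.
End Solution.

Theorem theorem1p4 (R : realType) (rho : \bar R) (a2 b2 c2 L1 L2 L3 : R)
    (hrho : (0 < rho)%E) (ha : 0 < a2) (hc : 0 < c2) (hb : 0 <= b2)
    (halpha : 0 < 2 * L1 + 4 * (L2 + L3) / 3) :
  exists Q : 'cV[R]_3 -> 'M[R]_3,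
    [/\ classical_solution L1 L2 L3 a2 b2 c2 rho Q,
        radially_symmetric (oball rho) Q &
        forall Q' : 'cV[R]_3 -> 'M[R]_3,
          classical_solution L1 L2 L3 a2 b2 c2 rho Q' ->
          radially_symmetric (oball rho) Q' ->
          forall x, cball rho x -> Q' x = Q x].
Proof.
set al := 2 * L1 + _ in halpha.
pose s := splus a2 b2 c2; pose C := lead_coeff c2 al; pose D := tail_coeff a2 b2 c2 al.
have hyp : cubic_ok C D s by exact: coeffs_ok.
have s0 : 0 < s by exact: splus_gt0.
have [w [w1 [W cw w0 Y bdry]]] := profile_exists hyp hrho.
have ch : continuous (fun r => trunc C D s r (w r)) by exact: trunc_cont.
have hedgehogE x : x != 0 -> hedgehog s x = (s / enorm x ^+ 2) *: hedge_mx x.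
  move=> x0; have e0 := lt0r_neq0 (enorm_gt0 x0).
  apply/matrixP => i j; rewrite /hedgehog /hedge_mx -enorm_sqr !mxE !big_ord1 !mxE.
  by case: (i == j); rewrite ?mulr1n ?mulr0n; field.
have bc1 x : (enorm x)%:E = rho -> radial_tensor w x = hedgehog s x.
  move=> xrho; have x0 : x != 0.
    by rewrite -enorm_eq0; apply/eqP => x0; have := hrho; rewrite -xrho x0 ltxx.
  rewrite hedgehogE// radial_tensor_mx; congr (_ *: _).
  rewrite -(bdry _ xrho); field; exact: lt0r_neq0 (enorm_gt0 x0).
exists (radial_tensor w); split.
- split.
  + by move=> x _; exact: radial_tensor_S0.
  + by move=> i j; exact: radial_tensor_C2 ch cw Y.
  + apply: continuous_subspaceT => x; apply: mx_continuous => i j.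
    by have [] := @radial_tensor_C2 R _ w w1 setT i j ch cw Y x I.
  + move=> x Ax i j.
    have HC := radial_C2_global ch Y.
    rewrite (@tensor_elastic R setT _ _ _ openT HC (radial_tensor w)
      (fun y _ i j => radial_tensorE w y i j) L1 L2 L3 x i j I) quot12 radial_tensor_rhs.
    rewrite -/al (coeffs_cubic ha hb hc halpha).
    (* The bounds on a profile make the truncation inactive, so the constructed [w] solves the
       original equation. *)
    have w_ge0 : 0 <= w (enorm x) by apply/ltW/(profile_gt0 hyp W) => //; exact: enorm_ge0.
    have w_le : enorm x ^+ 2 * w (enorm x) <= s.
      by apply: (profile_le hyp W) => //; exact: enorm_ge0.
    by rewrite trunc_id// enorm_sqr; ring.
  + split => // rhoE eps eps0.
    have eps1 : 0 < eps / 2 by rewrite divr_gt0.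
    have [M Mrho HM] := profile_bc W eps1.
    exists (Num.max M 0) => x; rewrite gt_max => /andP[Mx x_gt0].
    have x0 : x != 0 by rewrite -enorm_eq0 gt_eqF.
    have xrho : ((enorm x)%:E < rho)%E by rewrite rhoE ltry.
    have := HM _ Mx x_gt0 xrho.
    rewrite hedgehogE// radial_tensor_mx -scalerBl.
    set c := w (enorm x) - s / enorm x ^+ 2.
    have -> : enorm x ^+ 2 * w (enorm x) - s = enorm x ^+ 2 * c.
      by rewrite /c; field; rewrite gt_eqF.
    have trH : \tr (hedge_mx x *m hedge_mx x) = 2 / 3 * sqnorm x ^+ 2.
      rewrite /mxtrace (eq_bigr (fun k => sqnorm x / 3 * hedge k k x +
          (k == k)%:R * (2 / 9 * sqnorm x ^+ 2))); last first.
        move=> k _; rewrite mxE -hedge_sq; apply: eq_bigr => l _.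
        by rewrite !hedge_mxE.
      rewrite big_split /= -mulr_sumr hedge_tr mulr0 add0r.
      by rewrite (sum3E (fun k : 'I_3 => (k == k)%:R * (2 / 9 * sqnorm x ^+ 2))) /=; field.
    have -> : qnorm (c *: hedge_mx x) = Num.sqrt ((enorm x ^+ 2 * c) ^+ 2 * (2 / 3)).
      congr Num.sqrt; rewrite /qnorm2 -scalemxAl -scalemxAr !mxtraceZ trH -enorm_sqr.
      by ring.
    set b := enorm x ^+ 2 * c => Hb.
    have b0 : 0 <= b ^+ 2 * (2 / 3) by rewrite mulr_ge0 ?sqr_ge0.
    rewrite -(ltr_pXn2r (ltn0Sn 1)) ?nnegrE ?sqrtr_ge0 ?(ltW eps0)// sqr_sqrtr//.
    have Hb2 : b ^+ 2 < (eps / 2) ^+ 2.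
      by rewrite -[b ^+ 2]real_normK ?num_real// ltr_pXn2r ?nnegrE ?(ltW eps1).
    have := exprn_gt0 2 eps0; move: Hb2; rewrite exprMn.
    by have := sqr_ge0 b; lra.
- exact: radial_tensor_symmetric.
- move=> Q' HQ' SQ' x Cx.
  have [xrho|xrho] := eqVneq (enorm x)%:E rho.
    by rewrite bc1//; case: HQ' => _ _ _ _ [-> ].
  have Ax : oball rho x by rewrite /oball /= lt_neqAle xrho.
  (* Inside the ball [Q'] is the radial tensor of its own profile, which agrees with [w] by
     [profile_unique]; at the origin both tensors vanish. *)
  have P := sol_profile hrho ha hc hb halpha HQ' SQ'.
  have [->|x0] := eqVneq x 0.
    rewrite (sol_origin hrho HQ' SQ') !radial_tensor_mx.
    by rewrite /hedge_mx mul0mx sqnormE !mxE expr0n /= !addr0 mul0r raddf0 subr0 !scaler0.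
  rewrite (sol_form HQ' SQ' Ax x0) !radial_tensor_mx.
  by rewrite (profile_unique hyp P W (enorm_ge0 x) Ax).
Qed.
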